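(* Let $q$ be a complex number with $0<|q|<1$ and let $b,c,d$ be complex numbers with $|q/b|<1$. Then (i) $${}_9\psi_9\!\left[\begin{matrix}(q/b)^{1/2},-(q/b)^{1/2},(q^2/b)^{1/2},-(q^2/b)^{1/2},b,c,d,b/c,b/d\\ (qb)^{1/2},-(qb)^{1/2},b^{1/2},-b^{1/2},q/b,q/c,q/d,cq/b,dq/b\end{matrix};q,\frac qb\right]$$ $$=\frac{\left(q,\frac bc,\frac bd,\frac q{cd};q\right)_\infty}{\left(b,\frac qc,\frac qd,\frac b{cd};q\right)_\infty}\;{}_4\phi_3\!\left[\begin{matrix}b,c,d,cd\\ cq/b,dq/b,cdq/b\end{matrix};q,\frac{q^2}{b^2}\right]$$ $$+\frac{\left(q,c,d,\frac{cdq}{b^2};q\right)_\infty}{\left(b,\frac{cq}b,\frac{dq}b,\frac{cd}b;q\right)_\infty}\;{}_4\phi_3\!\left[\begin{matrix}b,b/c,b/d,b^2/(cd)\\ q/c,q/d,bq/(cd)\end{matrix};q,\frac{q^2}{b^2}\right];$$ (ii) $${}_9\psi_9\!\left[\begin{matrix}(q^2/b)^{1/2},-(q^2/b)^{1/2},(q^3/b)^{1/2},-(q^3/b)^{1/2},b,c,d,bq/c,bq/d\\ (q^2b)^{1/2},-(q^2b)^{1/2},(qb)^{1/2},-(qb)^{1/2},q^2/b,q^2/c,q^2/d,cq/b,dq/b\end{matrix};q,\frac qb\right]$$ $$=\frac{\left(q,\frac{bq}c,\frac{bq}d,\frac{q^2}{cd};q\right)_\infty}{\left(bq,\frac{q^2}c,\frac{q^2}d,\frac{bq}{cd};q\right)_\infty}\;{}_4\phi_3\!\left[\begin{matrix}b,c,d,cd/q\\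 cq/b,dq/b,cd/b\end{matrix};q,\frac{q^2}{b^2}\right]$$ $$+\frac{\left(q,c,d,\frac{cd}{b^2};q\right)_\infty}{\left(bq,\frac{cq}b,\frac{dq}b,\frac{cd}{bq};q\right)_\infty}\;{}_4\phi_3\!\left[\begin{matrix}b,bq/c,bq/d,b^2q/(cd)\\ q^2/c,q^2/d,bq^2/(cd)\end{matrix};q,\frac{q^2}{b^2}\right].$$
   Context: Notation. $(x;q)_\infty=\prod_{i=0}^\infty(1-xq^i)$ and, for every integer $n$, $(x;q)_n=(x;q)_\infty/(xq^n;q)_\infty$, i.e. $(x;q)_n=\prod_{i=0}^{n-1}(1-xq^i)$ for $n\ge0$ and $(x;q)_{-n}=\prod_{i=1}^{n}(1-xq^{-i})^{-1}$ for $n\geq 1$. For several parameters, $(x_1,\dots,x_s;q)_m=(x_1;q)_m\cdots(x_s;q)_m$. Bilateral series: ${}_s\psi_s\!\left[\begin{matrix}a_1,\dots,a_s\\ c_1,\dots,c_s\end{matrix};q,z\right]=\sum_{k=-\infty}^{\infty}\frac{(a_1,\dots,a_s;q)_k}{(c_1,\dots,c_s;q)_k}z^k.$ Unilateral series: ${}_4\phi_3\!\left[\begin{matrix}a_1,a_2,a_3,a_4\\ c_1,c_2,c_3\end{matrix};q,z\right]=\sum_{k=0}^\infty\frac{(a_1,a_2,a_3,a_4;q)_k}{(q,c_1,c_2,c_3;q)_k}z^k.$ $w^{1/2}$ denotes a square root of $w$; since every square root occurs together with its negative, the choices are immaterial. Standing convention: the parameters are such that every expression occurring is well defined (no denominator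 vanishes, including the denominator factors of the terms of the series). *)

(* Defs.v *)
From HB Require Import structures.
From mathcomp Require Import all_boot all_order all_algebra.
From mathcomp Require Import complex.
From mathcomp Require Import all_classical all_reals all_analysis.

Set Implicit Arguments.
Unset Strict Implicit.
Unset Printing Implicit Defensive.

Import Order.TTheory GRing.Theory Num.Theory.
Import numFieldNormedType.Exports.

Local Open Scope classical_set_scope.
Local Open Scope ring_scope.

(* The notions are set up over any algebraically closed numeric field, so that
   its norm topology is available; the intended field is R[i], R : realType. *)

(* (x;q)_oo *)
Definition qpoch_inf (C : numClosedFieldType) (q x : C) : C :=
  limn (fun n : nat => \prod_(0 <= i < n) (1 - x * q ^+ i)).

(* (x;q)_k for k : int; recall that Negz n is the integer -(n+1).
   If x = q ^+ i with 1 <= i <= n.+1, the symbol has a pole at Negz n. Since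
   0^-1 = 0, qpoch is then 0 and so is its inverse; the latter agrees with the
   regular function 1 / (x;q)_(-n-1) = \prod_(1 <= i < n.+2) (1 - x / q ^+ i).
   Hence qpoch is meaningful in a denominator without any condition at negative
   k, while in a numerator such x have to be excluded (see psi_defined). *)
Definition qpoch (C : numClosedFieldType) (q x : C) (k : int) : C :=
  match k with
  | Posz n => \prod_(0 <= i < n) (1 - x * q ^+ i)
  | Negz n => \prod_(1 <= i < n.+2) (1 - x / q ^+ i)^-1
  end.

Definition qpochs_inf (C : numClosedFieldType) (q : C) (xs : seq C) : C :=
  \prod_(x <- xs) qpoch_inf q x.

Definition qpochs (C : numClosedFieldType) (q : C) (xs : seq C) (k : int) : C :=
  \prod_(x <- xs) qpoch q x k.

(* A bilateral series converges when its two halves do. *)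
Definition bilateral_cvg (C : numClosedFieldType) (t : int -> C) : Prop :=
  cvgn (series (fun n : nat => t (Posz n))) /\
  cvgn (series (fun n : nat => t (Negz n))).

Definition bilateral_sum (C : numClosedFieldType) (t : int -> C) : C :=
  limn (series (fun n : nat => t (Posz n))) +
  limn (series (fun n : nat => t (Negz n))).

(* General term of the bilateral series s_psi_s. *)
Definition psi_term (C : numClosedFieldType) (a c : seq C) (q z : C) (k : int)
    : C :=
  qpochs q a k / qpochs q c k * z ^ k.

Definition psi (C : numClosedFieldType) (a c : seq C) (q z : C) : C :=
  bilateral_sum (psi_term a c q z).

(* General term of the unilateral series (s+1)_phi_s; c does not contain the
   lower parameter q. *)
Definition phi_term (C : numClosedFieldType) (a c : seq C) (q z : C) (k : nat)
    : C :=
  qpochs q a k%:Z / qpochs q (q :: c) k%:Z * z ^+ k.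

Definition phi (C : numClosedFieldType) (a c : seq C) (q z : C) : C :=
  limn (series (phi_term a c q z)).

(* No denominator factor of the terms of the series vanishes: at k >= 0 these
   come from the lower parameters, at k < 0 from the upper ones. *)
Definition psi_defined (C : numClosedFieldType) (a c : seq C) (q : C) : Prop :=
  (forall (x : C) (n : nat), x \in c -> 1 - x * q ^+ n != 0) /\
  (forall (x : C) (n : nat), x \in a -> 1 - x / q ^+ n.+1 != 0).

Definition phi_defined (C : numClosedFieldType) (c : seq C) (q : C) : Prop :=
  forall (x : C) (n : nat), x \in c -> 1 - x * q ^+ n != 0.

(* Main.v *)
(* Put a = 1 in (i) and a = q in (ii). Adding the terms of index k and -k,
   respectively k and -k-1, folds the bilateral series into a unilateral
   very-well-poised series of base a, and both parts become one identity between
   this series and two 4phi3.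

   If c = q^-N, the second 4phi3 drops out and the identity terminates; it is
   proved by induction on N, as an identity of polynomials in d.

   For general c and generic d, the difference E(c) of the two sides, cleared of
   poles, is analytic on the punctured plane. It vanishes at every zero of
   Q(c) = (c, ab/c, cd/(ab), qab/(cd); q)_oo: at c = q^-N by the terminating case,
   at c = a b q^N by the duality (c, d) -> (ab/c, ab/d), which preserves the
   identity, and at the zeros of the theta factor by an index shift. On suitable
   circles tending to 0 and oo the quotient E/Q tends to 0, so E = 0 by the
   maximum principle. A maximum principle for uniform limits of Laurent
   polynomials is enough, and this follows from bounds on their coefficients.
   The non-generic values of c and d reduce to the terminating case. *)

Require Import Defs.
From HB Require Import structures.
From mathcomp Require Import all_boot all_order all_algebra.
From mathcomp Require Import all_solvable all_field.
From mathcomp Require Import complex.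
From mathcomp Require Import all_classical all_reals all_analysis.
From mathcomp Require Import ring zify.

Set Implicit Arguments.
Unset Strict Implicit.
Unset Printing Implicit Defensive.

Import Order.TTheory GRing.Theory Num.Theory.
Import numFieldNormedType.Exports.

Local Open Scope classical_set_scope.
Local Open Scope ring_scope.

(** The terminating right side has two shapes: a convolution, invariant under d -> ab/d, and a
    terminating 4phi3, symmetric in q^-N and d. Neither symmetry is visible in the other shape;
    together they let the smaller cases supply 2N of the 2N + 1 values of d that a polynomial of
    degree 2N requires. The decay of E/Q comes from |q/b| < 1: a step z -> z/q multiplies
    (zq/b;q)_oo / (z;q)_oo by q/b, up to bounded factors. On the M-th large circle the k-th summand
    is thus at most of order r^max(k,M) relative to Q, r = |q/b|, hence of order r^((k+M)/2), which
    is summable in k and tends to 0 with M. The quotient E/Q itself is never formed. Laurent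
    polynomials close to E are small, but not 0, at the zeros of Q; subtracting an interpolating
    polynomial makes the division exact. As Q has infinitely many zeros, it is cut to finitely many
    factors, their number depending on the circles, and genericity of d keeps the remaining zeros
    simple. *)

(** * Finite q-products and their reversal *)

Section FiniteProducts.
Variables (F : fieldType) (q : F).

Definition qp (x : F) (n : nat) : F := \prod_(0 <= i < n) (1 - x * q ^+ i).

Lemma qp0 x : qp x 0 = 1.
Proof. by rewrite /qp big_geq. Qed.

Lemma qpSr x n : qp x n.+1 = qp x n * (1 - x * q ^+ n).
Proof. by rewrite /qp big_nat_recr. Qed.

Lemma qpD x m n : qp x (m + n) = qp x m * qp (x * q ^+ m) n.
Proof.
elim: n => [|n IHn]; first by rewrite addn0 qp0 mulr1.
by rewrite addnS !qpSr IHn exprD !mulrA.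
Qed.

Lemma qpS x n : qp x n.+1 = (1 - x) * qp (x * q) n.
Proof. by rewrite -add1n qpD qpSr qp0 !expr1 expr0 mul1r mulr1. Qed.

Lemma qp_neq0 x n : (forall i, (i < n)%N -> 1 - x * q ^+ i != 0) -> qp x n != 0.
Proof.
elim: n => [|n IHn] h; first by rewrite qp0 oner_eq0.
by rewrite qpSr mulf_neq0 ?h // IHn // => i /ltnW; apply: h.
Qed.

Lemma qp_eq0 x n i : (i < n)%N -> 1 - x * q ^+ i = 0 -> qp x n = 0.
Proof.
by move=> ltin h; rewrite -(subnKC ltin) qpD qpSr h mulr0 mul0r.
Qed.

(** Each factor satisfies q^(N-i) (1 - x q^(i-N)) = -x (1 - q^(N-i)/x), and for i < n these are the
    last n factors of (q/x;q)_N. The form is free of divisions, so that no q-product has to be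
    nonzero. *)
Lemma qp_rev x n N : q != 0 -> x != 0 -> (n <= N)%N ->
  qp (x / q ^+ N) n * (\prod_(0 <= i < n) q ^+ (N - i)) * qp (q / x) (N - n)
  = (- x) ^+ n * qp (q / x) N.
Proof.
move=> q0 x0; elim: n => [|n IHn] leN.
  by rewrite qp0 big_geq // subn0 expr0 !mul1r.
have -> : (- x) ^+ n.+1 * qp (q / x) N = (- x) * ((- x) ^+ n * qp (q / x) N).
  by rewrite exprS mulrA.
rewrite -IHn ?(ltnW leN) // qpSr big_nat_recr //=.
rewrite (_ : (N - n = (N - n.+1).+1)%N); last by rewrite subnSK.
rewrite qpSr.
have -> : x / q ^+ N * q ^+ n = x / q ^+ (N - n.+1).+1.
  rewrite subnSK // -{1}(subnK (ltnW leN)) exprD invfM -!mulrA mulVf ?expf_neq0 //.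
  by rewrite mulr1.
rewrite exprS; have D0 := expf_neq0 (N - n.+1) q0.
by field; rewrite x0 q0 D0.
Qed.

Variable b : F.

(** The building block of all the series: in each 4phi3 every lower parameter is q/b times an upper
    one, the parameter q being b q / b. *)
Definition hq (x : F) (n : nat) : F := qp x n / qp (x * q / b) n.

Lemma hq_rev x n N : q != 0 -> b != 0 -> x != 0 ->
  qp (b / x) N != 0 -> qp (q / x) N != 0 -> (n <= N)%N ->
  hq (x / q ^+ N) n = (b / q) ^+ n * hq (b / x) (N - n) / hq (b / x) N.
Proof.
move=> q0 b0 x0 h1 h2 leN.
have split_qp y : qp y N = qp y (N - n) * qp (y * q ^+ (N - n)) n.
  by rewrite -qpD subnK.
have P0 : \prod_(0 <= i < n) q ^+ (N - i) != 0.
  by rewrite prodf_seq_neq0; apply/allP => i _ /=; rewrite expf_neq0.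
have Q1 : qp (q / x) (N - n) != 0.
  by move: h2; rewrite split_qp mulf_eq0 negb_or => /andP[].
have Q2 : qp (b / x) (N - n) != 0.
  by move: h1; rewrite split_qp mulf_eq0 negb_or => /andP[].
have r1 := qp_rev q0 x0 leN.
have y0 : x * q / b != 0 by rewrite !mulf_neq0 ?invr_neq0.
have := qp_rev q0 y0 leN.
have -> : q / (x * q / b) = b / x by field; rewrite x0 b0 q0.
move=> r2; rewrite /hq.
have -> : x / q ^+ N * q / b = x * q / b / q ^+ N by ring.
have -> : b / x * q / b = q / x by field; rewrite b0 x0.
have -> : qp (x / q ^+ N) n = (- x) ^+ n * qp (q / x) N
    / (\prod_(0 <= i < n) q ^+ (N - i)) / qp (q / x) (N - n).
  by rewrite -r1; field; rewrite P0 Q1.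
have -> : qp (x * q / b / q ^+ N) n = (- (x * q / b)) ^+ n * qp (b / x) N
    / (\prod_(0 <= i < n) q ^+ (N - i)) / qp (b / x) (N - n).
  by rewrite -r2; field; rewrite P0 Q2.
have -> : (- (x * q / b)) ^+ n = (- x) ^+ n / (b / q) ^+ n.
  by rewrite -exprVn -exprMn invf_div; congr (_ ^+ _); ring.
have := expf_neq0 n (mulf_neq0 b0 (invr_neq0 q0)).
have : (- x) ^+ n != 0 by rewrite expf_neq0 ?oppr_eq0.
by move=> X0 B0; field; rewrite h2 h1 Q1 Q2 P0 B0 X0.
Qed.

End FiniteProducts.

(** * q-products as polynomials in one parameter *)

Section LinearFactors.
Variables (F : fieldType) (q : F).
Implicit Types (c d : F) (n : nat).

Definition pasc c n : {poly F} := \prod_(0 <= i < n) (1 - (c * q ^+ i)%:P * 'X).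
Definition pdesc c n : {poly F} := \prod_(0 <= i < n) ('X - (c * q ^+ i)%:P).

Lemma horner_pasc c n d : (pasc c n).[d] = qp q (d * c) n.
Proof.
rewrite horner_prod; apply: eq_bigr => i _.
by rewrite !hornerE [d * _]mulrC mulrAC.
Qed.

Lemma horner_pdesc c n d : d != 0 -> (pdesc c n).[d] = d ^+ n * qp q (c / d) n.
Proof.
move=> d0; rewrite horner_prod; elim: n => [|n IHn].
  by rewrite big_geq // qp0 mulr1.
rewrite big_nat_recr //= IHn qpSr exprSr !hornerE /=.
by field.
Qed.

Lemma size_prod_lin (f : nat -> {poly F}) n : (forall i, (size (f i) <= 2)%N) ->
  (size (\prod_(0 <= i < n) f i)%R <= n.+1)%N.
Proof.
move=> h; elim: n => [|n IHn]; first by rewrite big_geq // size_poly1.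
rewrite big_nat_recr //=; apply: leq_trans (size_polyMleq _ _) _.
by rewrite -subn1 leq_subLR add1n (leq_trans (leq_add IHn (h n))) // addn2.
Qed.

Lemma size_pasc c n : (size (pasc c n) <= n.+1)%N.
Proof.
apply: size_prod_lin => i.
rewrite (leq_trans (size_polyD _ _)) // geq_max size_poly1 size_polyN /=.
by rewrite mul_polyC (leq_trans (size_scale_leq _ _)) // size_polyX.
Qed.

Lemma size_pdesc c n : (size (pdesc c n) <= n.+1)%N.
Proof. by apply: size_prod_lin => i; rewrite size_XsubC. Qed.

Lemma pdesc_root c n d i : (i < n)%N -> d = c * q ^+ i -> (pdesc c n).[d] = 0.
Proof.
move=> ltin ->; rewrite horner_prod -(subnKC ltin) /index_iota subn0 iotaD.
by rewrite big_cat -addn1 iotaD big_cat big_seq1 /= !hornerE subrr !(mulr0, mul0r).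
Qed.

Lemma size_polyM_le (p1 p2 : {poly F}) m1 m2 :
  (size p1 <= m1.+1)%N -> (size p2 <= m2.+1)%N -> (size (p1 * p2)%R <= (m1 + m2).+1)%N.
Proof.
move=> h1 h2; apply: leq_trans (size_polyMleq _ _) _.
by rewrite -subn1 leq_subLR add1n (leq_trans (leq_add h1 h2)) // addnS.
Qed.

End LinearFactors.

(** * The terminating identity *)

Section Terminating.
Variables (F : fieldType) (q b a : F) (s : nat).
Hypothesis q_neq0 : q != 0.
Hypothesis b_neq0 : b != 0.
Hypothesis aE : a = q ^+ s.
Hypothesis q_inf : forall n, q ^+ n.+1 != 1.
Hypothesis b_gen : forall m n, b * q ^+ m != q ^+ n.

Local Notation "{ x ; n }" := (qp q x n) (at level 0, x at level 99).
Local Notation H := (hq q b).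

Let a_neq0 : a != 0. Proof. by rewrite aE expf_neq0. Qed.

Lemma qp_q_neq0 m n : {q ^+ m.+1; n} != 0.
Proof.
apply: qp_neq0 => i _; rewrite -exprD addSn subr_eq0 eq_sym; exact: q_inf.
Qed.

Lemma qp_aq_neq0 m n : {a * q ^+ m.+1; n} != 0.
Proof. rewrite aE -exprD addnS; exact: qp_q_neq0. Qed.

Lemma qp_b_neq0 m n : {b * q ^+ m; n} != 0.
Proof.
apply: qp_neq0 => i _; rewrite -mulrA -exprD subr_eq0 eq_sym.
by have := b_gen (m + i) 0; rewrite expr0.
Qed.

Lemma qp_ab_neq0 m n : {a * b * q ^+ m; n} != 0.
Proof. by rewrite aE [_ * b]mulrC -mulrA -exprD; apply: qp_b_neq0. Qed.

Lemma qp_qb_neq0 l m n : {q ^+ l / (b * q ^+ m); n} != 0.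
Proof.
have h : b * q ^+ m != 0 by rewrite mulf_neq0 ?expf_neq0.
apply: qp_neq0 => i _; rewrite subr_eq0 eq_sym mulrAC -exprD.
by apply/eqP => /(canRL (divfK h)) /eqP; rewrite mul1r eq_sym (negPf (b_gen _ _)).
Qed.

(* The very-well-poised factor (1 - a q^(2k)) / (1 - a) (a;q)_k / (q;q)_k, with
   1 - a cancelled so that it makes sense at a = 1. *)
Definition vwp k : F :=
  if k is k'.+1 then (1 - a * q ^+ (2 * k)) * {a * q; k'} / {q; k} else 1.

(** The part of the bilateral term that is free of c and d. The quotient of the symbols of index 2k
    is what the eight square-root parameters amount to. *)
Definition Dw k : F :=
  {a * q / b; 2 * k} / {a * b; 2 * k} * ({b; k} / {a * q / b; k}) * (q / b) ^+ k.

Definition Cw k : F := vwp k * Dw k.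

Definition Fw x k : F := H x k * H (a * b / x) k.

(** The right side of the terminating identity in the shape that shows its invariance under d ->
    ab/d, by n -> N - n. *)
Definition conv N d : F :=
  \sum_(0 <= n < N.+1) H b n * H b (N - n) * (H d n * H (a * b / d) (N - n)).

Definition Kw N : F := H b N * ({a * b; N} / {a * q; N}).

Definition regular N d := [/\ d != 0, {d * q / b; N} != 0 & {a * q / d; N} != 0].

Definition symsum M (x y : F) : F :=
  \sum_(0 <= n < M) H b n * H x n * H y n * H (x * y / a) n * (q / b) ^+ (2 * n).

Lemma regularV N d : regular N d -> regular N (a * b / d).
Proof.
case=> d0 h1 h2; split.
- by rewrite !mulf_neq0 ?invr_neq0.
- by have -> : a * b / d * q / b = a * q / d by field; rewrite d0 b_neq0.
- have -> // : a * q / (a * b / d) = d * q / b.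
  by field; rewrite d0 b_neq0 a_neq0.
Qed.

Lemma convV N d : d != 0 -> conv N (a * b / d) = conv N d.
Proof.
move=> d0; rewrite /conv big_nat_rev /= !big_nat.
apply: eq_bigr => n; rewrite add0n subSS leq0n /= ltnS => leN.
rewrite subKn // (_ : a * b / (a * b / d) = d); last first.
  by field; rewrite d0 b_neq0 a_neq0.
ring.
Qed.

Lemma FwV x k : x != 0 -> Fw (a * b / x) k = Fw x k.
Proof.
move=> x0; rewrite /Fw (_ : a * b / (a * b / x) = x) 1?mulrC //.
by field; rewrite x0 b_neq0 a_neq0.
Qed.

Lemma hb_neq0 N : H b N != 0.
Proof.
rewrite /hq mulf_neq0 ?invr_neq0 //; first by have := qp_b_neq0 0 N; rewrite mulr1.
by rewrite mulrAC divff // mul1r; have := qp_q_neq0 0 N.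
Qed.

Lemma h_qV_eq0 N n : (N < n)%N -> H (q ^- N) n = 0.
Proof.
move=> h; rewrite /hq (qp_eq0 h) ?mul0r //.
by rewrite mulVf ?subrr // expf_neq0.
Qed.

(** Reversal of the factors of index N - n, by [hq_rev] at x = 1 and at x = d/a; the two powers of
    b/q that appear account for (q/b)^(2n). In the new shape q^-N and d can be exchanged. *)
Lemma conv_symsum N d : regular N d -> {a * b / d; N} != 0 ->
  conv N d = H b N * H (a * b / d) N * symsum N.+1 (q ^- N) d.
Proof.
move=> [d0 h1 h2] h3; rewrite /conv /symsum mulr_sumr !big_nat; apply: eq_bigr => n.
rewrite leq0n /= ltnS => leN.
have e1 : b / (d / a) = a * b / d by field; rewrite d0 a_neq0.
have e2 : q / (d / a) = a * q / d by field; rewrite d0 a_neq0.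
have -> : q ^- N * d / a = d / a / q ^+ N by ring.
rewrite (@hq_rev _ q b (d / a) n N) //; last 3 first.
- by rewrite mulf_neq0 ?invr_neq0.
- by rewrite e1.
- by rewrite e2.
rewrite -[q ^- N]mul1r (@hq_rev _ q b 1 n N) ?oner_eq0 ?divr1 //; last 2 first.
- by have := qp_b_neq0 0 N; rewrite mulr1.
- by have := qp_q_neq0 0 N.
rewrite e1.
have h4 : H (a * b / d) N != 0.
  rewrite /hq mulf_neq0 // invr_neq0 //.
  by have -> : a * b / d * q / b = a * q / d by field; rewrite d0 b_neq0.
have -> : (q / b) ^+ (2 * n) = ((b / q) ^+ n) ^- 2.
  by rewrite mulnC exprM -exprVn -exprVn invf_div.
by field; rewrite h4 hb_neq0 expf_neq0 ?mulf_neq0 ?invr_neq0.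
Qed.

Lemma symsumC M x y : symsum M x y = symsum M y x.
Proof. by apply: eq_bigr => n _; rewrite [x * y]mulrC; ring. Qed.

Lemma symsum_trunc M N y : (N <= M)%N -> symsum M.+1 (q ^- N) y = symsum N.+1 (q ^- N) y.
Proof.
move=> leNM; rewrite /symsum (@big_cat_nat _ _ _ N.+1) //= [X in _ + X]big_nat.
rewrite [X in _ + X]big1 ?addr0 // => n /andP[ltNn _].
by rewrite h_qV_eq0 // !(mulr0, mul0r).
Qed.

(* The last product clears all denominators of H d n * H (a * b / d) m, n, m <= N. *)
Definition numer N n m : {poly F} :=
  pasc q 1 n * pdesc q (a * b) m * pasc q (q ^+ n.+1 / b) (N - n)
  * pdesc q (a * q ^+ m.+1) (N - m).

Lemma size_numer N n m : (n <= N)%N -> (m <= N)%N ->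
  (size (numer N n m) <= (2 * N).+1)%N.
Proof.
move=> hn hm; have -> : (2 * N = n + m + (N - n) + (N - m))%N by lia.
by rewrite /numer; do !apply: size_polyM_le; rewrite ?size_pasc ?size_pdesc.
Qed.

Lemma horner_numer N n m d : (n <= N)%N -> (m <= N)%N -> regular N d ->
  (numer N n m).[d] = d ^+ N * {d * q / b; N} * {a * q / d; N}
                      * (H d n * H (a * b / d) m).
Proof.
move=> hn hm [d0 h1 h2]; rewrite !hornerM !horner_pasc !horner_pdesc // mulr1.
have e1 : {d * q / b; N} = {d * q / b; n} * {d * (q ^+ n.+1 / b); N - n}.
  rewrite -{1}(subnKC hn) qpD; congr (_ * qp q _ _); rewrite exprS; ring.
have e2 : {a * q / d; N} = {a * q / d; m} * {a * q ^+ m.+1 / d; N - m}.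
  rewrite -{1}(subnKC hm) qpD; congr (_ * qp q _ _); rewrite exprS; ring.
have e3 : a * b / d * q / b = a * q / d by field; rewrite d0 b_neq0.
move: h1 h2; rewrite e1 e2 !mulf_eq0 !negb_or => /andP[h1 _] /andP[h2 _].
have e4 : d ^+ N = d ^+ m * d ^+ (N - m) by rewrite -exprD subnKC.
by rewrite /hq e3 e4; field; rewrite h1 h2.
Qed.

(** Compares the prefactors when (N, q^-j) and (j, q^-N) are exchanged. The reason is that (x;q)_N
    (x q^N;q)_j = (x;q)_(N+j) is symmetric in N and j, for x = ab and x = aq. *)
Lemma Kw_sym j N :
  Kw N * (H b j * H (a * b * q ^+ N) j) = Kw j * (H b N * H (a * b * q ^+ j) N).
Proof.
rewrite /Kw /hq.
have e m : a * b * q ^+ m * q / b = a * q ^+ m.+1.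
  by rewrite exprS; field.
rewrite !e.
have h1 : {a * b; N} * {a * b * q ^+ N; j} = {a * b; j} * {a * b * q ^+ j; N}.
  by rewrite -!qpD addnC.
have h2 : {a * q; N} * {a * q ^+ N.+1; j} = {a * q; j} * {a * q ^+ j.+1; N}.
  by rewrite !exprS !mulrA -!qpD addnC.
have n1 := qp_aq_neq0 0 N; have n2 := qp_aq_neq0 0 j.
have n3 := qp_aq_neq0 N j; have n4 := qp_aq_neq0 j N.
rewrite expr1 in n1 n2.
rewrite !mulrA.
transitivity ({b; N} / {b * q / b; N} * ({b; j} / {b * q / b; j}) *
  (({a * b; N} * {a * b * q ^+ N; j}) / ({a * q; N} * {a * q ^+ N.+1; j}))).
  by rewrite invfM; ring.
by rewrite h1 h2 invfM; ring.
Qed.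

(** What is left of the identity at the node d = a q^(N+1), after a common factor is removed: only
    the last term of the sum on the left and the term n = 0 of the convolution survive there. *)
Lemma top_weight N :
  Kw N.+1 * (Cw N.+1 * Fw (q ^- N.+1) N.+1) * {a * q ^+ N.+1; N.+1}
  = H b N.+1 * {a * q ^+ N.+2 / b; N.+1}.
Proof.
rewrite /Kw /Cw /Dw /Fw /vwp -[q ^- N.+1]mul1r (@hq_rev _ q b 1 N.+1 N.+1) ?oner_eq0 //;
  rewrite ?divr1; last 2 first.
- by have := qp_b_neq0 0 N.+1; rewrite mulr1.
- by have := qp_q_neq0 0 N.+1; rewrite expr1.
have -> : a * b / (1 / q ^+ N.+1) = a * b * q ^+ N.+1 by rewrite div1r invrK.
rewrite subnn {2}/hq !qp0 divr1 mulr1 [H (a * b * _) _]/hq.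
have -> : a * b * q ^+ N.+1 * q / b = a * q ^+ N.+2.
  by rewrite [q ^+ N.+2]exprS; field.
rewrite mul2n -addnn (qpD q (a * b)) (qpD q (a * q / b)).
have -> : a * q / b * q ^+ N.+1 = a * q ^+ N.+2 / b.
  by rewrite [q ^+ N.+2]exprS; ring.
rewrite (qpS q (a * q ^+ N.+1)) (qpSr q (a * q ^+ N.+2)) (qpSr q (a * q)).
have -> : a * q ^+ N.+1 * q = a * q ^+ N.+2 by rewrite [q ^+ N.+2]exprSr; ring.
have -> : a * q * q ^+ N = a * q ^+ N.+1 by rewrite [q ^+ N.+1]exprS; ring.
have -> : a * q ^+ N.+2 * q ^+ N = a * q ^+ (N.+1 + N.+1).
  by rewrite -mulrA -exprD; congr (_ * _ ^+ _); lia.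
have -> : (q / b) ^+ N.+1 = (b / q) ^- N.+1 by rewrite -exprVn invf_div.
have n1 := qp_aq_neq0 0 N; rewrite expr1 in n1.
have n2 := qp_aq_neq0 N.+1 N.
have n3 := qp_q_neq0 0 N.+1; rewrite expr1 in n3.
have n4 := qp_b_neq0 0 N.+1; rewrite mulr1 in n4.
have n5 := qp_ab_neq0 0 N.+1; rewrite mulr1 in n5.
have n6 := qp_ab_neq0 N.+1 N.+1.
have n7 := qp_qb_neq0 s.+1 0 N.+1; rewrite mulr1 exprSr -aE in n7.
have n8 : 1 - a * q ^+ (N.+1 + N.+1) != 0.
  by rewrite aE -exprD !addnS subr_eq0 eq_sym q_inf.
have n9 : 1 - a * q ^+ N.+1 != 0 by rewrite aE -exprD addnS subr_eq0 eq_sym q_inf.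
have n10 := hb_neq0 N.+1.
have n11 : (b / q) ^+ N.+1 != 0 by rewrite expf_neq0 // mulf_neq0 ?invr_neq0.
rewrite {2}[H b N.+1]/hq [b * q / b]mulrAC divff // mul1r.
rewrite /hq [b * q / b]mulrAC divff // mul1r in n10 *.
by field; rewrite n1 n2 n3 n4 n5 n6 n7 n8 n9 n11.
Qed.

Lemma qX_inj : injective (GRing.exp q).
Proof.
have aux m n : (m <= n)%N -> q ^+ m = q ^+ n -> m = n.
  move=> lemn; rewrite -(subnKC lemn) exprD; case: (n - m)%N => [|k].
    by rewrite addn0.
  move=> /esym/eqP; rewrite -[X in _ == X]mulr1 (inj_eq (mulfI (expf_neq0 _ q_neq0))).
  by rewrite (negPf (q_inf _)).
move=> m n h; case: (leqP m n) => [le|/ltnW le]; first exact: aux.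
by apply/esym/aux.
Qed.

Lemma uniq_roots M :
  uniq ([seq q ^- j | j <- iota 0 M] ++ [seq a * b * q ^+ j | j <- iota 0 M]
        ++ [:: a * q ^+ M]).
Proof.
have bX m n k : b * q ^+ m * q ^+ n = q ^+ k -> False.
  by move/eqP; rewrite -mulrA -exprD (negPf (b_gen _ _)).
have qn0 n : q ^+ n != 0 by rewrite expf_neq0.
rewrite !cat_uniq !map_inj_uniq ?iota_uniq; last 2 first.
- by move=> i j /(mulfI (mulf_neq0 a_neq0 b_neq0)) /qX_inj.
- by move=> i j /invr_inj /qX_inj.
rewrite has_cat /= !orbF !andbT negb_or -andbA.
apply/and3P; split.
- apply/hasPn => _ /mapP[j _ ->]; apply/mapP => -[i _ h].
  apply: (bX (s + j)%N i 0); rewrite expr0 exprD -aE mulrA [b * a]mulrC h.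
  by rewrite mulVf.
- apply/mapP => -[i ]; rewrite mem_iota /= => hi /eqP; rewrite -(inj_eq (mulIf (qn0 i))).
  by rewrite mulVf // aE -!exprD -[1]/(q ^+ 0) => /eqP /qX_inj; lia.
- apply/mapP => -[i _ /esym].
  rewrite -mulrA => /(mulfI a_neq0) h; apply: (bX i 0%N M); by rewrite mulr1.
Qed.

Lemma Kw_neq0 N : Kw N != 0.
Proof.
have := qp_ab_neq0 0 N; have := qp_aq_neq0 0 N; rewrite mulr1 expr1 => h1 h2.
by rewrite /Kw mulf_neq0 ?hb_neq0 // mulf_neq0 ?invr_neq0.
Qed.

Lemma Fw_qV_eq0 N k : (N < k)%N -> Fw (q ^- N) k = 0.
Proof. by move=> h; rewrite /Fw h_qV_eq0 // mul0r. Qed.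

Lemma regular_qV N j : regular N (q ^- j).
Proof.
split; first by rewrite invr_neq0 ?expf_neq0.
- have -> : q ^- j * q / b = q ^+ 1 / (b * q ^+ j).
    by rewrite expr1; field; rewrite b_neq0 expf_neq0.
  exact: qp_qb_neq0.
- by rewrite invrK -mulrA -exprS; apply: qp_aq_neq0.
Qed.

Lemma Fsum_trunc j N d (f : nat -> F) : (j <= N)%N ->
  \sum_(0 <= k < N.+1) f k * Fw d k * Fw (q ^- j) k
  = \sum_(0 <= k < j.+1) f k * Fw d k * Fw (q ^- j) k.
Proof.
move=> lejN; rewrite (@big_cat_nat _ _ _ j.+1) //= [X in _ + X]big_nat.
rewrite [X in _ + X]big1 ?addr0 // => k /andP[ltjk _].
by rewrite Fw_qV_eq0 // mulr0.
Qed.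

(* Cleared of denominators, both sides are polynomials of degree 2N in d. They
   agree at q^-j and a b q^j for j < N, since the symmetry of symsum exchanges
   (N, d = q^-j) with (j, d = q^-N), and at a q^N, where one term survives. *)
Lemma terminating N d : regular N d ->
  Kw N * (\sum_(0 <= k < N.+1) Cw k * Fw (q ^- N) k * Fw d k) = conv N d.
Proof.
elim/ltn_ind: N d => -[_ d _|N IHN d reg_d].
  rewrite /conv !big_nat1 /Kw /Cw /Dw /Fw /hq /= !qp0 !expr0.
  by rewrite !(divr1, mulr1).
set M := N.+1 in IHN reg_d *.
pose G : {poly F} := Kw M *: (\sum_(0 <= k < M.+1) (Cw k * Fw (q ^- M) k) *: numer M k k)
  - \sum_(0 <= n < M.+1) (H b n * H b (M - n)) *: numer M n (M - n).
have GE x : regular M x -> G.[x] = x ^+ M * {x * q / b; M} * {a * q / x; M} *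
   (Kw M * (\sum_(0 <= k < M.+1) Cw k * Fw (q ^- M) k * Fw x k) - conv M x).
  move=> hx; rewrite /G /conv !hornerE !horner_sum mulrBr; congr (_ - _).
    rewrite [RHS]mulrCA; congr (_ * _); rewrite mulr_sumr !big_nat.
    apply: eq_bigr => k; rewrite leq0n ltnS /= => hk.
    by rewrite hornerZ horner_numer // /Fw; ring.
  rewrite mulr_sumr !big_nat.
  apply: eq_bigr => k; rewrite leq0n ltnS /= => hk.
  by rewrite hornerZ horner_numer // ?leq_subr //; ring.
suff G0 : G = 0.
  have := GE d reg_d; rewrite G0 horner0 => /esym/eqP.
  case: reg_d => d0 h1 h2.
  by rewrite !mulf_eq0 (negPf (expf_neq0 _ _)) // (negPf h1) (negPf h2) subr_eq0 => /eqP.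
have root_qV j : (j < M)%N -> Kw M * (\sum_(0 <= k < M.+1) Cw k * Fw (q ^- M) k
    * Fw (q ^- j) k) = conv M (q ^- j).
  move=> ltjM; rewrite Fsum_trunc ?(ltnW ltjM) //.
  have := IHN j ltjM (q ^- M) (regular_qV _ _).
  rewrite (conv_symsum (regular_qV _ _)) ?invrK ?qp_ab_neq0 //.
  rewrite (conv_symsum (regular_qV _ _)) ?invrK ?qp_ab_neq0 //.
  rewrite (symsumC M.+1) (@symsum_trunc M j) ?(ltnW ltjM) //.
  under [in X in _ -> X]eq_bigr do rewrite mulrAC.
  move: (\sum_(_ <= _ < _) _) (symsum _ _ _) => T S IH.
  apply: (mulfI (Kw_neq0 j)).
  by rewrite mulrCA IH mulrA Kw_sym !mulrA.
pose rs := [seq q ^- j | j <- iota 0 M] ++ [seq a * b * q ^+ j | j <- iota 0 M]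
  ++ [:: a * q ^+ M].
apply/eqP/negPn/negP => nzG.
have size_rs : size rs = (2 * M).+1 by rewrite !size_cat !size_map size_iota /=; lia.
have size_G : (size G <= (2 * M).+1)%N.
  apply: leq_trans (size_polyD _ _) _.
  have size_sum (f : nat -> nat) (g : nat -> F) :
      (forall k, (k <= M)%N -> (f k <= M)%N) ->
      (size (\sum_(0 <= k < M.+1) g k *: numer M k (f k))%R <= (2 * M).+1)%N.
    move=> hf; rewrite big_nat; apply: (leq_trans (size_sum _ _ _)).
    apply/bigmax_leqP_seq => k _ /andP[_]; rewrite ltnS => hk.
    by rewrite (leq_trans (size_scale_leq _ _)) // size_numer ?hf.
  rewrite geq_max size_polyN (leq_trans (size_scale_leq _ _)) ?size_sum //.
  by move=> k _; apply: leq_subr.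
have root_G x : regular M x -> Kw M * (\sum_(0 <= k < M.+1) Cw k * Fw (q ^- M) k
    * Fw x k) = conv M x -> root G x.
  by move=> hx h; rewrite /root GE // h subrr mulr0.
have : ~ (all (root G) rs && uniq rs).
  by case/andP=> h1 h2; have := max_poly_roots nzG h1 h2; rewrite size_rs ltnNge size_G.
move=> no_roots; apply: no_roots; apply/andP; split.
- rewrite !all_cat !all_map all_seq1; apply/and3P; split.
  + apply/allP => j; rewrite mem_iota => /andP[_ hj] /=; apply: root_G => //.
      exact: regular_qV.
    exact: root_qV.
  + apply/allP => j; rewrite mem_iota => /andP[_ hj] /=.
    have -> : a * b * q ^+ j = a * b / q ^- j by rewrite invrK.
    have qj0 : q ^- j != 0 by rewrite invr_neq0 ?expf_neq0.
    apply: root_G; first by apply/regularV/regular_qV.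
    rewrite convV // -root_qV //; congr (_ * _).
    by apply: eq_bigr => k _; rewrite FwV.
  (* The factor [pdesc q (a * q ^+ m.+1) (M - m)] of [numer] vanishes at a q^M unless m = M, which
     leaves k = M in the first sum and n = 0 in the second. *)
  + rewrite /root /G !hornerE !horner_sum.
    rewrite big_nat_recr //= big_nat big1 => [|k /andP[_ hk]]; last first.
      rewrite hornerZ !hornerM.
      rewrite (@pdesc_root _ q (a * q ^+ k.+1) (M - k) _ (M - k.+1)) ?mulr0 //.
        by rewrite ltn_sub2l.
      by rewrite -mulrA -exprD subnKC.
    rewrite add0r big_nat_recl //= [X in _ - (_ + X)]big_nat.
    rewrite [X in _ - (_ + X)]big1 => [|k /andP[_ hk]]; last first.
      rewrite hornerZ !hornerM.
      rewrite (@pdesc_root _ q (a * q ^+ (M - k.+1).+1) (M - (M - k.+1)) _ k) ?mulr0 //.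
        by rewrite subKn.
      by rewrite -mulrA -exprD; congr (_ * _ ^+ _); lia.
    rewrite addr0 !hornerZ /numer subnn subn0 !hornerM !horner_pasc.
    have q0 x : (pdesc q x 0).[a * q ^+ M] = 1 by rewrite /pdesc big_geq // hornerE.
    have h0 : H b 0 = 1 by rewrite /hq !qp0 divr1.
    rewrite !q0 !qp0 !mulr1 !mul1r expr1 h0 mul1r subr_eq0.
    have -> : a * q ^+ M * (q / b) = a * q ^+ N.+2 / b.
      by rewrite [q ^+ N.+2]exprSr; ring.
    have := top_weight N; rewrite -/M.
    move: (pdesc _ _ _).[_] => P hT.
    apply/eqP; transitivity (Kw M * (Cw M * Fw (q ^- M) M) * {a * q ^+ M; M} * P).
      by ring.
    by rewrite hT; ring.
- exact: uniq_roots.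
Qed.

End Terminating.

(** * Geometric convergence and infinite products *)

Definition eps_cvg (C : numFieldType) (u : nat -> C) (l : C) : Prop :=
  forall eps, 0 < eps -> exists N, forall n, (N <= n)%N -> `|l - u n| < eps.

(* Everything below needs only these two properties of the base field, so the
   analysis is carried out over an abstract numClosedFieldType. *)
Definition geo_archimedean (C : numFieldType) : Prop :=
  forall K rho eps : C, 0 <= K -> 0 <= rho < 1 -> 0 < eps ->
  exists N, forall n, (N <= n)%N -> K * rho ^+ n < eps.

Definition geo_complete (C : numFieldType) : Prop :=
  forall (u : nat -> C) (K rho : C), 0 <= K -> 0 <= rho < 1 ->
  (forall n, `|u n.+1 - u n| <= K * rho ^+ n) -> exists l, eps_cvg u l.

Section Complex.
Variable R : realType.
Local Notation C := R[i].

Lemma real_of_ge0 (x : C) : 0 <= x -> exists2 r : R, 0 <= r & x = (r%:C)%C.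
Proof. by move=> x0; exists (complex.Re x); rewrite -?lecR RRe_real ?ger0_real. Qed.

Lemma geo_archimedean_complex : geo_archimedean C.
Proof.
move=> K rho eps /real_of_ge0[k k0 ->] /andP[/real_of_ge0[r r0 ->] r1] e0.
have [e e0' eE] := real_of_ge0 (ltW e0).
move: r1 e0; rewrite eE !ltcR => r1 e0.
have : geometric k r @ \oo --> 0 by apply: cvg_geometric; rewrite ger0_norm.
move/cvgrPdist_lt => /(_ _ e0)[N _ hN]; exists N => n /hN /=.
rewrite sub0r normrN ger0_norm ?mulr_ge0 ?exprn_ge0 // => h.
by rewrite -rmorphXn -rmorphM ltcR.
Qed.

Lemma real_cvg_geo (x : nat -> R) (k r : R) : 0 <= k -> 0 <= r < 1 ->
  (forall n, `|x n.+1 - x n| <= k * r ^+ n) -> exists a : R, x @ \oo --> a.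
Proof.
move=> k0 /andP[r0 r1] h; pose d n := x n.+1 - x n.
have cd : cvgn (series d).
  apply: normed_cvg.
  apply: (@series_le_cvg _ _ (geometric k r)).
  - by move=> n /=; exact: normr_ge0.
  - by move=> n; rewrite /= mulr_ge0 ?exprn_ge0.
  - exact: h.
  - by apply: is_cvg_geometric_series; rewrite ger0_norm.
exists (limn (series d) + x 0%N).
have xE : (fun n => series d n + x 0%N) = x.
  by apply/funext => n; rewrite /series /= telescope_sumr // subrK.
by rewrite -[X in X @ _]xE; exact: (cvgD cd (cvg_cst _)).
Qed.

Lemma geo_complete_complex : geo_complete C.
Proof.
move=> u K rho K0 rho01 h; have [k k0 kE] := real_of_ge0 K0.
have [r r0 rE] : exists2 r : R, 0 <= r & rho = (r%:C)%C.
  by case/andP: rho01 => /real_of_ge0.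
have r01 : 0 <= r < 1 by move: rho01; rewrite rE -{1}[0]/((0 : R)%:C)%C ltcR r0 => /andP[].
have [x hx] : exists x : R, (fun n => complex.Re (u n)) @ \oo --> x.
  apply: (@real_cvg_geo _ k r k0 r01) => n.
  rewrite -lecR rmorphM rmorphXn /= -kE -rE; apply: le_trans (h n).
  by have := normc_ge_Re (u n.+1 - u n); rewrite raddfB.
have [y hy] : exists y : R, (fun n => complex.Im (u n)) @ \oo --> y.
  apply: (@real_cvg_geo _ k r k0 r01) => n.
  rewrite -lecR rmorphM rmorphXn /= -kE -rE; apply: le_trans (h n).
  have := normc_ge_Re ((u n.+1 - u n) * 'i%C); rewrite ReiNIm normrN normrM raddfB.
  by rewrite (_ : `|'i%C| = 1) ?mulr1 // complexiE normCi.
exists (x +i* y)%C => _ /[dup] /ltW /real_of_ge0[e e0 ->].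
  rewrite -{1}[0]/((0 : R)%:C)%C ltcR => {}e0.
  have e20 : 0 < e / 2 by rewrite divr_gt0.
  move/cvgrPdist_lt: hx => /(_ _ e20)[N1 _ h1].
  move/cvgrPdist_lt: hy => /(_ _ e20)[N2 _ h2].
  exists (maxn N1 N2) => n; rewrite geq_max => /andP[/h1 /= {}h1 /h2 /= {}h2].
  rewrite [_ - _]complexE.
  apply: le_lt_trans (ler_normD _ _) _.
  rewrite normrM (_ : `|'i%C| = 1) ?mul1r; last by rewrite complexiE normCi.
  rewrite !raddfB /= -!rmorphB.
  have nr (z : R) : `|(z%:C)%C| = (`|z|%:C)%C :> C.
    by rewrite normc_def /= expr0n addr0 sqrtr_sqr.
  by rewrite !nr -rmorphD ltcR [e]splitr ltrD.
Qed.

End Complex.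

Section GeometricConvergence.
Variable C : numClosedFieldType.
Hypothesis C_arch : geo_archimedean C.
Hypothesis C_complete : geo_complete C.
Implicit Types (u v : nat -> C) (l K rho eps : C).

Lemma cvg_epsP u l : u @ \oo --> l <-> eps_cvg u l.
Proof.
split=> [/cvgrPdist_lt h eps e0|h].
  by have [N _ hN] := h _ e0; exists N.
by apply/cvgrPdist_lt => eps /h[N hN]; exists N.
Qed.

Lemma geo_dist u K rho : 0 <= K -> 0 <= rho < 1 ->
  (forall n, `|u n.+1 - u n| <= K * rho ^+ n) ->
  forall n m, `|u (n + m)%N - u n| <= K / (1 - rho) * rho ^+ n.
Proof.
move=> K0 /andP[r0 r1] h n m.
have d0 : 0 < 1 - rho by rewrite subr_gt0.
(* The induction on m carries the exact partial geometric sum, hence the factor 1 - rho^m. *)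
suff : `|u (n + m)%N - u n| <= K / (1 - rho) * rho ^+ n * (1 - rho ^+ m).
  move/le_trans; apply; rewrite ler_piMr ?mulr_ge0 ?invr_ge0 ?exprn_ge0 ?(ltW d0) //.
  by rewrite gerBl exprn_ge0.
elim: m => [|m IHm]; first by rewrite addn0 subrr normr0 expr0 subrr mulr0.
rewrite addnS -(subrKA (u (n + m)%N)); apply: le_trans (ler_normD _ _) _.
apply: le_trans (lerD (h _) IHm) _; rewrite le_eqVlt; apply/orP; left; apply/eqP.
by rewrite exprD exprS; field; rewrite gt_eqF.
Qed.

Lemma lim_norm_le u l x (B : C) : u @ \oo --> l ->
  (exists N, forall n, (N <= n)%N -> `|u n - x| <= B) -> `|l - x| <= B.
Proof.
move=> /cvg_epsP ul [N hN]; apply/ler_addgt0Pr => e e0; have [M hM] := ul e e0.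
rewrite -(subrKA (u (maxn M N))) (le_trans (ler_normD _ _)) // addrC lerD //.
  by apply: hN; rewrite leq_maxr.
by apply/ltW/hM; rewrite leq_maxl.
Qed.

Lemma cvg_geo u K rho : 0 <= K -> 0 <= rho < 1 ->
  (forall n, `|u n.+1 - u n| <= K * rho ^+ n) ->
  exists2 l, u @ \oo --> l & forall n, `|l - u n| <= K / (1 - rho) * rho ^+ n.
Proof.
move=> K0 rho01 h; have [l /cvg_epsP ul] := C_complete K0 rho01 h.
exists l => // n.
apply: (lim_norm_le ul); exists n => m le_nm.
by rewrite -(subnKC le_nm); apply: geo_dist.
Qed.

End GeometricConvergence.

Section InfiniteProducts.
Variable C : numClosedFieldType.
Hypothesis C_arch : geo_archimedean C.
Hypothesis C_complete : geo_complete C.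
Implicit Types (u v : nat -> C) (l K rho eps x y : C).

Lemma limn_unique u l : u @ \oo --> l -> limn u = l.
Proof. by move=> h; apply: cvg_lim. Qed.

Lemma sum_geo u K rho : 0 <= K -> 0 <= rho < 1 -> (forall n, `|u n| <= K * rho ^+ n) ->
  series u @ \oo --> limn (series u) /\
  forall n, `|limn (series u) - series u n| <= K / (1 - rho) * rho ^+ n.
Proof.
move=> K0 rho01 h.
have [|l ul hl] := cvg_geo C_complete K0 rho01 (u := series u).
  by move=> n; rewrite seriesSB.
by rewrite (limn_unique ul).
Qed.

Lemma norm_sum_geo u K rho : 0 <= K -> 0 <= rho < 1 ->
  (forall n, `|u n| <= K * rho ^+ n) -> `|limn (series u)| <= K / (1 - rho).
Proof.
move=> K0 rho01 h; have [_ /(_ 0%N)] := sum_geo K0 rho01 h.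
by rewrite /series /= big_geq // subr0 expr0 mulr1.
Qed.

Lemma cvg_seriesZ (k : C) v : cvgn (series v) ->
  series (fun n => k * v n) @ \oo --> k * limn (series v).
Proof.
move=> cv; have -> : series (fun n => k * v n) = (fun n => k * series v n).
  by apply/funext => n; rewrite /series /= mulr_sumr.
exact: (cvgM (cvg_cst k) cv).
Qed.

Lemma limn_seriesZ (k : C) u v : u =1 (fun n => k * v n) -> cvgn (series v) ->
  limn (series u) = k * limn (series v).
Proof. by move=> /funext -> cv; apply/limn_unique/cvg_seriesZ. Qed.

Lemma limn_seriesD u v : cvgn (series u) -> cvgn (series v) ->
  limn (series (fun n => u n + v n)) = limn (series u) + limn (series v).
Proof.
move=> hu hv; rewrite -limD //; congr (limn _); apply/funext => n.
by rewrite /series /= big_split.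
Qed.

Lemma limn_series_shift j u : (forall n, (n < j)%N -> u n = 0) ->
  cvgn (series (fun n => u (j + n)%N)) ->
  limn (series u) = limn (series (fun n => u (j + n)%N)).
Proof.
move=> u0 cu; apply: limn_unique; rewrite -(cvg_shiftn j) /=.
have -> // : (fun n => series u (n + j)%N) = series (fun n => u (j + n)%N).
apply/funext => n; rewrite /series /= addnC (@big_cat_nat _ _ _ j) ?leq_addr //=.
rewrite big_nat big1 ?add0r; last by move=> i /andP[_]; exact: u0.
rewrite -{1}[j]add0n big_addn addKn.
by apply: eq_bigr => i _; rewrite addnC.
Qed.

Lemma limn_series_finite N u : (forall n, (N <= n)%N -> u n = 0) ->
  limn (series u) = \sum_(0 <= k < N) u k.
Proof.
move=> u0; apply: limn_unique; apply/cvg_epsP => eps e0; exists N => n hn.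
rewrite /series /= (@big_cat_nat _ _ _ N 0 n) //= [X in _ - (_ + X)]big_nat.
rewrite [X in _ - (_ + X)]big1 ?addr0 ?subrr ?normr0 // => i /andP[h _]; exact: u0.
Qed.

Variable q : C.
Hypothesis q_gt0 : 0 < `|q|.
Hypothesis q_lt1 : `|q| < 1.

Let q_neq0 : q != 0. Proof. by rewrite -normr_gt0. Qed.
Let q01 : 0 <= `|q| < 1. Proof. by rewrite normr_ge0. Qed.
Let oneq : 0 < 1 - `|q|. Proof. by rewrite subr_gt0. Qed.

Local Notation "{ x ; n }" := (qp q x n) (at level 0, x at level 99).
Local Notation "{ x }oo" := (qpoch_inf q x) (at level 0, x at level 99).

(** With S_n the sum of |x q^i| over i < n, induction gives |(x;q)_n| (1 - S_n) <= 1, because (1 +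
    t)(1 - S - t) <= 1 - S for S, t >= 0; and S_n <= 1/2. *)
Lemma norm_qp_small x n : `|x| / (1 - `|q|) <= 1 / 2 -> `|{x; n}| <= 2.
Proof.
move=> hx; pose S m := \sum_(0 <= i < m) `|x| * `|q| ^+ i.
have SE m : S m = `|x| / (1 - `|q|) * (1 - `|q| ^+ m).
  rewrite /S; elim: m => [|m IHm]; first by rewrite big_geq // expr0 subrr mulr0.
  by rewrite big_nat_recr //= IHm exprS; field; rewrite gt_eqF.
have S0 m : 0 <= S m by rewrite sumr_ge0 // => i _; rewrite mulr_ge0 ?exprn_ge0.
have S2 m : S m <= 1 / 2.
  apply: le_trans hx; rewrite SE ler_piMr ?mulr_ge0 ?invr_ge0 ?(ltW oneq) //.
have h : `|{x; n}| * (1 - S n) <= 1.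
  elim: n => [|n IHn]; first by rewrite qp0 /S big_geq // subr0 normr1 mulr1.
  apply: le_trans IHn; rewrite qpSr normrM -mulrA ler_wpM2l //.
  have -> : S n.+1 = S n + `|x| * `|q| ^+ n by rewrite /S big_nat_recr.
  set t := `|x| * _; have t0 : 0 <= t by rewrite mulr_ge0 ?exprn_ge0.
  have ht : `|1 - x * q ^+ n| <= 1 + t.
    by rewrite (le_trans (ler_normB _ _)) // normr1 normrM normrX.
  have S1 : 0 <= 1 - (S n + t).
    have -> : S n + t = S n.+1 by rewrite /S big_nat_recr.
    by rewrite subr_ge0 (le_trans (S2 _)) // ler_pdivrMr // mul1r ler1n.
  apply: le_trans (ler_wpM2r S1 ht) _.
  rewrite -subr_ge0 (_ : _ - _ = t * S n + t * t); last by ring.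
  by rewrite addr_ge0 ?mulr_ge0.
have h2 : 1 / 2 <= 1 - S n.
  rewrite lerBrDr -lerBrDl (le_trans (S2 n)) //.
  by rewrite (_ : 1 - 1 / 2 = 1 / 2 :> C) //; field.
have := le_trans (ler_wpM2l (normr_ge0 {x; n}) h2) h.
by rewrite mulrA mulr1 ler_pdivrMr // mul1r.
Qed.

Lemma qp_bounded X : 0 <= X ->
  exists2 B, 1 <= B & forall x n, `|x| <= X -> `|{x; n}| <= B.
Proof.
move=> X0.
have e0 : 0 < 1 / 2 * (1 - `|q|) by rewrite mulr_gt0 // divr_gt0.
have [J hJ] := C_arch X0 q01 e0.
have XJ x : `|x| <= X -> `|x * q ^+ J| / (1 - `|q|) <= 1 / 2.
  move=> hx; rewrite ler_pdivrMr // normrM normrX.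
  by rewrite (le_trans (ler_wpM2r _ hx)) ?exprn_ge0 // ltW // hJ.
have Y1 : 1 <= 1 + X by rewrite lerDl.
exists ((1 + X) ^+ J * 2) => [|x n hx].
  by rewrite mulr_ege1 ?exprn_ege1 ?ler1n.
have aux m : `|{x; m}| <= (1 + X) ^+ m.
  elim: m => [|m IHm]; first by rewrite qp0 normr1.
  rewrite qpSr normrM exprSr ler_pM //.
  rewrite (le_trans (ler_normB _ _)) // normr1 lerD2l normrM normrX.
  by rewrite (le_trans _ hx) // ler_piMr // exprn_ile1 // ltW.
have [le_nJ|lt_Jn] := leqP n J.
  apply: le_trans (aux _) _; rewrite (le_trans (ler_weXn2l Y1 le_nJ)) //.
  by rewrite ler_peMr ?exprn_ge0 ?addr_ge0 ?ler1n.
rewrite -(subnKC (ltnW lt_Jn)) qpD normrM ler_pM //.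
by rewrite norm_qp_small ?XJ.
Qed.

Lemma qpinf_approx X : 0 <= X -> exists2 B, 0 <= B & forall x, `|x| <= X ->
  [/\ (fun n => {x; n}) @ \oo --> {x}oo,
      forall n, `|{x; n}| <= B, `|{x}oo| <= B &
      forall n, `|{x}oo - {x; n}| <= B * `|q| ^+ n].
Proof.
move=> X0; have [B B1 hB] := qp_bounded X0.
have B0 : 0 <= B by apply: le_trans B1.
pose K := B * X / (1 - `|q|).
have K0 : 0 <= K by rewrite !mulr_ge0 ?invr_ge0 // ltW.
exists (B + K) => [|x hx]; first by rewrite addr_ge0.
have [n|l ul hl] := cvg_geo C_complete (mulr_ge0 B0 X0) q01 (u := fun n => {x; n}).
  rewrite qpSr mulrBr mulr1 addrC addKr normrN normrM -mulrA ler_pM ?hB //.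
  by rewrite normrM normrX ler_wpM2r ?exprn_ge0.
have le : {x}oo = l by apply: limn_unique ul.
rewrite le; split=> //.
- by move=> n; rewrite (le_trans (hB _ _ hx)) // lerDl.
- have := hl 0%N; rewrite qp0 expr0 mulr1 => h.
  by rewrite -(subrK 1 l) (le_trans (ler_normD _ _)) // normr1 addrC lerD.
- by move=> n; rewrite (le_trans (hl n)) // ler_wpM2r ?exprn_ge0 // lerDr.
Qed.

Lemma qpinf_cvg x : (fun n => {x; n}) @ \oo --> {x}oo.
Proof. by have [B _ /(_ x (lexx _))[]] := qpinf_approx (normr_ge0 x). Qed.

Lemma qpinfD x n : {x}oo = {x; n} * {x * q ^+ n}oo.
Proof.
apply: limn_unique; rewrite -(cvg_shiftn n) /=.
have -> : (fun m => {x; m + n}) = (fun m => {x; n} * {x * q ^+ n; m}).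
  by apply/funext => m; rewrite addnC qpD.
exact: (cvgM (cvg_cst {x; n}) (@qpinf_cvg (x * q ^+ n))).
Qed.

Lemma qpinfS x : {x}oo = (1 - x) * {x * q}oo.
Proof. by rewrite (qpinfD x 1) qpS qp0 mulr1 expr1. Qed.

Lemma qpinf_eq0 x i : 1 - x * q ^+ i = 0 -> {x}oo = 0.
Proof. by move=> h; rewrite (qpinfD x i.+1) (qp_eq0 (ltnSn i) h) mul0r. Qed.

Lemma qpinf_neq0E x : {x}oo != 0 -> forall i, 1 - x * q ^+ i != 0.
Proof. by move=> h i; apply: contra_neq h => /qpinf_eq0. Qed.

(** The lower bound yields the nonvanishing of infinite products whose factors are nonzero; the
    upper bound permits replacing an infinite product by a finite one at the cost of a factor 2. *)
Lemma qpinf_tail X : 0 <= X ->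
  exists J, forall x n, (J <= n)%N -> `|x| <= X -> 1 / 2 <= `|{x * q ^+ n}oo| <= 2.
Proof.
move=> X0; have [B B0 hB] := qpinf_approx ler01.
have e0 : 0 < (1 / 2 : C) by rewrite divr_gt0.
have [B2 B20 hB2] := qp_bounded ler01.
(* The summand 1 forces |x q^n| <= 1, so that the bound B2 applies; the other summand then bounds
   the distance of the product from 1. *)
have [J hJ] : exists J, forall n, (J <= n)%N -> X * (1 + B2 / (1 - `|q|)) * `|q| ^+ n < 1 / 2.
  apply: C_arch => //; rewrite mulr_ge0 // addr_ge0 // divr_ge0 ?(ltW oneq) //.
  exact: le_trans B20.
exists J => x n Jn hx; set y := x * q ^+ n.
have hy : `|y| * (1 + B2 / (1 - `|q|)) <= 1 / 2.
  apply: le_trans (ltW (hJ n Jn)); rewrite /y normrM normrX mulrAC.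
  rewrite ler_wpM2r ?exprn_ge0 // ler_wpM2r // addr_ge0 // divr_ge0 ?(ltW oneq) //.
  exact: le_trans B20.
have y1 : `|y| <= 1.
  apply: le_trans (_ : 1 / 2 <= 1); last by rewrite ler_pdivrMr // mul1r ler1n.
  apply: le_trans hy; rewrite ler_peMr // lerDl divr_ge0 ?(ltW oneq) //.
  exact: le_trans B20.
clearbody y; have h : `|{y}oo - 1| <= 1 / 2.
  have [n0|l ul hl] := cvg_geo C_complete (mulr_ge0 (le_trans ler01 B20) (normr_ge0 y)) q01
    (u := fun n => {y; n}).
    rewrite qpSr mulrBr mulr1 addrC addKr normrN normrM -(mulrA B2) ler_pM ?hB2 //.
    by rewrite normrM normrX.
  have -> : {y}oo = l by apply: limn_unique ul.
  have := hl 0%N; rewrite qp0 expr0 mulr1 => /le_trans; apply.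
  apply: le_trans hy; rewrite mulrDr mulr1 mulrCA mulrA lerDr.
  exact: normr_ge0.
have h1 : 1 = `|1 - {y}oo + {y}oo| by rewrite subrK normr1.
apply/andP; split.
  have : 1 <= 1 / 2 + `|{y}oo|.
    by rewrite {1}h1 (le_trans (ler_normD _ _)) // lerD2r distrC.
  by rewrite -lerBlDl {1}[1]splitr addrK.
rewrite -(subrK 1 {y}oo) (le_trans (ler_normD _ _)) // normr1.
by rewrite (natrD _ 1 1) lerD2r (le_trans h) // ler_pdivrMr // mul1r ler1n.
Qed.

Lemma qpinf_neq0 x : (forall i, 1 - x * q ^+ i != 0) -> {x}oo != 0.
Proof.
move=> h; have [J hJ] := qpinf_tail (normr_ge0 x).
rewrite (qpinfD x J) mulf_neq0 ?qp_neq0 //.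
have /andP[/lt_le_trans h1 _] := hJ x J (leqnn _) (lexx _).
by rewrite -normr_gt0 h1 // divr_gt0.
Qed.

End InfiniteProducts.

(** * Growth on circles *)

Section Growth.
Variable C : numClosedFieldType.
Hypothesis C_arch : geo_archimedean C.
Hypothesis C_complete : geo_complete C.
Implicit Types (K rho eps x y z : C).
Variable q : C.
Hypothesis q_gt0 : 0 < `|q|.
Hypothesis q_lt1 : `|q| < 1.

Let q_neq0 : q != 0. Proof. by rewrite -normr_gt0. Qed.
Let q01 : 0 <= `|q| < 1. Proof. by rewrite normr_ge0. Qed.

Local Notation "{ x ; n }" := (qp q x n) (at level 0, x at level 99).
Local Notation "{ x }oo" := (qpoch_inf q x) (at level 0, x at level 99).

(* The circles of radius rho |q|^j, j an integer, avoid the zeros of (z; q)_oo. *)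
Definition off_circle rho : Prop :=
  0 < rho /\ forall m n, rho * `|q| ^+ m != `|q| ^+ n.

Lemma off_circleV rho : off_circle rho -> off_circle rho^-1.
Proof.
case=> r0 h; split=> [|m n]; first by rewrite invr_gt0.
apply: contra (h n m) => /eqP <-; apply/eqP.
by field; rewrite gt_eqF.
Qed.

Lemma off_circleM rho : off_circle rho -> off_circle (rho * `|q|).
Proof.
case=> r0 h; split=> [|m n]; first by rewrite mulr_gt0.
by rewrite -mulrA -exprS.
Qed.

(** The tail (x q^n;q)_oo is bounded above, so a lower bound for the infinite product passes to all
    finite ones. *)
Lemma qp_lower x : (forall i, 1 - x * q ^+ i != 0) ->
  exists2 m, 0 < m & forall n, m <= `|{x; n}|.
Proof.
move=> h.
have [B B1 hB] := qpinf_approx C_arch C_complete q_lt1 (normr_ge0 x).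
have x0 : 0 < `|{x}oo| by rewrite normr_gt0 qpinf_neq0.
have B0 : 0 < B.
  by have [_ _ + _] := hB x (lexx _); apply: lt_le_trans.
exists (`|{x}oo| / B) => [|n]; first by rewrite divr_gt0.
rewrite ler_pdivrMr // (qpinfD C_arch C_complete q_lt1 x n) normrM ler_wpM2l //.
have [|_ _ + _] := hB (x * q ^+ n); last by [].
by rewrite normrM normrX ler_piMr // exprn_ile1 // ltW.
Qed.

(** On the circle j = 0 each factor satisfies |1 - z q^i| >= |1 - rho |q|^i| > 0. The smaller
    circles follow from (z q^-j;q)_oo = (z q^-j;q)_j (z;q)_oo, whose first factor is bounded. *)
Lemma qp_lower_circle rho : off_circle rho -> exists2 m, 0 < m &
  forall j z, `|z| = rho * `|q| ^+ j -> m <= `|{z}oo| /\ forall n, m <= `|{z; n}|.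
Proof.
move=> [rho0 off].
have [B B0 hB] := qpinf_approx C_arch C_complete q_lt1 (ltW rho0).
have [J hJ] := qpinf_tail C_arch C_complete q_lt1 (ltW rho0).
pose B1 := 1 + B.
have B1_gt0 : 0 < B1 by rewrite ltr_wpDr.
pose m0 := `|qp `|q| rho J| / 2.
have m0_gt0 : 0 < m0.
  rewrite divr_gt0 // normr_gt0 qp_neq0 // => i _.
  by rewrite subr_eq0 eq_sym; have := off i 0; rewrite expr0.
have le_rho j z : `|z| = rho * `|q| ^+ j -> `|z| <= rho.
  by move=> ->; rewrite ler_piMr ?(ltW rho0) // exprn_ile1 // ltW.
have le_qp n z : `|z| = rho -> `|qp `|q| rho n| <= `|{z; n}|.
  move=> zE; elim: n => [|n IHn]; first by rewrite !qp0.
  rewrite !qpSr !normrM ler_pM // -zE -normrX -normrM.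
  by rewrite -{1}(normr1 C) ler_dist_dist.
have lower0 z : `|z| = rho -> m0 <= `|{z}oo|.
  move=> zE; rewrite (qpinfD C_arch C_complete q_lt1 z J) normrM ler_pM //.
    exact: le_qp.
  by have := hJ z J (leqnn _); rewrite zE => /(_ (lexx _)) /andP[]; rewrite mul1r.
have lower1 j z : `|z| = rho * `|q| ^+ j -> m0 / B1 <= `|{z}oo|.
  move=> zE; rewrite ler_pdivrMr //.
  have z0E : `|z / q ^+ j| = rho.
    by rewrite normrM normfV normrX zE mulfK // expf_neq0 // gt_eqF.
  apply: le_trans (lower0 _ z0E) _.
  rewrite (qpinfD C_arch C_complete q_lt1 _ j) divfK ?expf_neq0 // normrM.
  rewrite mulrC ler_wpM2l //.
  have [|_ + _ _] := hB (z / q ^+ j); first by rewrite z0E.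
  by move=> /(_ j)/le_trans; apply; rewrite lerDr.
exists (m0 / B1 / B1) => [|j z zE]; first exact: (divr_gt0 (divr_gt0 m0_gt0 B1_gt0) B1_gt0).
split=> [|n].
  apply: le_trans (lower1 _ _ zE); rewrite ler_pdivrMr // ler_peMr ?lerDl //.
  by rewrite ltW // divr_gt0.
rewrite ler_pdivrMr //; apply: le_trans (lower1 _ _ zE) _.
rewrite (qpinfD C_arch C_complete q_lt1 z n) normrM ler_wpM2l //.
have [|_ _ + _] := hB (z * q ^+ n); last by move/le_trans; apply; rewrite lerDr.
apply: le_trans (le_rho _ _ zE).
by rewrite normrM normrX ler_piMr // exprn_ile1 // ltW.
Qed.

Variable b : C.
Hypothesis b_neq0 : b != 0.
Hypothesis qb_lt1 : `|q / b| < 1.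

Local Notation r := `|q / b|.
Local Notation H := (hq q b).

Let r_gt0 : 0 < r.
Proof. by rewrite normr_gt0 mulf_neq0 ?invr_neq0. Qed.

(** [H z n] is the quotient of the values of this function at z q^n and z. Each step z -> z/q
    multiplies it by q/b, up to factors that are bounded on the circles: this is the source of all
    decay. *)
Definition Phi z : C := {z * q / b}oo / {z}oo.

Lemma Phi_shift z j : z != 0 -> {q / z; j} != 0 -> Phi (z / q ^+ j) * {q / z; j}
  = (q / b) ^+ j * Phi z * {b / z; j}.
Proof.
move=> z0 qz0; rewrite /Phi.
have y0 : z * q / b != 0 by rewrite !mulf_neq0 ?invr_neq0.
rewrite (qpinfD C_arch C_complete q_lt1 (z / q ^+ j) j).
rewrite (qpinfD C_arch C_complete q_lt1 (z / q ^+ j * q / b) j).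
have -> : z / q ^+ j * q / b * q ^+ j = z * q / b by field; rewrite b_neq0 expf_neq0.
rewrite divfK ?expf_neq0 //.
have := qp_rev q_neq0 z0 (leqnn j); have := qp_rev q_neq0 y0 (leqnn j).
have -> : q / (z * q / b) = b / z by field; rewrite z0 q_neq0 b_neq0.
have -> : z * q / b / q ^+ j = z / q ^+ j * q / b by ring.
rewrite subnn !qp0 !mulr1; set P := \prod_(_ <= _ < _) _.
have P0 : P != 0 by rewrite prodf_seq_neq0; apply/allP => i _; rewrite /= expf_neq0.
have -> : (- (z * q / b)) ^+ j = (q / b) ^+ j * (- z) ^+ j.
  by rewrite -exprMn; congr (_ ^+ _); ring.
have nz0 : (- z) ^+ j != 0 by rewrite expf_neq0 ?oppr_eq0.
move=> h1 h2.
have h : {z / q ^+ j; j} != 0.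
  apply: contraNneq qz0 => h0; rewrite h0 !mul0r in h2.
  by have /esym/eqP := h2; rewrite mulf_eq0 (negPf nz0).
have -> : {q / z; j} = {z / q ^+ j; j} * P / (- z) ^+ j.
  by apply: canRL (mulfK _) _ => //; rewrite mulrC.
have -> : {z / q ^+ j * q / b; j} = (q / b) ^+ j * (- z) ^+ j * {b / z; j} / P.
  by apply: canRL (mulfK _) _.
rewrite invfM; move: ({z}oo^-1) => w.
by field; rewrite h P0 nz0.
Qed.

Definition up_circle rho (M : nat) z : Prop := `|z| * `|q| ^+ M = rho.
Definition down_circle rho (M : nat) z : Prop := `|z| = rho * `|q| ^+ M.

Lemma up_circleE rho M z : up_circle rho M z ->
  exists2 z0, `|z0| = rho & z = z0 / q ^+ M.
Proof.
by move=> h; exists (z * q ^+ M); rewrite ?normrM ?normrX // mulfK ?expf_neq0.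
Qed.

Lemma Phi_down rho : off_circle rho -> exists2 K, 0 < K &
  forall M z, down_circle rho M z -> `|Phi z| <= K.
Proof.
move=> off; have [rho0 _] := off.
have [m m0 hm] := qp_lower_circle off.
have X0 : 0 <= rho * r by rewrite mulr_ge0 // ltW.
have [B B0 hB] := qpinf_approx C_arch C_complete q_lt1 X0.
exists ((B + 1) / m) => [|M z hz]; first by rewrite divr_gt0 // ltr_wpDl.
rewrite normrM normfV ler_pM ?invr_ge0 //.
  have [|_ _ + _] := hB (z * q / b); last by move=> /le_trans; apply; rewrite lerDl.
  by rewrite -mulrA normrM ler_wpM2r // hz ler_piMr ?(ltW rho0) // exprn_ile1 // ltW.
have [h _] := hm _ _ hz.
by rewrite lef_pV2 // posrE // (lt_le_trans m0).
Qed.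

Lemma qp_upper_circle rho x : off_circle rho -> exists2 K, 0 < K &
  forall z n, `|z| = rho -> `|{x / z; n}| <= K.
Proof.
move=> [rho0 _]; have X0 : 0 <= `|x| / rho by rewrite divr_ge0 // ltW.
have [B B0 hB] := qpinf_approx C_arch C_complete q_lt1 X0.
exists (B + 1) => [|z n hz]; first by rewrite ltr_wpDl.
have [|_ + _ _] := hB (x / z); first by rewrite normrM normfV hz.
by move=> /(_ n) /le_trans; apply; rewrite lerDl.
Qed.

Lemma off_qV rho z : off_circle rho -> `|z| = rho ->
  z != 0 /\ forall n, {q / z; n} != 0.
Proof.
move=> [rho0 off] hz; have z0 : z != 0 by rewrite -normr_gt0 hz.
split=> // n; apply: qp_neq0 => i _; rewrite subr_eq0 eq_sym.
apply/eqP => /(congr1 (fun x => `|x|)); rewrite !normrM normfV normrX normr1 hz => h.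
have /eqP := off 0%N i.+1; apply; rewrite expr0 mulr1 exprS.
by rewrite -[rho]mul1r -h; field; rewrite gt_eqF.
Qed.

Lemma norm_quot (x y z w : C) : `|x * y * z / w| = `|x| * `|y| * `|z| / `|w|.
Proof. by rewrite !normrM normfV. Qed.

Lemma Phi_up rho : off_circle rho -> exists2 K, 0 < K &
  forall M z, up_circle rho M z -> `|Phi z| <= K * r ^+ M.
Proof.
move=> off; have [rho0 _] := off.
have [m m0 hm] := qp_lower_circle (off_circleM (off_circleV off)).
have [K1 K10 hK1] := Phi_down off.
have [K2 K20 hK2] := qp_upper_circle b off.
exists (K1 * K2 / m) => [|M z /up_circleE[z0 hz ->]]; first by rewrite divr_gt0 ?mulr_gt0.
have [z00 hq0] := off_qV off hz.
have -> : Phi (z0 / q ^+ M) = (q / b) ^+ M * Phi z0 * {b / z0; M} / {q / z0; M}.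
  by rewrite -Phi_shift // mulfK.
rewrite norm_quot normrX [_ * r ^+ M]mulrC -3!mulrA ler_wpM2l ?exprn_ge0 //.
rewrite !mulrA ler_pM ?invr_ge0 ?mulr_ge0 //.
  rewrite ler_pM ?hK2 // (hK1 0%N) // /down_circle expr0 mulr1 //.
have [|_ h] := hm 0%N (q / z0); first by rewrite expr0 mulr1 normrM normfV hz mulrC.
by rewrite lef_pV2 // posrE ?normr_gt0.
Qed.

(** The condition on rho / |b| keeps z away from the zeros b q^-(i+1) of [Phi]. *)
Lemma Phi_up_lower rho : off_circle rho -> off_circle (rho / `|b|) -> exists2 m, 0 < m &
  forall M z, up_circle rho M z -> m * r ^+ M <= `|Phi z|.
Proof.
move=> off offb; have [rho0 _] := off.
have [m1 m10 hm1] := qp_lower_circle (off_circleV offb).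
have [m2 m20 hm2] := qp_lower_circle (off_circleM offb).
have [K2 K20 hK2] := qp_upper_circle q off.
have [B B0 hB] := qpinf_approx C_arch C_complete q_lt1 (ltW rho0).
have B1 : 0 < B + 1 by rewrite ltr_wpDl.
have c10 : 0 < m2 / (B + 1) by rewrite divr_gt0.
exists (m2 / (B + 1) * m1 / K2) => [|M z /up_circleE[z0 hz ->]].
  exact: (divr_gt0 (mulr_gt0 c10 m10) K20).
have [z00 hq0] := off_qV off hz.
have -> : Phi (z0 / q ^+ M) = (q / b) ^+ M * Phi z0 * {b / z0; M} / {q / z0; M}.
  by rewrite -Phi_shift // mulfK.
rewrite norm_quot normrX [_ * r ^+ M]mulrC -!mulrA ler_wpM2l ?exprn_ge0 //.
rewrite !mulrA.
have zoo : 0 < `|{z0}oo|.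
  have [m m0 hm] := qp_lower_circle off.
  by have [|h _] := hm 0%N z0; [rewrite expr0 mulr1 | apply: lt_le_trans h].
apply: ler_pM.
- by rewrite ltW // mulr_gt0.
- by rewrite invr_ge0 ltW.
- apply: ler_pM.
  + exact: ltW.
  + exact: ltW.
  + rewrite /Phi normrM normfV; apply: ler_pM.
    * exact: ltW.
    * by rewrite invr_ge0 ltW.
    * have [|h _] := hm2 0%N (z0 * q / b) => //.
      by rewrite expr0 mulr1 !normrM normfV hz mulrAC.
    * rewrite lef_pV2 // ?posrE ?ltr_wpDl //.
      have [|_ _ + _] := hB z0; first by rewrite hz.
      by move=> /le_trans; apply; rewrite lerDl.
  + have [|_ h] := hm1 0%N (b / z0) => //.
    by rewrite expr0 mulr1 normrM normfV hz invf_div.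
- by rewrite lef_pV2 ?hK2 // posrE ?normr_gt0.
Qed.

(* For n > M the point z q^n lies inside the circle of radius rho, and the truncated M - n is 0. *)
Lemma Phi_mixed rho : off_circle rho -> exists2 K, 0 < K &
  forall M n z, up_circle rho M z -> `|Phi (z * q ^+ n)| <= K * r ^+ (M - n).
Proof.
move=> off; have [K1 K10 h1] := Phi_up off; have [K2 K20 h2] := Phi_down off.
exists (K1 + K2) => [|M n z hz]; first by rewrite addr_gt0.
have [lenM|ltMn] := leqP n M.
  have h : up_circle rho (M - n) (z * q ^+ n).
    by rewrite /up_circle normrM normrX -mulrA -exprD subnKC.
  by rewrite (le_trans (h1 _ _ h)) // ler_wpM2r ?exprn_ge0 // lerDl ltW.
have h : down_circle rho (n - M) (z * q ^+ n).
  rewrite /down_circle normrM normrX -hz -mulrA -exprD subnKC //; exact: ltnW.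
have /eqP -> : (M - n == 0)%N by rewrite subn_eq0 ltnW.
by rewrite expr0 mulr1 (le_trans (h2 _ _ h)) // lerDr ltW.
Qed.

Lemma hq_Phi z n : {z}oo != 0 -> {z * q / b}oo != 0 -> H z n = Phi (z * q ^+ n) / Phi z.
Proof.
rewrite /hq /Phi (qpinfD C_arch C_complete q_lt1 z n).
rewrite (qpinfD C_arch C_complete q_lt1 (z * q / b) n).
have -> : z * q / b * q ^+ n = z * q ^+ n * q / b by ring.
rewrite !mulf_eq0 !negb_or => /andP[h1 h2] /andP[h3 h4].
by field; rewrite h1 h2 h3 h4.
Qed.

(** As a quotient of two values of [Phi], [H z n] is at most of order r^(M-n) / r^M, with M - n
    truncated at 0; hence it grows no faster than r^-n, uniformly in M. *)
Lemma hq_up rho : off_circle rho -> off_circle (rho / `|b|) -> exists2 K, 0 < K &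
  forall M n z, up_circle rho M z -> `|H z n| * r ^+ n <= K.
Proof.
move=> off offb; have [K1 K10 h1] := Phi_mixed off.
have [m m0 hm] := Phi_up_lower off offb.
exists (K1 / m) => [|M n z hz]; first by rewrite divr_gt0.
have := hm _ _ hz; have rM : 0 < r ^+ M by rewrite exprn_gt0.
move/(lt_le_trans (mulr_gt0 m0 rM)); rewrite normr_gt0 mulf_eq0 invr_eq0 negb_or.
case/andP=> z1 z2; rewrite hq_Phi // normrM normfV.
have P0 : 0 < `|Phi z| by rewrite normr_gt0 mulf_neq0 ?invr_neq0.
rewrite mulrAC ler_pdivrMr //.
apply: le_trans (_ : K1 * r ^+ (M - n) * r ^+ n <= _).
  by rewrite ler_wpM2r ?exprn_ge0 ?h1.
rewrite -mulrA -exprD -mulrA ler_wpM2l ?(ltW K10) //.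
rewrite [m^-1 * _]mulrC ler_pdivlMr // [_ * m]mulrC.
apply: le_trans (hm _ _ hz); rewrite ler_wpM2l ?(ltW m0) //.
by rewrite ler_wiXn2l ?(ltW r_gt0) ?(ltW qb_lt1) // addnC -leq_subLR.
Qed.

Lemma hq_down rho : off_circle (rho / `|b|) -> exists2 K, 0 < K &
  forall M n z, down_circle rho M z -> `|H z n| <= K.
Proof.
move=> offb; have [m m0 hm] := qp_lower_circle (off_circleM offb).
have b0 : 0 < `|b| by rewrite normr_gt0.
have rho0 : 0 < rho by case: offb; rewrite pmulr_lgt0 // invr_gt0.
have [B B0 hB] := qpinf_approx C_arch C_complete q_lt1 (ltW rho0).
exists ((B + 1) / m) => [|M n z hz]; first by rewrite divr_gt0 // ltr_wpDl.
rewrite normrM normfV ler_pM ?invr_ge0 //.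
  have [|_ + _ _] := hB z; last by move=> /(_ n) /le_trans; apply; rewrite lerDl.
  by rewrite hz ler_piMr ?(ltW rho0) // exprn_ile1 // ltW.
have [|_ /(_ n) h] := hm M (z * q / b).
  by rewrite !normrM normfV hz; ring.
by rewrite lef_pV2 // posrE // (lt_le_trans m0).
Qed.

Lemma hq_bounded x : (forall i, 1 - x * q / b * q ^+ i != 0) ->
  exists2 K, 0 < K & forall n, `|H x n| <= K.
Proof.
move=> /qp_lower[m m0 hm].
have [B B0 hB] := qpinf_approx C_arch C_complete q_lt1 (normr_ge0 x).
exists ((B + 1) / m) => [|n]; first by rewrite divr_gt0 // ltr_wpDl.
rewrite normrM normfV ler_pM ?invr_ge0 //.
  by have [_ + _ _] := hB x (lexx _); move=> /(_ n) /le_trans; apply; rewrite lerDl.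
by rewrite lef_pV2 // posrE // (lt_le_trans m0).
Qed.

End Growth.

(** * A Liouville estimate *)

Section LaurentPolynomials.
Variable C : numClosedFieldType.
Implicit Types (f g h : C -> C) (p : {poly C}) (z w x y : C).

Lemma prim_root_exists n : (0 < n)%N -> exists z : C, n.-primitive_root z.
Proof.
move=> n_gt0; pose p : {poly C} := 'X^n - 1; have [r Dp] := closed_field_poly_normal p.
move: Dp; rewrite (monicP _) ?monicXnsubC // scale1r => Dp.
have rn1 : all n.-unity_root r by apply/allP=> z; rewrite -root_prod_XsubC -Dp.
have sz_r : (n < (size r).+1)%N.
  by rewrite -(size_prod_XsubC r id) -Dp size_XnsubC.
have [|z] := hasP (has_prim_root n_gt0 rn1 _ sz_r); last by exists z.
by rewrite -separable_prod_XsubC -Dp separable_Xn_sub_1 // pnatr_eq0 -lt0n.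
Qed.

(* Cauchy's estimate, with an average over m-th roots of unity, m > deg p. *)
Lemma coef_bound p rho M n : 0 < rho -> (forall z, `|z| = rho -> `|p.[z]| <= M) ->
  `|p`_n| * rho ^+ n <= M.
Proof.
move=> rho0 hM; pose m := (maxn (size p) n.+1).
have m0 : (0 < m)%N by rewrite leq_max orbT.
have [w hw] := prim_root_exists m0.
have wm : w ^+ m = 1 by apply: prim_expr_order.
have w1 : `|w| = 1.
  by apply/eqP; rewrite -(@pexpr_eq1 _ _ m) // -normrX wm normr1.
have w0 : w != 0 by rewrite -normr_gt0 w1.
have sum_w k : (k < m)%N -> \sum_(0 <= j < m) (w ^+ k / w ^+ n) ^+ j
    = (k == n)%:R * m%:R.
  move=> ltkm; have [->|ne] := eqVneq k n.
    rewrite divff ?expf_neq0 // mul1r; under eq_bigr do rewrite expr1n.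
    by rewrite sumr_const_nat subn0.
  rewrite mul0r; set t := w ^+ k / w ^+ n.
  have t1 : t - 1 != 0.
    rewrite subr_eq0; apply: contra ne => /eqP ht.
    have : w ^+ k = w ^+ n by rewrite -[LHS](divfK (expf_neq0 n w0)) -/t ht mul1r.
    move/eqP; rewrite (eq_prim_root_expr hw) !modn_small //.
    by rewrite leq_max leqnn orbT.
  apply: (mulfI t1); rewrite mulr0 big_mkord -subrX1 /t expr_div_n.
  by rewrite -!exprM ![(_ * m)%N]mulnC !exprM wm !expr1n divr1 subrr.
have key : p`_n * rho ^+ n * m%:R = \sum_(0 <= j < m) p.[rho * w ^+ j] / w ^+ (n * j).
  transitivity (\sum_(0 <= j < m) \sum_(0 <= k < m)
      p`_k * rho ^+ k * (w ^+ k / w ^+ n) ^+ j); last first.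
    apply: eq_bigr => j _; rewrite (@horner_coef_wide _ m) ?leq_maxl // mulr_suml.
    rewrite big_mkord; apply: eq_bigr => k _.
    by rewrite [(rho * _) ^+ _]exprMn expr_div_n -!exprM [(j * k)%N]mulnC !mulrA.
  rewrite exchange_big /= big_nat; under eq_bigr => k hk.
    rewrite -mulr_sumr sum_w //; over.
  rewrite -big_nat (bigD1_seq n) ?iota_uniq //=; last first.
    by rewrite mem_index_iota leq_max leqnn orbT.
  rewrite eqxx mul1r big1 ?addr0 // => k /negPf ->.
  by rewrite mul0r mulr0.
have mpos : 0 < m%:R :> C by rewrite ltr0n.
rewrite -(ler_pM2r mpos) -[X in _ * X * _](ger0_norm (exprn_ge0 n (ltW rho0))).
rewrite -[X in _ * X <= _](ger0_norm (ltW mpos)) -!normrM key.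
apply: le_trans (ler_norm_sum _ _ _) _.
rewrite -[m in X in _ <= X]subn0 mulr_natr -sumr_const_nat ler_sum // => j _.
rewrite normrM normfV normrX w1 expr1n invr1 mulr1 hM //.
by rewrite normrM normrX w1 expr1n mulr1 gtr0_norm.
Qed.

Definition laurent g : Prop :=
  exists p k, forall z, z != 0 -> g z = p.[z] / z ^+ k.

Lemma laurent_cst (a : C) : laurent (fun=> a).
Proof. by exists a%:P, 0%N => z _; rewrite hornerC expr0 divr1. Qed.

Lemma laurentX (a : C) : laurent (fun z => a * z).
Proof. by exists (a *: 'X), 0%N => z _; rewrite !hornerE expr0 divr1. Qed.

Lemma laurentV (a : C) : laurent (fun z => a / z).
Proof. by exists a%:P, 1%N => z _; rewrite hornerC expr1. Qed.

Lemma laurentD f g : laurent f -> laurent g -> laurent (fun z => f z + g z).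
Proof.
move=> [p1 [k1 h1]] [p2 [k2 h2]]; exists (p1 * 'X^k2 + p2 * 'X^k1), (k1 + k2)%N => z z0.
by rewrite h1 // h2 // !hornerE /= exprD; field; rewrite !expf_neq0.
Qed.

Lemma laurentM f g : laurent f -> laurent g -> laurent (fun z => f z * g z).
Proof.
move=> [p1 [k1 h1]] [p2 [k2 h2]]; exists (p1 * p2), (k1 + k2)%N => z z0.
by rewrite h1 // h2 // !hornerE /= exprD; field; rewrite !expf_neq0.
Qed.

Lemma geo_half_sum (n : nat) : \sum_(0 <= i < n) (1 / 2 : C) ^+ i <= 2.
Proof.
have -> : \sum_(0 <= i < n) (1 / 2 : C) ^+ i = 2 * (1 - (1 / 2) ^+ n).
  elim: n => [|n IHn]; first by rewrite big_geq // expr0 subrr mulr0.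
  by rewrite big_nat_recr //= IHn exprS; field.
by rewrite ler_piMr // gerBl exprn_ge0 // divr_ge0.
Qed.

(** Cauchy's estimate is used on the outer circle for the powers of nonnegative exponent and on the
    inner one for the others. As |w| stays a factor 2 away from both radii, each half is at most
    delta times a geometric sum of ratio 1/2; two sums bounded by 2 give the constant 4. *)
Lemma laurent_max g r0 R0 w delta : laurent g -> 0 < r0 -> 0 <= delta ->
  2 * r0 <= `|w| -> 2 * `|w| <= R0 ->
  (forall z, `|z| = r0 \/ `|z| = R0 -> `|g z| <= delta) -> `|g w| <= 4 * delta.
Proof.
move=> [p [k gE]] r00 delta0 hr hR hg.
have w0 : 0 < `|w| by apply: lt_le_trans hr; rewrite mulr_gt0.
have R00 : 0 < R0 by apply: lt_le_trans hR; rewrite mulr_gt0.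
have bound rho n : rho = r0 \/ rho = R0 -> 0 < rho -> `|p`_n| * rho ^+ n <= delta * rho ^+ k.
  move=> hrho rho0; apply: coef_bound => // z zE.
  have z0 : z != 0 by rewrite -normr_gt0 zE.
  have -> : p.[z] = g z * z ^+ k by rewrite gE // divfK // expf_neq0.
  by rewrite normrM normrX zE ler_wpM2r ?exprn_ge0 ?(ltW rho0) // hg // zE.
have hR' : `|w| / R0 <= 1 / 2.
  by rewrite ler_pdivrMr // mulrC mulrA mulr1 ler_pdivlMr // mulrC.
have hr' : r0 / `|w| <= 1 / 2.
  by rewrite ler_pdivrMr // mulrC mulrA mulr1 ler_pdivlMr // mulrC.
pose m := (maxn (size p) k).
(* Subtraction is truncated, so one of the two exponents is always 0 and a single bound serves both
   halves. *)
have term n : `|p`_n * w ^+ n| <= `|w| ^+ k * delta * ((1 / 2) ^+ (n - k) * (1 / 2) ^+ (k - n)).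
  rewrite normrM normrX; have [le_kn|/ltnW le_nk] := leqP k n.
    have -> : (k - n = 0)%N by apply/eqP; rewrite subn_eq0.
    rewrite expr0 mulr1.
    apply: le_trans (_ : `|w| ^+ k * (delta * (`|w| / R0) ^+ (n - k)) <= _); last first.
      rewrite -mulrA ler_wpM2l ?exprn_ge0 // ler_wpM2l //.
      by rewrite lerXn2r // nnegrE divr_ge0 // ltW.
    have hb : `|p`_n| * R0 ^+ (n - k) <= delta.
      by rewrite -(ler_pM2r (exprn_gt0 k R00)) -mulrA -exprD subnK // bound //; right.
    have -> : `|w| ^+ n = `|w| ^+ k * `|w| ^+ (n - k) by rewrite -exprD subnKC.
    rewrite mulrCA ler_wpM2l ?exprn_ge0 // expr_div_n.
    by rewrite [_ / _]mulrC mulrA ler_wpM2r ?exprn_ge0 // ler_pdivlMr ?exprn_gt0.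
  have -> : (n - k = 0)%N by apply/eqP; rewrite subn_eq0.
  rewrite expr0 mul1r.
  apply: le_trans (_ : `|w| ^+ k * (delta * (r0 / `|w|) ^+ (k - n)) <= _); last first.
    rewrite -mulrA ler_wpM2l ?exprn_ge0 // ler_wpM2l //.
    by rewrite lerXn2r // nnegrE divr_ge0 // ltW.
  have hb : `|p`_n| <= delta * r0 ^+ (k - n).
    by rewrite -(ler_pM2r (exprn_gt0 n r00)) -mulrA -exprD subnK // bound //; left.
  have -> : `|w| ^+ k * (delta * (r0 / `|w|) ^+ (k - n)) = delta * r0 ^+ (k - n) * `|w| ^+ n.
    by rewrite -{1}(subnKC le_nk) exprD expr_div_n; field; rewrite expf_neq0 // gt_eqF.
  by rewrite ler_wpM2r ?exprn_ge0.
have w0' : w != 0 by rewrite -normr_gt0.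
rewrite gE // normrM normfV normrX ler_pdivrMr ?exprn_gt0 //.
rewrite (@horner_coef_wide _ m) ?leq_maxl //.
apply: le_trans (ler_norm_sum _ _ _) _.
apply: (@le_trans _ _ (\sum_(i < m) `|w| ^+ k * delta
    * ((1 / 2) ^+ (i - k) * (1 / 2) ^+ (k - i)))).
  by apply: ler_sum => i _; apply: term.
rewrite -mulr_sumr [4 * delta * _]mulrC [4 * delta]mulrC mulrA.
rewrite ler_wpM2l ?mulr_ge0 ?exprn_ge0 //.
rewrite -(big_mkord xpredT (fun i => (1 / 2 : C) ^+ (i - k) * (1 / 2) ^+ (k - i))).
rewrite (@big_cat_nat _ _ _ k) ?leq_maxr //= (natrD _ 2 2) lerD //.
  rewrite big_nat_rev /= add0n; apply: le_trans (geo_half_sum k).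
  rewrite !big_nat ler_sum // => i /andP[_ hi].
  have -> : (k - i.+1 - k = 0)%N by rewrite subnAC subnn.
  by rewrite expr0 mul1r subKn // exprS ler_piMl ?exprn_ge0 ?divr_ge0 // ler_pdivrMr // mul1r ler1n.
rewrite -{1}[k]add0n big_addn; apply: le_trans (geo_half_sum (m - k)).
rewrite ler_sum // => i _; rewrite addnK.
have -> : (k - (i + k) = 0)%N by apply/eqP; rewrite subn_eq0 leq_addl.
by rewrite expr0 mulr1.
Qed.

End LaurentPolynomials.

Section Liouville.
Variable C : numClosedFieldType.
Hypothesis C_arch : geo_archimedean C.
Hypothesis C_complete : geo_complete C.
Implicit Types (f g h Q : C -> C) (p : {poly C}) (z w x y : C) (ps : seq C).

Lemma poly_bounded p X : 0 <= X ->
  exists2 B, 0 < B & forall z, `|z| <= X -> `|p.[z]| <= B.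
Proof.
move=> X0; exists (1 + \sum_(i < size p) `|p`_i| * X ^+ i) => [|z hz].
  by rewrite ltr_pwDl // sumr_ge0 // => i _; rewrite mulr_ge0 ?exprn_ge0.
rewrite horner_coef (le_trans (ler_norm_sum _ _ _)) //.
apply: (@le_trans _ _ (\sum_(i < size p) `|p`_i| * X ^+ i)); last by rewrite lerDr.
by apply: ler_sum => i _; rewrite normrM normrX ler_wpM2l // lerXn2r ?nnegrE.
Qed.

(** Newton interpolation. The constant L is fixed before h and eta: values of size eta at the nodes
    are to be removed by a polynomial of size O(eta) on the whole disk, while eta tends to 0. *)
Lemma interpolation ps X : uniq ps -> 0 <= X -> (forall x, x \in ps -> `|x| <= X) ->
  exists2 L, 0 <= L & forall h eta, 0 <= eta ->
  (forall x, x \in ps -> `|h x| <= eta) -> exists p, (forall x, x \in ps -> p.[x] = h x)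
    /\ forall z, `|z| <= X -> `|p.[z]| <= L * eta.
Proof.
move=> + X0; elim: ps => [_ _|x0 ps IHps /= /andP[x0ps Ups] hX].
  by exists 0 => // h eta _ _; exists 0; split=> // z _; rewrite horner0 normr0 mul0r.
have [|L L0 hL] := IHps Ups.
  by move=> x hx; apply: hX; rewrite inE hx orbT.
pose N : {poly C} := \prod_(y <- ps) ('X - y%:P).
have Nx0 : N.[x0] != 0 by rewrite -rootE root_prod_XsubC.
have [B B0 hB] := poly_bounded N X0.
exists (L + (1 + L) / `|N.[x0]| * B) => [|h eta eta0 hh].
  by rewrite addr_ge0 // mulr_ge0 ?(ltW B0) // divr_ge0 // addr_ge0.
have [|p [pE hp]] := hL h eta eta0.
  by move=> x hx; apply: hh; rewrite inE hx orbT.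
exists (p + ((h x0 - p.[x0]) / N.[x0]) *: N); split=> [x|z hz].
  rewrite inE hornerD hornerZ => /orP[/eqP ->|hx].
    by rewrite divfK // addrCA subrr addr0.
  have /eqP -> : N.[x] == 0 by rewrite -rootE root_prod_XsubC.
  by rewrite mulr0 addr0 pE.
rewrite hornerD hornerZ (le_trans (ler_normD _ _)) // [leRHS]mulrDl lerD ?hp //.
rewrite !normrM normfV.
have -> : (1 + L) / `|N.[x0]| * B * eta = (eta + L * eta) / `|N.[x0]| * B by ring.
rewrite ler_pM ?hB ?divr_ge0 // ler_wpM2r ?invr_ge0 //.
rewrite (le_trans (ler_normB _ _)) // lerD //; first by rewrite hh ?inE ?eqxx.
by rewrite hp // hX // inE eqxx.
Qed.

(* Locally uniform limits, on the punctured plane, of Laurent polynomials. *)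
Definition lap f : Prop := forall r0 R0 eps, 0 < r0 -> 0 < eps ->
  exists2 g, laurent g & forall z, r0 <= `|z| <= R0 -> `|f z - g z| <= eps.

Lemma laurent_bounded g r0 R0 : laurent g -> 0 < r0 ->
  exists2 B, 0 < B & forall z, r0 <= `|z| <= R0 -> `|g z| <= B.
Proof.
move=> [p [k gE]] r00; have [R00|] := boolP (0 <= R0); last first.
  move=> hR; exists 1 => // z /andP[h1 h2]; case/negP: hR.
  exact: le_trans (le_trans (normr_ge0 z) h2).
have [B B0 hB] := poly_bounded p R00.
exists (B / r0 ^+ k) => [|z /andP[h1 h2]]; first by rewrite divr_gt0 ?exprn_gt0.
have z0 : 0 < `|z| by apply: lt_le_trans h1.
rewrite gE -?normr_gt0 // normrM normfV normrX ler_pM ?invr_ge0 ?hB ?exprn_ge0 //.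
by rewrite lef_pV2 ?posrE ?exprn_gt0 // lerXn2r ?nnegrE // ltW.
Qed.

Lemma lap_bounded f r0 R0 : lap f -> 0 < r0 ->
  exists2 B, 0 < B & forall z, r0 <= `|z| <= R0 -> `|f z| <= B.
Proof.
move=> hf r00; have [g hg fg] := hf r0 R0 1 r00 ltr01.
have [B B0 hB] := laurent_bounded R0 hg r00.
exists (1 + B) => [|z hz]; first by rewrite addr_gt0.
by rewrite -(subrK (g z) (f z)) (le_trans (ler_normD _ _)) // lerD ?fg ?hB.
Qed.

Lemma laurent_lap g : laurent g -> lap g.
Proof. by move=> hg r0 R0 eps _ /ltW e0; exists g => // z _; rewrite subrr normr0. Qed.

Lemma lap_ext f g : (forall z, z != 0 -> f z = g z) -> lap f -> lap g.
Proof.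
move=> fg hf r0 R0 eps r00 e0; have [h hh fh] := hf r0 R0 eps r00 e0.
exists h => // z hz; rewrite -fg ?fh // -normr_gt0.
by case/andP: hz => hz _; apply: lt_le_trans hz.
Qed.

Lemma lap_cst a : lap (fun=> a).
Proof. exact/laurent_lap/laurent_cst. Qed.

Lemma lapX a : lap (fun z => a * z).
Proof. exact/laurent_lap/laurentX. Qed.

Lemma lapV a : lap (fun z => a / z).
Proof. exact/laurent_lap/laurentV. Qed.

Lemma lapD f g : lap f -> lap g -> lap (fun z => f z + g z).
Proof.
move=> hf hg r0 R0 eps r00 e0; have e2 : 0 < eps / 2 by rewrite divr_gt0.
have [f' lf' ff'] := hf r0 R0 _ r00 e2; have [g' lg' gg'] := hg r0 R0 _ r00 e2.
exists (fun z => f' z + g' z) => [|z hz]; first exact: laurentD.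
by rewrite /= opprD addrACA (le_trans (ler_normD _ _)) // [eps]splitr lerD ?ff' ?gg'.
Qed.

Lemma lapM f g : lap f -> lap g -> lap (fun z => f z * g z).
Proof.
move=> hf hg r0 R0 eps r00 e0; have e2 : 0 < eps / 2 by rewrite divr_gt0.
have [B B0 hB] := lap_bounded R0 hg r00.
have [f' lf' ff'] := hf r0 R0 _ r00 (divr_gt0 e2 B0).
have [A A0 hA] := laurent_bounded R0 lf' r00.
have [g' lg' gg'] := hg r0 R0 _ r00 (divr_gt0 e2 A0).
exists (fun z => f' z * g' z) => [|z hz]; first exact: laurentM.
have -> : f z * g z - f' z * g' z = (f z - f' z) * g z + f' z * (g z - g' z) by ring.
rewrite (le_trans (ler_normD _ _)) // [eps]splitr lerD // normrM.
  by rewrite -[eps / 2](divfK (lt0r_neq0 B0)) ler_pM ?ff' ?hB.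
by rewrite -[eps / 2](divfK (lt0r_neq0 A0)) mulrC ler_pM ?gg' ?hA.
Qed.

Lemma lap_lim (f_ : nat -> C -> C) f : (forall n, lap (f_ n)) ->
  (forall r0 R0, 0 < r0 -> exists K rho, [/\ 0 <= K, 0 <= rho < 1 &
    forall n z, r0 <= `|z| <= R0 -> `|f z - f_ n z| <= K * rho ^+ n]) -> lap f.
Proof.
move=> hf_ hlim r0 R0 eps r00 e0; have e2 : 0 < eps / 2 by rewrite divr_gt0.
have [K [rho [K0 rho01 hK]]] := hlim r0 R0 r00.
have [N hN] := C_arch K0 rho01 e2.
have [g lg hg] := hf_ N r0 R0 _ r00 e2.
exists g => // z hz; rewrite -(subrKA (f_ N z)) (le_trans (ler_normD _ _)) //.
by rewrite [eps]splitr lerD ?hg // (le_trans (hK _ _ hz)) // ltW // hN.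
Qed.

Lemma lap_sum (f_ : nat -> C -> C) n : (forall i, lap (f_ i)) ->
  lap (fun z => \sum_(0 <= i < n) f_ i z).
Proof.
move=> h; elim: n => [|n IHn].
  by apply: (lap_ext _ (lap_cst 0)) => z _; rewrite big_geq.
by apply: (lap_ext _ (lapD IHn (h n))) => z _; rewrite big_nat_recr.
Qed.

Lemma lap_series (f_ : nat -> C -> C) : (forall i, lap (f_ i)) ->
  (forall r0 R0, 0 < r0 -> exists K rho, [/\ 0 <= K, 0 <= rho < 1 &
    forall n z, r0 <= `|z| <= R0 -> `|f_ n z| <= K * rho ^+ n]) ->
  lap (fun z => limn (series (fun n => f_ n z))).
Proof.
move=> hf_ hb; apply: (@lap_lim (fun n z => \sum_(0 <= i < n) f_ i z)).
  by move=> n; apply: lap_sum.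
move=> r0 R0 /(hb r0 R0)[K [rho [K0 rho01 hK]]].
exists (K / (1 - rho)), rho; split=> // [|n z hz].
  by rewrite divr_ge0 // subr_ge0; case/andP: rho01 => _ /ltW.
by have [_] := sum_geo C_complete K0 rho01 (fun n => hK n z hz); apply.
Qed.

Variable q : C.
Hypothesis q_lt1 : `|q| < 1.

Lemma lap_qp h n : lap h -> lap (fun z => qp q (h z) n).
Proof.
move=> hh; elim: n => [|n IHn].
  by apply: (lap_ext _ (lap_cst 1)) => z _; rewrite qp0.
apply: (lap_ext _ (lapM IHn (lapD (lap_cst 1) (lapM hh (lap_cst (- q ^+ n)))))) => z _.
by rewrite qpSr mulrN.
Qed.

Lemma lap_qpinf h : lap h -> lap (fun z => qpoch_inf q (h z)).
Proof.
move=> hh; apply: (@lap_lim (fun n z => qp q (h z) n)) => [n|r0 R0 r00].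
  exact: lap_qp.
have [X X0 hX] := lap_bounded R0 hh r00.
have [B B0 hB] := qpinf_approx C_arch C_complete q_lt1 (ltW X0).
exists B, `|q|; split=> // [|n z hz]; first by rewrite normr_ge0.
by have [_ _ _] := hB _ (hX z hz); apply.
Qed.

(** The zeros are simple only together with [uniq ps], which is assumed where it matters. *)
Definition simple_zeros Q ps : Prop := exists2 a, a != 0 & exists k : nat,
  forall z, z != 0 -> Q z = a / z ^+ k * (\prod_(x <- ps) ('X - x%:P)).[z].

Lemma annulus_containing ps r0 R0 : 0 < r0 -> 0 <= R0 -> (forall x, x \in ps -> x != 0) ->
  exists r1 R1, [/\ 0 < r1, r1 <= r0, R0 <= R1 &
    forall x, x \in ps -> r1 <= `|x| <= R1].
Proof.
move=> r00 R00; elim: ps => [|x ps IHps] hps; first by exists r0, R0.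
have [|r1 [R1 [r10 le_r le_R h]]] := IHps.
  by move=> y hy; apply: hps; rewrite inE hy orbT.
have x0 : 0 < `|x| by rewrite normr_gt0 hps // inE eqxx.
have s0 : 0 < r1 + `|x| by rewrite addr_gt0.
(* The quotient lies below both r1 and |x|, and R1 + |x| lies above both R1 and |x|, so the two
   never have to be compared. *)
have l1 : r1 * `|x| / (r1 + `|x|) <= r1.
  by rewrite ler_pdivrMr // ler_wpM2l ?(ltW r10) // lerDr ltW.
have l2 : r1 * `|x| / (r1 + `|x|) <= `|x|.
  by rewrite ler_pdivrMr // mulrC ler_wpM2l // lerDl.
have R10 : R0 <= R1 + `|x| by rewrite (le_trans le_R) // lerDl.
exists (r1 * `|x| / (r1 + `|x|)), (R1 + `|x|); split=> //.
- by rewrite divr_gt0 ?mulr_gt0.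
- exact: le_trans le_r.
move=> y; rewrite inE => /orP[/eqP ->|/h/andP[h1 h2]].
  by rewrite l2 /= lerDr (le_trans R00).
by rewrite (le_trans l1) //= (le_trans h2) // lerDl.
Qed.

Lemma simple_zeros_lower Q ps rho : simple_zeros Q ps -> 0 < rho ->
  (forall x, x \in ps -> `|x| != rho) ->
  exists2 mu, 0 < mu & forall z, `|z| = rho -> mu <= `|Q z|.
Proof.
move=> [a a0 [k QE]] rho0 hps.
have [mu mu0 hmu] : exists2 mu, 0 < mu & forall z, `|z| = rho ->
    mu <= `|(\prod_(x <- ps) ('X - x%:P)).[z]|.
  elim: ps hps {QE} => [_|x ps IHps hps].
    by exists 1 => // z _; rewrite big_nil hornerC normr1.
  have [|mu mu0 hmu] := IHps; first by move=> y hy; apply: hps; rewrite inE hy orbT.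
  exists (`|rho - `|x| | * mu) => [|z hz].
    by rewrite mulr_gt0 // normr_gt0 subr_eq0 eq_sym hps // inE eqxx.
  rewrite big_cons hornerM normrM !hornerE ler_pM ?(ltW mu0) ?hmu //.
  by rewrite -hz ler_dist_dist.
exists (`|a| / rho ^+ k * mu) => [|z hz].
  by rewrite mulr_gt0 // divr_gt0 ?normr_gt0 ?exprn_gt0.
rewrite QE; last by rewrite -normr_gt0 hz.
by rewrite !normrM normfV normrX hz ler_wpM2l ?hmu // divr_ge0 ?exprn_ge0 // ltW.
Qed.

(** A Laurent approximant P of f, within eps on an annulus containing all of ps, has values of size
    eps on ps. Subtracting the polynomial l that interpolates them makes P - l divisible by Q, so g
    = (P - l) / Q is again a Laurent polynomial and [laurent_max] applies to it; then eps tends to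
    0. *)
Lemma liouville_estimate f Q ps r0 R0 w delta :
  lap f -> uniq ps -> simple_zeros Q ps -> (forall x, x \in ps -> f x = 0) ->
  (forall x, x \in ps -> [/\ x != 0, `|x| != r0 & `|x| != R0]) ->
  0 < r0 -> 0 <= delta -> 2 * r0 <= `|w| -> 2 * `|w| <= R0 ->
  (forall z, `|z| = r0 \/ `|z| = R0 -> `|f z| <= delta * `|Q z|) ->
  `|f w| <= 4 * delta * `|Q w|.
Proof.
move=> hf Ups QP f0 hps r00 delta0 hr hR hQ.
have w0 : 0 < `|w| by apply: lt_le_trans hr; rewrite mulr_gt0.
have leww : `|w| <= 2 * `|w| by rewrite ler_peMl // ler1n.
have R00 : 0 < R0 by apply: lt_le_trans hR; rewrite mulr_gt0.
have lerw : r0 <= `|w| by apply: le_trans hr; rewrite ler_peMl ?ler1n // ltW.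
have lewR : `|w| <= R0 := le_trans leww hR.
have [r1 [R1 [r10 ler1 leR1 psr1]]] : exists r1 R1, [/\ 0 < r1, r1 <= r0, R0 <= R1 &
    forall x, x \in ps -> r1 <= `|x| <= R1].
  by apply: annulus_containing => // [|x /hps[]//]; apply: ltW.
have R10 : 0 <= R1 by apply: le_trans leR1; apply: ltW.
have [|m1 m10 hm1] := simple_zeros_lower QP r00; first by move=> x /hps[].
have [|m2 m20 hm2] := simple_zeros_lower QP R00; first by move=> x /hps[].
pose nu := m1^-1 + m2^-1.
have nu0 : 0 < nu by rewrite addr_gt0 ?invr_gt0.
have hnu z : `|z| = r0 \/ `|z| = R0 -> 0 < `|Q z| /\ `|Q z|^-1 <= nu.
  case=> /[dup] hz; [move=> /hm1 h|move=> /hm2 h].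
    have h0 : 0 < `|Q z| by apply: lt_le_trans h.
    split=> //; apply: le_trans (_ : m1^-1 <= _).
      by rewrite lef_pV2.
    by rewrite lerDl invr_ge0 ltW.
  have h0 : 0 < `|Q z| by apply: lt_le_trans h.
  split=> //; apply: le_trans (_ : m2^-1 <= _).
    by rewrite lef_pV2.
  by rewrite lerDr invr_ge0 ltW.
have [|L L0 hL] := interpolation Ups R10; first by move=> x /psr1/andP[].
(* The total coefficient of eps in the estimates below. *)
pose A := (1 + L) + 4 * ((1 + L) * nu) * `|Q w|.
have A0 : 0 < A.
  have L10 : 0 < 1 + L by rewrite ltr_pwDl.
  by rewrite ltr_pwDl // !mulr_ge0 // ltW.
apply/ler_addgt0Pr => e e0.
pose eps := e / A; have eps0 : 0 < eps by rewrite divr_gt0.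
have [P [p [kp PE]] hP] := hf r1 R1 eps r10 eps0.
have [|l [lE hl]] := hL P eps (ltW eps0).
  move=> x hx; have := hP x; rewrite f0 // sub0r normrN; apply; exact: psr1.
case: QP => a a0 [k QE].
set N := \prod_(x <- ps) ('X - x%:P) in QE.
have [s sE] : exists s, p - l * 'X^kp = s * N.
  apply: uniq_roots_prod_XsubC; last by rewrite uniq_rootsE.
  apply/allP => x hx; rewrite /root !hornerE.
  have x0 : x != 0 by case: (hps x hx).
  by rewrite lE // PE // divfK ?expf_neq0 // subrr.
pose g z := (s * 'X^k).[z] / z ^+ kp * a^-1.
have gE z : z != 0 -> g z * Q z = P z - l.[z].
  move=> z0; rewrite QE // PE //.
  have -> : p = l * 'X^kp + s * N by rewrite -sE addrC subrK.
  by rewrite /g !hornerE /=; field; rewrite a0 !expf_neq0.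
have lg : laurent g by apply: laurentM (laurent_cst _); exists (s * 'X^k), kp.
have bound z : r1 <= `|z| <= R1 -> `|f z - (P z - l.[z])| <= eps + L * eps.
  move=> hz; have -> : f z - (P z - l.[z]) = (f z - P z) + l.[z] by ring.
  rewrite (le_trans (ler_normD _ _)) // lerD ?hP // hl //.
  by case/andP: hz.
have inr z : `|z| = r0 \/ `|z| = R0 -> r1 <= `|z| <= R1.
  case=> ->; rewrite ?ler1 ?leR1 ?andbT /=.
    exact: le_trans (le_trans lerw lewR) leR1.
  exact: le_trans ler1 (le_trans lerw lewR).
have eps_ge0 := ltW eps0.
have epsL : 0 <= eps + L * eps := addr_ge0 eps_ge0 (mulr_ge0 L0 eps_ge0).
have hg : `|g w| <= 4 * (delta + (eps + L * eps) * nu).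
  apply: (laurent_max lg r00 _ hr hR) => [|z hz].
    exact: addr_ge0 delta0 (mulr_ge0 epsL (ltW nu0)).
  have z0 : z != 0 by rewrite -normr_gt0; case: hz => ->.
  have [Qz0 hnuz] := hnu z hz.
  have -> : g z = (P z - l.[z]) / Q z by rewrite -gE // mulfK // -normr_gt0.
  rewrite normrM normfV.
  have -> : P z - l.[z] = f z - (f z - (P z - l.[z])) by rewrite subKr.
  apply: le_trans (_ : (delta * `|Q z| + (eps + L * eps)) / `|Q z| <= _).
    rewrite ler_wpM2r ?invr_ge0 // (le_trans (ler_normB _ _)) // lerD ?hQ ?bound //.
    exact: inr.
  by rewrite mulrDl mulfK ?gt_eqF // lerD2l ler_wpM2l.
have w0' : w != 0 by rewrite -normr_gt0.
rewrite -(subrK (P w - l.[w]) (f w)) (le_trans (ler_normD _ _)) // -gE // normrM.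
apply: le_trans (_ : eps + L * eps + 4 * (delta + (eps + L * eps) * nu) * `|Q w| <= _).
  rewrite lerD ?ler_wpM2r //; rewrite gE // bound //.
  by rewrite (le_trans ler1 lerw) (le_trans lewR leR1).
rewrite le_eqVlt; apply/orP; left; apply/eqP.
transitivity (4 * delta * `|Q w| + eps * A); first by rewrite /A; ring.
by rewrite /eps divfK // gt_eqF.
Qed.

End Liouville.

(** * Radii that avoid several sequences of zeros at once *)

Section OffCircle.
Variable C : numClosedFieldType.
Variable q : C.
Hypothesis q_gt0 : 0 < `|q|.
Hypothesis q_lt1 : `|q| < 1.

(* Pigeonhole: each x excludes at most one of the radii t^j, where t^K = |q|. *)
Lemma exists_off (xs : seq C) : (forall x, x \in xs -> 0 < x) ->
  exists2 rho, 0 < rho & forall x, x \in xs -> off_circle q (rho * x).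
Proof.
move=> xs0; pose K := (size xs).+1; pose t : C := K.-root `|q|.
have tK : t ^+ K = `|q| by rewrite /t rootCK.
have t_ge0 : 0 <= t by rewrite /t rootC_ge0.
have t0 : 0 < t.
  by rewrite lt0r t_ge0 andbT; apply: contraTneq q_gt0 => t0; rewrite -tK t0 expr0n ltxx.
have t1 : t < 1.
  have : t ^+ K < 1 by rewrite tK.
  by rewrite -[X in _ < X -> _](expr1n C K) ltr_pXn2r // nnegrE.
have t_inj i j : t ^+ i = t ^+ j -> i = j.
  move=> h; apply/eqP; rewrite eqn_leq; apply/andP; split.
    by rewrite -(ler_iXn2l t0 t1) h.
  by rewrite -(ler_iXn2l t0 t1) h.
have excl x j j' : 0 < x -> (j < K)%N -> (j' < K)%N ->
    ~ off_circle q (t ^+ j * x) -> ~ off_circle q (t ^+ j' * x) -> j = j'.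
  move=> x0 ltj ltj' hj hj'.
  have bad i : ~ off_circle q (t ^+ i * x) ->
      exists m n, t ^+ i * x * `|q| ^+ m = `|q| ^+ n.
    move=> hi; apply: contrapT => no; apply: hi; split; first by rewrite mulr_gt0 ?exprn_gt0.
    by move=> m n; apply/eqP => h; apply: no; exists m, n.
  have [m [n h]] := bad _ hj; have [m' [n' h']] := bad _ hj'.
  (* Eliminating x from the two coincidences leaves an equality of powers of t, with exponents
     congruent to j and j' modulo K. *)
  have : t ^+ (j + K * (m + n')) = t ^+ (j' + K * (m' + n)).
    rewrite (exprD t j) (exprD t j') !exprM tK !exprD.
    apply: (mulfI (lt0r_neq0 x0)).
    transitivity (t ^+ j * x * `|q| ^+ m * `|q| ^+ n'); first by ring.
    by rewrite h -h'; ring.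
  move/t_inj => e; have := congr1 (modn^~ K) e.
  by rewrite ![(K * _)%N]mulnC ![(_ + _ * K)%N]addnC !modnMDl !modn_small.
suff key : forall (ys : seq C) (js : seq nat), (forall x, x \in ys -> 0 < x) -> uniq js ->
    (forall j, j \in js -> (j < K)%N) -> (size ys < size js)%N ->
    exists2 j, j \in js & forall x, x \in ys -> off_circle q (t ^+ j * x).
  have [j||j _ hj] := key xs (iota 0 K) xs0 (iota_uniq _ _); rewrite ?size_iota //.
    by rewrite mem_iota.
  by exists (t ^+ j); rewrite ?exprn_gt0.
elim=> [[|j js] // _ _ _ _|x ys IHys js ys0 Ujs ltjs szjs].
  by exists j; rewrite ?mem_head.
have x0 : 0 < x by rewrite ys0 ?mem_head.
have ys0' y : y \in ys -> 0 < y by move=> hy; rewrite ys0 // inE hy orbT.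
have [[j0 j0js bad0]|good] := pselect (exists2 j, j \in js & ~ off_circle q (t ^+ j * x)).
  have [|j||j hj offj] := IHys (rem j0 js) ys0'.
  - exact: rem_uniq.
  - by move=> /mem_rem; apply: ltjs.
  - by rewrite size_rem // -ltnS prednK //; case: (js) j0js.
  exists j; first exact: mem_rem hj.
  move=> y; rewrite inE => /orP[/eqP ->|]; last exact: offj.
  apply: contrapT => badj.
  have := excl x j j0 x0 (ltjs _ (mem_rem hj)) (ltjs _ j0js) badj bad0.
  by move=> e; move: hj; rewrite e mem_rem_uniq // inE eqxx.
have [j hj offj] := IHys js ys0' Ujs ltjs (ltnW szjs).
exists j => // y; rewrite inE => /orP[/eqP ->|]; last exact: offj.
by apply: contrapT => badj; apply: good; exists j.
Qed.

End OffCircle.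

(** * Zeros of finite q-products *)

Section SimpleZeros.
Variables (C : numClosedFieldType) (q : C).
Hypothesis q_neq0 : q != 0.

Lemma simple_zerosM Q1 Q2 ps1 ps2 : simple_zeros Q1 ps1 -> simple_zeros Q2 ps2 ->
  simple_zeros (fun z : C => Q1 z * Q2 z) (ps1 ++ ps2).
Proof.
move=> [a1 a10 [k1 h1]] [a2 a20 [k2 h2]]; exists (a1 * a2); first by rewrite mulf_neq0.
exists (k1 + k2)%N => z z0; rewrite h1 // h2 // big_cat hornerM exprD /=.
by field; rewrite !expf_neq0.
Qed.

Lemma simple_zeros_asc (x : C) n : x != 0 ->
  simple_zeros (fun z => qp q (x * z) n) [seq x^-1 / q ^+ j | j <- iota 0 n].
Proof.
move=> x0; elim: n => [|n [a a0 [k IHn]]].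
  by exists 1; rewrite ?oner_eq0 //; exists 0%N => z _; rewrite qp0 big_nil !hornerE expr0 invr1.
exists (- (a * x * q ^+ n)).
  by rewrite oppr_eq0 !mulf_neq0 ?expf_neq0.
exists k => z z0; rewrite qpSr IHn // -[n.+1]addn1 iotaD map_cat big_cat big_seq1 /=.
by rewrite hornerM !hornerE /= ?add0n; field; rewrite !expf_neq0 //= x0.
Qed.

Lemma simple_zeros_desc (x : C) n :
  simple_zeros (fun z => qp q (x / z) n) [seq x * q ^+ j | j <- iota 0 n].
Proof.
elim: n => [|n [a a0 [k IHn]]].
  by exists 1; rewrite ?oner_eq0 //; exists 0%N => z _; rewrite qp0 big_nil !hornerE expr0 invr1.
exists a => //; exists k.+1 => z z0.
rewrite qpSr IHn // -[n.+1]addn1 iotaD map_cat big_cat big_seq1 /=.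
by rewrite hornerM !hornerE /= ?add0n exprSr; field; rewrite !expf_neq0 //= z0.
Qed.

End SimpleZeros.

(** * The unilateral identity *)

Section Difference.
Variable C : numClosedFieldType.
Hypothesis C_arch : geo_archimedean C.
Hypothesis C_complete : geo_complete C.
Variables (q b a : C) (s : nat).
Hypothesis q_gt0 : 0 < `|q|.
Hypothesis q_lt1 : `|q| < 1.
Hypothesis b_neq0 : b != 0.
Hypothesis qb_lt1 : `|q / b| < 1.
Hypothesis aE : a = q ^+ s.
Hypothesis b_gen : forall m n, b * q ^+ m != q ^+ n.

Let q_neq0 : q != 0. Proof. by rewrite -normr_gt0. Qed.
Let a_neq0 : a != 0. Proof. by rewrite aE expf_neq0. Qed.
Let q01 : 0 <= `|q| < 1. Proof. by rewrite normr_ge0. Qed.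

Let q_inf n : q ^+ n.+1 != 1.
Proof.
apply/eqP => /(congr1 (fun x => `|x|)); rewrite normrX normr1 => /eqP.
by rewrite pexpr_eq1 // => /eqP h; move: q_lt1; rewrite h ltxx.
Qed.

Local Notation "{ x ; n }" := (qp q x n) (at level 0, x at level 99).
Local Notation "{ x }oo" := (qpoch_inf q x) (at level 0, x at level 99).
Local Notation H := (hq q b).
Local Notation Cw := (Cw q b a).
Local Notation Fw := (Fw q b a).
Local Notation ooD := (qpinfD C_arch C_complete q_lt1).

Definition nonvan x : Prop := forall i, 1 - x * q ^+ i != 0.

Lemma nonvan_oo x : nonvan x -> {x}oo != 0.
Proof. exact: qpinf_neq0. Qed.

Lemma nonvan_qp x n : nonvan x -> {x; n} != 0.
Proof. by move=> h; apply: qp_neq0 => i _. Qed.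

Lemma nonvan_shift x n : nonvan x -> nonvan (x * q ^+ n).
Proof. by move=> h i; rewrite -mulrA -exprD. Qed.

(** [H y n] times (yq/b;q)_oo, which clears its poles and makes it entire in y. *)
Definition Psi n y : C := {y; n} * {y * q / b * q ^+ n}oo.

Lemma Psi_H n y : nonvan (y * q / b) -> Psi n y = {y * q / b}oo * H y n.
Proof.
move=> h; rewrite /Psi /hq (ooD (y * q / b) n).
by field; rewrite nonvan_qp.
Qed.

Lemma Psi_Phi n y : nonvan y -> Psi n y = {y}oo * Phi q b (y * q ^+ n).
Proof.
move=> h; rewrite /Psi /Phi (ooD y n).
have -> : y * q ^+ n * q / b = y * q / b * q ^+ n by ring.
by field; rewrite nonvan_oo //; apply: nonvan_shift.
Qed.

Lemma PsiD j n y : Psi (j + n) y = {y; j} * Psi n (y * q ^+ j).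
Proof.
rewrite /Psi qpD -!mulrA; congr (_ * (_ * qpoch_inf q _)).
by rewrite exprD; ring.
Qed.

Definition Ssum c d : C :=
  limn (series (fun k => Cw k * Fw d k * (Psi k c * Psi k (a * b / c)))).

Definition Tcoef d n : C := H b n * H d n * (q / b) ^+ (2 * n).

Definition Tsum c d : C :=
  limn (series (fun n => Tcoef d n * (Psi n c * Psi n (c * d / a)))).

Definition Tfun c d : C := {a * b / d}oo / {a * q / d}oo
  * ({a * b / c}oo * {q / (c * d / a)}oo) * Tsum c d.

(** A Jacobi theta function, with zeros at e = b q^n for all integers n. Multiplication by it clears
    the denominators (b/e;q)_oo and (e/b;q)_oo of the two coefficients, e = cd/a. *)
Definition theta e : C := {e / b}oo * {q * b / e}oo.

Definition kap : C := {a * q}oo / {a * b}oo.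

(* The difference of the two sides of the identity, times a factor that makes it
   analytic in c on the punctured plane. *)
Definition Efun c d : C := theta (c * d / a) * Ssum c d
  + kap * (c * d / a / b) * Tfun c d - kap * Tfun (a * b / c) (a * b / d).

(** While the definition displays the denominator (e/b;q)_oo of the second coefficient, this form
    displays the denominator (b/e;q)_oo of the first; the difference explains the factor cd/(ab) in
    [Efun]. *)
Lemma thetaE e : e != 0 -> theta e = - (e / b) * ({b / e}oo * {e * q / b}oo).
Proof.
move=> e0; rewrite /theta.
rewrite (qpinfS C_arch C_complete q_lt1 (e / b)) (qpinfS C_arch C_complete q_lt1 (b / e)).
have -> : e / b * q = e * q / b by ring.
have -> : b / e * q = q * b / e by ring.
by field; rewrite e0 b_neq0.
Qed.

Lemma dualK x : x != 0 -> a * b / (a * b / x) = x.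
Proof. by move=> x0; field; rewrite x0 b_neq0 a_neq0. Qed.

Lemma Efun_dual c d : c != 0 -> d != 0 ->
  Efun (a * b / c) (a * b / d) = - (b / (c * d / a)) * Efun c d.
Proof.
move=> c0 d0; rewrite /Efun !dualK //.
have -> : Ssum (a * b / c) (a * b / d) = Ssum c d.
  rewrite /Ssum; congr (limn (series _)); apply/funext => k.
  by rewrite dualK // (FwV q_neq0 b_neq0 aE) // [Psi k c * _]mulrC.
have -> : a * b / c * (a * b / d) / a = b ^+ 2 / (c * d / a).
  by field; rewrite c0 d0 a_neq0.
set e := c * d / a; have e0 : e != 0 by rewrite !mulf_neq0 ?invr_neq0.
rewrite !thetaE ?mulf_neq0 ?invr_neq0 ?expf_neq0 //.
have -> : b / (b ^+ 2 / e) = e / b by field; rewrite e0 b_neq0.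
have -> : b ^+ 2 / e * q / b = b / e * q by field; rewrite e0 b_neq0.
rewrite (qpinfS C_arch C_complete q_lt1 (e / b)) (qpinfS C_arch C_complete q_lt1 (b / e)).
have -> : e / b * q = e * q / b by ring.
by field; rewrite e0 b_neq0.
Qed.

Lemma nonvan_aq : nonvan (a * q).
Proof. by move=> i; rewrite aE -exprSr -exprD addSn subr_eq0 eq_sym. Qed.

Lemma nonvan_ab : nonvan (a * b).
Proof.
by move=> i; rewrite mulrC aE mulrA -exprD mulrC subr_eq0 eq_sym -(expr0 q).
Qed.

Lemma nonvan_q : nonvan q.
Proof. by move=> i; rewrite -exprS subr_eq0 eq_sym. Qed.

Lemma nonvan_qb m n : nonvan (q ^+ m / (b * q ^+ n)).
Proof.
move=> i; have h : b * q ^+ n != 0 by rewrite mulf_neq0 ?expf_neq0.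
rewrite subr_eq0 eq_sym mulrAC -exprD.
by apply/eqP => /(canRL (divfK h)) /eqP; rewrite mul1r eq_sym (negPf (b_gen _ _)).
Qed.

Lemma Efun_qV N d : d != 0 -> nonvan (d * q / b) -> nonvan (a * q / d) ->
  nonvan (a * b / d) -> nonvan (q ^- N * d / a * q / b) -> Efun (q ^- N) d = 0.
Proof.
move=> d0 h1 h2 h3 h4; rewrite /Efun.
set c := q ^- N; set e := c * d / a.
have c0 : c != 0 by rewrite invr_neq0 ?expf_neq0.
have e0 : e != 0 := mulf_neq0 (mulf_neq0 c0 d0) (invr_neq0 a_neq0).
have -> : Tfun (a * b / c) (a * b / d) = 0.
  rewrite /Tfun !dualK // (_ : {c}oo = 0) ?(mul0r, mulr0) //.
  by apply: (qpinf_eq0 C_arch C_complete q_lt1 (i := N)); rewrite mulVf ?subrr ?expf_neq0.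
rewrite mulr0 subr0.
have nc : nonvan (c * q / b).
  have -> : c * q / b = q ^+ 1 / (b * q ^+ N) by rewrite /c; field; rewrite b_neq0 expf_neq0.
  exact: nonvan_qb.
have eaqc : a * b / c * q / b = a * q * q ^+ N.
  by rewrite /c invrK; field.
have naqc : nonvan (a * b / c * q / b) by rewrite eaqc; apply/nonvan_shift/nonvan_aq.
have SE : Ssum c d = {c * q / b}oo * {a * q * q ^+ N}oo
    * (\sum_(0 <= k < N.+1) Cw k * Fw c k * Fw d k).
  rewrite /Ssum mulr_sumr (@limn_series_finite _ N.+1) => [|n hn]; last first.
    by rewrite Psi_H // h_qV_eq0 // !(mulr0, mul0r).
  apply: eq_bigr => k _; rewrite !Psi_H // eaqc /Fw; ring.
have TE : Tsum c d = {c * q / b}oo * {e * q / b}oo * symsum q b a N.+1 c d.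
  rewrite /Tsum mulr_sumr (@limn_series_finite _ N.+1) => [|n hn]; last first.
    by rewrite Psi_H // h_qV_eq0 // !(mulr0, mul0r).
  by apply: eq_bigr => k _; rewrite !Psi_H // /Tcoef -/e; ring.
have reg : regular q b a N d by split; rewrite ?nonvan_qp.
have := terminating q_neq0 b_neq0 aE q_inf b_gen reg.
rewrite (conv_symsum q_neq0 b_neq0 aE q_inf b_gen reg) ?nonvan_qp // -/c.
rewrite SE /Tfun TE thetaE // /kap /Kw.
move: (\sum_(_ <= _ < _) _) (symsum _ _ _ _ _ _) => X Y.
have hbN := hb_neq0 b_neq0 q_inf b_gen N.
have n1 := nonvan_qp N nonvan_ab; have n2 := nonvan_qp N nonvan_aq.
have n3 := nonvan_qp N h2; have n4 := nonvan_qp N h3.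
move=> hT; have -> : X = {a * q; N} / {a * b; N} * (H (a * b / d) N * Y).
  apply: (mulfI hbN).
  transitivity ({a * q; N} / {a * b; N} * (H b N * H (a * b / d) N * Y)); last by ring.
  by rewrite -hT; field; rewrite n1 n2.
rewrite /hq.
have -> : a * b / d * q / b = a * q / d by field; rewrite d0 b_neq0.
have -> : a * b / c = a * b * q ^+ N by rewrite /c invrK.
rewrite (ooD (a * b) N) (ooD (a * q) N) (ooD (a * b / d) N) (ooD (a * q / d) N).
have -> : a * b / d * q ^+ N = b / e by rewrite /e /c; field; rewrite d0 a_neq0 !expf_neq0.
have -> : a * q / d * q ^+ N = q / e by rewrite /e /c; field; rewrite d0 a_neq0 !expf_neq0.
have n5 : {q / e}oo != 0.
  apply: nonvan_oo; have -> : q / e = a * q / d * q ^+ N.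
    by rewrite /e /c; field; rewrite d0 a_neq0 !expf_neq0.
  exact: nonvan_shift.
have n6 : {a * b * q ^+ N}oo != 0 by apply/nonvan_oo/nonvan_shift/nonvan_ab.
by field; rewrite n1 ?n2 n3 ?n4 n5 n6 b_neq0.
Qed.

Lemma qp_bdd x : exists2 B, 0 < B & forall n, `|{x; n}| <= B.
Proof.
have [B B1 hB] := qp_bounded C_arch q_lt1 (normr_ge0 x).
by exists B => [|n]; [apply: lt_le_trans B1 | apply: hB].
Qed.

Lemma qpV_bdd x : nonvan x -> exists2 B, 0 < B & forall n, `|{x; n}^-1| <= B.
Proof.
move=> /(qp_lower C_arch C_complete q_lt1)[m m0 hm].
exists m^-1 => [|n]; first by rewrite invr_gt0.
by rewrite normfV lef_pV2 // posrE // (lt_le_trans m0).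
Qed.

Lemma Psi_bdd X : 0 <= X -> exists2 B, 0 < B & forall n y, `|y| <= X -> `|Psi n y| <= B.
Proof.
move=> X0; have Y0 : 0 <= X * `|q / b| by rewrite mulr_ge0.
have [B1 B10 hB1] := qpinf_approx C_arch C_complete q_lt1 X0.
have [B2 B20 hB2] := qpinf_approx C_arch C_complete q_lt1 Y0.
exists (B1 * B2 + 1) => [|n y hy]; first by rewrite ltr_wpDl ?mulr_ge0.
apply: le_trans (_ : B1 * B2 <= _); last by rewrite lerDl.
rewrite normrM ler_pM //; first by have [_ + _ _] := hB1 y hy; apply.
have [|_ _ + _] := hB2 (y * q / b * q ^+ n); last by [].
rewrite -[y * q / b]mulrA normrM normrX normrM.
apply: le_trans (_ : `|y| * `|q / b| <= _); last by rewrite ler_wpM2r.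
by rewrite ler_piMr ?mulr_ge0 // exprn_ile1 // ltW.
Qed.

Lemma nonvan_qbb : nonvan (b * q / b).
Proof. by rewrite mulrAC divff // mul1r; apply: nonvan_q. Qed.

Lemma nonvan_aqb : nonvan (a * q / b).
Proof. by have := @nonvan_qb s.+1 0; rewrite mulr1 exprSr -aE. Qed.

Lemma Tcoef_bdd d : nonvan (d * q / b) ->
  exists2 K, 0 < K & forall n, `|Tcoef d n| <= K * `|q / b| ^+ (2 * n).
Proof.
move=> hd; have [K1 K10 h1] := hq_bounded C_arch C_complete q_lt1 nonvan_qbb.
have [K2 K20 h2] := hq_bounded C_arch C_complete q_lt1 hd.
exists (K1 * K2) => [|n]; first by rewrite mulr_gt0.
by rewrite /Tcoef normrM normrX ler_wpM2r ?exprn_ge0 // normrM ler_pM.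
Qed.

Lemma vwp_bdd : exists2 K, 0 < K & forall k, `|vwp q a k| <= K.
Proof.
have [B B0 hB] := qp_bdd (a * q); have [B' B'0 hB'] := qpV_bdd nonvan_q.
have A0 : 0 < 1 + `|a| by rewrite ltr_pwDl.
have K0 : 0 < (1 + `|a|) * B * B' by rewrite !mulr_gt0.
exists (1 + (1 + `|a|) * B * B') => [|[|k]]; first by rewrite addr_gt0.
  by rewrite /vwp normr1 lerDl ltW.
apply: le_trans (_ : (1 + `|a|) * B * B' <= _); last by rewrite lerDr.
rewrite /vwp !normrM; apply: ler_pM => //.
apply: ler_pM => //; rewrite (le_trans (ler_normB _ _)) // normr1 lerD2l.
by rewrite normrM normrX ler_piMr // exprn_ile1 // ltW.
Qed.

Lemma Dw_bdd d : nonvan (d * q / b) -> nonvan (a * q / d) -> d != 0 ->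
  exists2 K, 0 < K & forall k, `|Dw q b a k * Fw d k| <= K * `|q / b| ^+ k.
Proof.
move=> hd hd' d0.
have hd'' : nonvan (a * b / d * q / b).
  by have -> : a * b / d * q / b = a * q / d by field; rewrite d0 b_neq0.
have [B1 B10 hB1] := qp_bdd (a * q / b); have [B2 B20 hB2] := qpV_bdd nonvan_ab.
have [B3 B30 hB3] := qp_bdd b; have [B4 B40 hB4] := qpV_bdd nonvan_aqb.
have [K2 K20 h2] := hq_bounded C_arch C_complete q_lt1 hd.
have [K3 K30 h3] := hq_bounded C_arch C_complete q_lt1 hd''.
exists ((B1 * B2) * (B3 * B4) * (K2 * K3)) => [|k]; first by rewrite !mulr_gt0.
rewrite /Dw mulrAC normrM normrX ler_wpM2r ?exprn_ge0 //.
have e3 : `|{b; k} / {a * q / b; k}| <= B3 * B4 by rewrite normrM ler_pM.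
have e2 : `|{a * q / b; 2 * k} / {a * b; 2 * k}| <= B1 * B2 by rewrite normrM ler_pM.
have e4 : `|Fw d k| <= K2 * K3 by rewrite normrM ler_pM.
move: ({b; k} / _) e3 ({a * q / b; 2 * k} / _) e2 (Fw d k) e4 => y hy x hx f hf.
by rewrite !normrM; do !(apply: ler_pM => //); rewrite ?mulr_ge0.
Qed.

Lemma Scoef_bdd d : nonvan (d * q / b) -> nonvan (a * q / d) -> d != 0 ->
  exists2 K, 0 < K & forall k, `|Cw k * Fw d k| <= K * `|q / b| ^+ k.
Proof.
move=> hd hd' d0; have [K1 K10 h1] := vwp_bdd; have [K2 K20 h2] := Dw_bdd hd hd' d0.
exists (K1 * K2) => [|k]; first by rewrite mulr_gt0.
by rewrite /Cw -(mulrA _ (Dw _ _ _ k)) normrM -[leRHS]mulrA ler_pM.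
Qed.

Lemma cvg_Tsum c d : nonvan (d * q / b) ->
  cvgn (series (fun n => Tcoef d n * (Psi n c * Psi n (c * d / a)))).
Proof.
move=> /Tcoef_bdd[K K0 hK].
have [B1 B10 hB1] := Psi_bdd (normr_ge0 c).
have [B2 B20 hB2] := Psi_bdd (normr_ge0 (c * d / a)).
have KB : 0 <= K * (B1 * B2) by rewrite !mulr_ge0 // ltW.
have r01 : 0 <= `|q / b| < 1 by rewrite normr_ge0.
have [n|h _] := sum_geo C_complete KB r01
  (u := fun n => Tcoef d n * (Psi n c * Psi n (c * d / a))).
  rewrite normrM [leRHS]mulrAC; apply: ler_pM => //; last by rewrite normrM ler_pM ?hB1 ?hB2.
  rewrite (le_trans (hK n)) // ler_wpM2l ?(ltW K0) //.
  by rewrite ler_wiXn2l ?(ltW qb_lt1) // mulSn leq_addr.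
by apply: (cvgP _ h).
Qed.

(** The dual of the product cd/a = b q^j is b q^-j, and [Psi n] of it contains (q^(n+1-j);q)_oo,
    which is 0 for n < j. As ab/c = d q^-j and ab/d = c q^-j, the shift n -> j + n turns the dual
    series into the original one, with c and d exchanged. *)
Lemma Tsum_shift j c d : d != 0 -> c * d / a = b * q ^+ j ->
  nonvan (d * q / b) -> nonvan (c / q ^+ j * q / b) ->
  Tsum (a * b / c) (a * b / d) = H b j * H (c / q ^+ j) j * (q / b) ^+ (2 * j)
    * {d / q ^+ j; j} * {d * q / b}oo * {b / q ^+ j; j} * {q}oo
    / ({c * q / b}oo * {q * q ^+ j}oo) * Tsum c d.
Proof.
move=> d0 eE hd hc.
have qj0 : q ^+ j != 0 by rewrite expf_neq0.
have c0 : c != 0.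
  apply: contraTneq (mulf_neq0 b_neq0 qj0) => c0.
  by rewrite -eE c0 !mul0r eqxx.
have dE : a * b / c = d / q ^+ j.
  apply: (mulIf qj0); rewrite divfK // mulrAC -(mulrA a) -eE.
  by field; rewrite c0 a_neq0.
have cE : a * b / d = c / q ^+ j.
  apply: (mulIf qj0); rewrite divfK // mulrAC -(mulrA a) -eE.
  by field; rewrite d0 a_neq0.
have e'E : a * b / c * (a * b / d) / a = b / q ^+ j.
  have -> : a * b / c * (a * b / d) / a = b ^+ 2 / (c * d / a).
    by field; rewrite c0 d0 a_neq0.
  by rewrite eE; field; rewrite qj0 b_neq0.
have nq := nonvan_oo nonvan_q; have nqj := nonvan_oo (nonvan_shift j nonvan_q).
have nc : {c * q / b}oo != 0.
  apply: nonvan_oo; have -> : c * q / b = c / q ^+ j * q / b * q ^+ j.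
    by field; rewrite qj0 b_neq0.
  exact: nonvan_shift.
set kj := (X in _ = X * _).
have key m : Tcoef (a * b / d) (j + m) * (Psi (j + m) (a * b / c)
      * Psi (j + m) (a * b / c * (a * b / d) / a))
    = kj * (Tcoef d m * (Psi m c * Psi m (c * d / a))).
  rewrite e'E dE cE eE !PsiD !divfK // /Tcoef.
  have hD x : H x (j + m) = H x j * H (x * q ^+ j) m.
    rewrite /hq !qpD invfM -!mulrA; congr (_ * _); rewrite mulrCA; congr (_ * (_ * (qp q _ m)^-1)).
    by ring.
  rewrite !hD divfK //.
  have nd := nonvan_oo hd.
  rewrite (Psi_H _ hd) (Psi_H _ nonvan_qbb) /kj.
  have ncv : nonvan (c * q / b).
    have -> : c * q / b = c / q ^+ j * q / b * q ^+ j by field; rewrite qj0 b_neq0.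
    exact: nonvan_shift.
  have ebj : b * q ^+ j * q / b = q * q ^+ j by field.
  have nbj : nonvan (b * q ^+ j * q / b) by rewrite ebj; apply/nonvan_shift/nonvan_q.
  rewrite (Psi_H _ ncv) (Psi_H _ nbj) ebj.
  have -> : b * q / b = q by field.
  by rewrite mulnDr exprD; field; rewrite nc nqj.
rewrite /Tsum (@limn_series_shift _ j).
- rewrite (limn_seriesZ key) //; exact: cvg_Tsum.
- move=> n ltnj; suff -> : Psi n (a * b / c * (a * b / d) / a) = 0 by rewrite !mulr0.
  rewrite e'E /Psi (@qpinf_eq0 _ C_arch C_complete _ q_lt1 _ (j - n.+1)) ?mulr0 //.
  apply/eqP; rewrite subr_eq0; apply/eqP.
  have -> : q ^+ j = q ^+ (j - n.+1) * q ^+ n * q by rewrite -exprD -exprSr -addnS subnK.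
  by field; rewrite !expf_neq0 // b_neq0 q_neq0.
- have -> : (fun n => Tcoef (a * b / d) (j + n) * (Psi (j + n) (a * b / c)
      * Psi (j + n) (a * b / c * (a * b / d) / a)))
    = (fun m => kj * (Tcoef d m * (Psi m c * Psi m (c * d / a)))) by apply/funext.
  exact: (cvgP _ (cvg_seriesZ (k := kj) (@cvg_Tsum c d hd))).
Qed.

(* At c d = a b q^j the first j terms of one 4phi3 vanish, and the rest is
   proportional to the other one. *)
Lemma Efun_shift j c d : d != 0 -> c * d / a = b * q ^+ j ->
  nonvan (d * q / b) -> nonvan (c / q ^+ j * q / b) -> Efun c d = 0.
Proof.
move=> d0 eE hd hc; rewrite /Efun /Tfun (Tsum_shift d0 eE hd hc).
have qj0 : q ^+ j != 0 by rewrite expf_neq0.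
have c0 : c != 0.
  apply: contraTneq (mulf_neq0 b_neq0 qj0) => c0.
  by rewrite -eE c0 !mul0r eqxx.
have dE : a * b / c = d / q ^+ j.
  apply: (mulIf qj0); rewrite divfK // mulrAC -(mulrA a) -eE.
  by field; rewrite c0 a_neq0.
have cE : a * b / d = c / q ^+ j.
  apply: (mulIf qj0); rewrite divfK // mulrAC -(mulrA a) -eE.
  by field; rewrite d0 a_neq0.
have e'E : a * b / c * (a * b / d) / a = b / q ^+ j.
  have -> : a * b / c * (a * b / d) / a = b ^+ 2 / (c * d / a).
    by field; rewrite c0 d0 a_neq0.
  by rewrite eE; field; rewrite qj0 b_neq0.
have -> : theta (c * d / a) = 0.
  rewrite eE /theta; case: j {eE hc qj0 dE cE e'E} => [|j].
    by rewrite expr0 mulr1 divff // (qpinfS C_arch C_complete q_lt1 1) subrr !mul0r.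
  rewrite (@qpinf_eq0 _ C_arch C_complete _ q_lt1 (q * b / _) j) ?mulr0 //.
  by rewrite exprS; field; rewrite q_neq0 b_neq0 expf_neq0.
rewrite mul0r add0r !dualK // e'E eE.
have -> : a * q / (a * b / d) = d * q / b by field; rewrite d0 b_neq0 a_neq0.
have -> : a * q / d = c / q ^+ j * q / b by rewrite -cE; field; rewrite d0 b_neq0.
rewrite dE cE.
have -> : q / (b * q ^+ j) = q / b / q ^+ j by field; rewrite b_neq0 qj0.
have -> : q / (b / q ^+ j) = q / b * q ^+ j by field; rewrite b_neq0 qj0.
have -> : b * q ^+ j / b = q ^+ j by field.
have hcb : {c * q / b}oo != 0.
  apply: nonvan_oo; have -> : c * q / b = c / q ^+ j * q / b * q ^+ j.
    by field; rewrite qj0 b_neq0.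
  exact: nonvan_shift.
have hcj := nonvan_qp j hc; have hdd := nonvan_oo hd.
rewrite (ooD (c / q ^+ j) j) (ooD (c / q ^+ j * q / b) j) (ooD (d / q ^+ j) j).
rewrite (ooD (q / b / q ^+ j) j) (ooD q j) !divfK //.
have -> : c / q ^+ j * q / b * q ^+ j = c * q / b by field; rewrite qj0 b_neq0.
rewrite (ooD (q / b) j) /hq.
have -> : b * q / b = q by field.
have nq := nonvan_qp j nonvan_q.
have nqq := nonvan_oo (nonvan_shift j nonvan_q).
have rev : {q / b / q ^+ j; j} * {q / b; j} = (q / b ^+ 2) ^+ j * ({b; j} * {b / q ^+ j; j}).
  have y0 : q / b != 0 by rewrite mulf_neq0 ?invr_neq0.
  have := qp_rev q_neq0 b_neq0 (leqnn j); have := qp_rev q_neq0 y0 (leqnn j).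
  have -> : q / (q / b) = b by field; rewrite q_neq0 b_neq0.
  rewrite subnn !qp0 !mulr1; set P := \prod_(_ <= _ < _) _.
  have P0 : P != 0 by rewrite prodf_seq_neq0; apply/allP => i _; rewrite /= expf_neq0.
  move=> h1 h2; apply: (mulIf P0).
  have nb : (- b) ^+ j != 0 by rewrite expf_neq0 ?oppr_eq0.
  apply: (mulIf nb); transitivity ({q / b / q ^+ j; j} * P * ((- b) ^+ j * {q / b; j})).
    by ring.
  rewrite h1 -h2.
  have -> : (- (q / b)) ^+ j = (q / b ^+ 2) ^+ j * (- b) ^+ j.
    by rewrite -exprMn; congr (_ ^+ _); field.
  by ring.
have -> : (q / b) ^+ (2 * j) = q ^+ j * (q / b ^+ 2) ^+ j.
  by rewrite exprM -exprMn; congr (_ ^+ _); field.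
apply/eqP; rewrite subr_eq0; apply/eqP.
transitivity (kap * q ^+ j * ({c / q ^+ j; j} * {c}oo / ({c / q ^+ j * q / b; j} * {c * q / b}oo)
  * {d / q ^+ j; j} * {d}oo * {q / b * q ^+ j}oo * Tsum c d)
  * ({q / b / q ^+ j; j} * {q / b; j})); first by ring.
by rewrite rev; field; rewrite hdd hcb hcj nq nqq.
Qed.

(** * Analyticity of the difference in c *)

Lemma lap_Psi (h : C -> C) n : lap h -> lap (fun z => Psi n (h z)).
Proof.
move=> hh; apply: lapM; first exact: lap_qp.
apply: (lap_qpinf C_arch C_complete q_lt1).
apply: (lap_ext _ (lapM hh (lap_cst (q / b * q ^+ n)))) => z _; ring.
Qed.

Lemma lap_series_Psi (u : nat -> C) (f g : C -> C) K :
  0 <= K -> (forall n, `|u n| <= K * `|q / b| ^+ n) -> lap f -> lap g ->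
  lap (fun z => limn (series (fun n => u n * (Psi n (f z) * Psi n (g z))))).
Proof.
move=> K0 hK hf hg; apply: lap_series => // [n|r0 R0 r00].
  by apply: lapM (lap_cst _) (lapM (lap_Psi _ hf) (lap_Psi _ hg)).
have [X1 X10 hX1] := lap_bounded R0 hf r00; have [X2 X20 hX2] := lap_bounded R0 hg r00.
have [B1 B10 hB1] := Psi_bdd (ltW X10); have [B2 B20 hB2] := Psi_bdd (ltW X20).
exists (K * (B1 * B2)), `|q / b|; split; rewrite ?normr_ge0 //.
  by rewrite !mulr_ge0 // ltW.
move=> n z hz; rewrite normrM [leRHS]mulrAC; apply: ler_pM => //.
by rewrite normrM ler_pM ?hB1 ?hB2 ?hX1 ?hX2.
Qed.

Lemma Tcoef_bdd1 d : nonvan (d * q / b) ->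
  exists2 K, 0 < K & forall n, `|Tcoef d n| <= K * `|q / b| ^+ n.
Proof.
move=> /Tcoef_bdd[K K0 hK]; exists K => // n.
rewrite (le_trans (hK n)) // ler_wpM2l ?(ltW K0) //.
by rewrite ler_wiXn2l ?(ltW qb_lt1) // mulSn leq_addr.
Qed.

(** d lies outside q^Z and b q^Z. This keeps the denominators in d nonzero and the zeros of [Qfun]
    in c distinct; it is stable under d -> ab/d because a is a power of q. *)
Record generic d : Prop := Generic {
  generic_neq0 : d != 0;
  generic_q : forall m n, d * q ^+ m != q ^+ n;
  generic_b : forall m n, d * q ^+ m != b * q ^+ n }.

Lemma generic_nonvan d : generic d ->
  [/\ nonvan d, nonvan (d * q / b), nonvan (a * q / d) & nonvan (a * b / d)].
Proof.
case=> d0 dq db; split=> i; rewrite subr_eq0 eq_sym.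
- by have := dq i 0%N.
- apply: contra (db i.+1 0%N) => /eqP h; apply/eqP.
  by rewrite expr0 mulr1 -[b]mul1r -h exprS; field.
- apply: contra (dq 0%N (s + i.+1)%N) => /eqP h; apply/eqP.
  by rewrite expr0 mulr1 exprD -aE -[d]mul1r -h exprS; field.
- apply: contra (db 0%N (s + i)%N) => /eqP h; apply/eqP.
  by rewrite expr0 mulr1 exprD -aE -[d]mul1r -h; field.
Qed.

Lemma generic_dual d : generic d -> generic (a * b / d).
Proof.
case=> d0 dq db; split=> [|m n|m n]; first by rewrite !mulf_neq0 ?invr_neq0.
- apply: contra (db n (s + m)%N) => /eqP h; apply/eqP.
  by rewrite exprD -aE -h; field.
- apply: contra (dq n (s + m)%N) => /eqP h; apply/eqP; apply: (mulfI b_neq0).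
  by rewrite exprD -aE mulrCA -h; field.
Qed.

Lemma lapXr (x y : C) : lap (fun z : C => z * x / y).
Proof. by apply: (lap_ext _ (lapX (x / y))) => z _; ring. Qed.

Lemma lap_Tfun d : generic d -> lap (fun c => Tfun c d).
Proof.
move=> gd; have [_ nv1 _ _] := generic_nonvan gd; have d0 := generic_neq0 gd.
have [K K0 hK] := Tcoef_bdd1 nv1.
apply: lapM; last first.
  apply: lap_series_Psi (ltW K0) hK _ (lapXr d a).
  by apply: (lap_ext _ (lapX 1)) => z _; rewrite mul1r.
apply: lapM (lap_cst _) (lapM _ _); apply: (lap_qpinf C_arch C_complete q_lt1).
  exact: lapV.
by apply: (lap_ext _ (lapV (a * q / d))) => z z0; field; rewrite z0 d0 a_neq0.
Qed.

Lemma lap_Tfun_dual d : generic d -> lap (fun c => Tfun (a * b / c) (a * b / d)).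
Proof.
move=> gd; have d0 := generic_neq0 gd.
have [_ nv1 _ _] := generic_nonvan (generic_dual gd).
have [K K0 hK] := Tcoef_bdd1 nv1.
apply: lapM; last first.
  apply: lap_series_Psi (ltW K0) hK (lapV _) _.
  by apply: (lap_ext _ (lapV (a * b ^+ 2 / d))) => z z0; field; rewrite z0 d0 a_neq0.
apply: lapM (lap_cst _) (lapM _ _); apply: (lap_qpinf C_arch C_complete q_lt1).
  by apply: (lap_ext _ (lapX 1)) => z z0; rewrite mul1r dualK.
apply: (lap_ext _ (lapX (q * d / (a * b ^+ 2)))) => z z0.
by field; rewrite z0 d0 a_neq0 b_neq0.
Qed.

Lemma lap_Efun d : generic d -> lap (fun c => Efun c d).
Proof.
move=> gd; have d0 := generic_neq0 gd; have [_ nv1 nv2 _] := generic_nonvan gd.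
have [K K0 hK] := Scoef_bdd nv1 nv2 d0.
have lapid : lap (fun z : C => z).
  by apply: (lap_ext _ (lapX 1)) => z _; rewrite mul1r.
have lth : lap (fun c => theta (c * d / a)).
  apply: lapM; apply: (lap_qpinf C_arch C_complete q_lt1).
    by apply: (lap_ext _ (lapX (d / a / b))) => z _; ring.
  by apply: (lap_ext _ (lapV (q * b * a / d))) => z z0; field; rewrite z0 d0 a_neq0.
have lS : lap (fun c => Ssum c d) by apply: lap_series_Psi (ltW K0) hK lapid (lapV _).
have le : lap (fun c => kap * (c * d / a / b)).
  by apply: (lap_ext _ (lapX (kap * (d / a / b)))) => z _; ring.
apply: (lap_ext _ (lapD (lapD (lapM lth lS) (lapM le (lap_Tfun gd)))
  (lapM (lap_cst (- kap)) (lap_Tfun_dual gd)))) => z _.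
by rewrite /Efun mulNr.
Qed.

(* Efun vanishes at all the zeros of Qfun in c. *)
Definition Qfun c d : C := {c}oo * {a * b / c}oo * theta (c * d / a).

Lemma nonvan_up rho M z : off_circle q rho -> up_circle q rho M z -> nonvan z.
Proof.
move=> [_ off] h i; rewrite subr_eq0; apply: contra (off i M) => /eqP e; apply/eqP.
by rewrite -h mulrAC -normrX -normrM -e normr1 mul1r.
Qed.

Lemma nonvan_down rho M z : off_circle q rho -> down_circle q rho M z -> nonvan z.
Proof.
move=> [_ off] h i; rewrite subr_eq0; apply: contra (off (M + i)%N 0%N) => /eqP e; apply/eqP.
by rewrite expr0 exprD mulrA -h -normrX -normrM -e normr1.
Qed.

Local Notation r := `|q / b|.
Local Notation sigma := (sqrtC `|q / b|).

Let r_gt0 : 0 < r.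
Proof. by rewrite normr_gt0 mulf_neq0 ?invr_neq0. Qed.

Lemma sigma01 : 0 <= sigma < 1.
Proof. by rewrite sqrtC_ge0 normr_ge0 -(@expr_lt1 _ 2) ?sqrtC_ge0 // sqrtCK. Qed.

Lemma sigma_le m n : (n <= 2 * m)%N -> r ^+ m <= sigma ^+ n.
Proof.
have /andP[s0 s1] := sigma01.
by move=> h; rewrite -{1}[r]sqrtCK -exprM ler_wiXn2l ?(ltW s1).
Qed.

(** With truncated subtraction k + (M - k) = max(k, M) >= (k + M)/2. Taking the square root of r
    shares the decay evenly between the summation index k and the circle M. *)
Lemma sigma_exp k M : r ^+ k * r ^+ (M - k) <= sigma ^+ M * sigma ^+ k.
Proof.
by rewrite -!exprD sigma_le //; lia.
Qed.

Lemma norm_sum_sigma (u : nat -> C) K : 0 <= K ->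
  (forall n, `|u n| <= K * sigma ^+ n) ->
  `|limn (series u)| <= K / (1 - sigma).
Proof. by move=> K0 h; apply: (norm_sum_geo C_complete K0 sigma01 h). Qed.

(** * Growth of the difference on large circles *)

Section Circle.
Variables (d rho : C).
Hypothesis gd : generic d.
Hypothesis off1 : off_circle q rho.
Hypothesis off2 : off_circle q (rho / `|a * b|).
Hypothesis off3 : off_circle q (rho * `|d / a|).
Hypothesis off4 : off_circle q (rho * `|d / a| / `|b|).

Let d0 : d != 0 := generic_neq0 gd.
Let sig1 : 0 < 1 - sigma.
Proof. by rewrite subr_gt0; case/andP: sigma01. Qed.

Lemma up_e M c : up_circle q rho M c -> up_circle q (rho * `|d / a|) M (c * d / a).
Proof. by rewrite /up_circle -mulrA normrM mulrAC => ->. Qed.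

Lemma up_neq0 rho' M c : 0 < rho' -> up_circle q rho' M c -> c != 0.
Proof.
move=> rho0 h; apply: contraTneq rho0 => c0.
by rewrite -h c0 normr0 mul0r ltxx.
Qed.

Lemma down_V x rho' M z : 0 < rho' -> up_circle q rho' M z ->
  down_circle q (rho' / `|x|)^-1 M (x / z).
Proof.
move=> rho0 h; have z0 := up_neq0 rho0 h.
rewrite /down_circle -h invfM invrK invfM normrM normfV.
by field; rewrite normr_eq0 z0 expf_neq0 // gt_eqF.
Qed.

(** After (c;q)_oo and (ab/c;q)_oo are factored out by [Psi_Phi], the coefficient is of order r^k,
    the factor in c at most of order r^(M-k), and the factor in ab/c, a point on a small circle, is
    bounded. *)
Lemma growth_S : exists2 K, 0 < K & forall M c, up_circle q rho M c ->
  `|Ssum c d| <= K * sigma ^+ M * (`|{c}oo| * `|{a * b / c}oo|).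
Proof.
have [_ nv1 nv2 _] := generic_nonvan gd.
have [K1 K10 h1] := Scoef_bdd nv1 nv2 d0.
have [K2 K20 h2] := Phi_mixed C_arch C_complete q_gt0 q_lt1 b_neq0 off1.
have [K3 K30 h3] := Phi_down C_arch C_complete q_gt0 q_lt1 b (off_circleV off2).
have [rho0 _] := off1.
exists (K1 * K2 * K3 / (1 - sigma)) => [|M c hc]; first by rewrite divr_gt0 ?mulr_gt0.
have nc := nonvan_up off1 hc; have hab := down_V (a * b) rho0 hc.
have nab := nonvan_down (off_circleV off2) hab.
set P := `|{c}oo| * _.
have P0 : 0 <= P by rewrite mulr_ge0.
have s0 : 0 <= sigma by case/andP: sigma01.
have L0 : 0 <= K1 * K2 * K3 * sigma ^+ M * P.
  by rewrite !mulr_ge0 ?exprn_ge0 // ltW.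
have -> : K1 * K2 * K3 / (1 - sigma) * sigma ^+ M * P
    = K1 * K2 * K3 * sigma ^+ M * P / (1 - sigma) by ring.
apply: norm_sum_sigma => // k.
rewrite !Psi_Phi // normrM.
have e1 := h1 k; have e2 := h2 M k c hc.
have e3 : `|Phi q b (a * b / c * q ^+ k)| <= K3.
  apply: (h3 (M + k)%N); rewrite /down_circle normrM hab normrX exprD; ring.
apply: (@le_trans _ _ (K1 * r ^+ k * (`|{c}oo| * (K2 * r ^+ (M - k)) * (`|{a * b / c}oo| * K3)))).
  apply: ler_pM => //; rewrite normrM; apply: ler_pM => //; rewrite normrM; exact: ler_wpM2l.
apply: (@le_trans _ _ (K1 * K2 * K3 * P * (r ^+ k * r ^+ (M - k)))).
  by rewrite le_eqVlt; apply/orP; left; apply/eqP; rewrite /P; ring.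
apply: (@le_trans _ _ (K1 * K2 * K3 * P * (sigma ^+ M * sigma ^+ k))).
  by rewrite ler_wpM2l ?sigma_exp // !mulr_ge0 // ltW.
by rewrite le_eqVlt; apply/orP; left; apply/eqP; ring.
Qed.

(** Of the two factors r^k in [Tcoef], one pays for the growth of [H (c * d / a) k]; the other, with
    the bound r^(M-k) for the factor in c, gives the decay. The factor (q/e;q)_oo, e = cd/a, is
    compared with (b/e;q)_oo, a factor of [theta]. *)
Lemma growth_T : exists2 K, 0 < K & forall M c, up_circle q rho M c ->
  `|kap * (c * d / a / b) * Tfun c d| <= K * sigma ^+ M * `|Qfun c d|.
Proof.
have [_ nv1 nv2 _] := generic_nonvan gd.
have [K1 K10 h1] := Tcoef_bdd nv1.
have [K2 K20 h2] := Phi_mixed C_arch C_complete q_gt0 q_lt1 b_neq0 off1.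
have [K3 K30 h3] := hq_up C_arch C_complete q_gt0 q_lt1 b_neq0 qb_lt1 off3 off4.
have [K4 K40 h4] := Phi_down C_arch C_complete q_gt0 q_lt1 b (off_circleV off4).
have [rho0 _] := off1; have [rhoe0 _] := off3.
pose A := `|kap * ({a * b / d}oo / {a * q / d}oo)| + 1.
have A0 : 0 < A by rewrite ltr_wpDl.
exists (A * K4 * (K1 * K2 * K3 / (1 - sigma))) => [|M c hc].
  by rewrite !mulr_gt0 // invr_gt0.
have c0 := up_neq0 rho0 hc; have he := up_e hc.
have e0 := up_neq0 rhoe0 he.
have nc := nonvan_up off1 hc.
have hbe := down_V b rhoe0 he.
have nbe := nonvan_oo (nonvan_down (off_circleV off4) hbe).
have neqb : nonvan (c * d / a * q / b).
  apply: (@nonvan_up (rho * `|d / a| / `|b| * `|q|) M); first exact: off_circleM.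
  by rewrite /up_circle -he (normrM (c * d / a * q)) normfV (normrM (c * d / a)); ring.
rewrite /Qfun thetaE // /Tfun; set e := c * d / a in he e0 hbe nbe neqb *.
have sum_le : `|Tsum c d| <= K1 * K2 * K3 * sigma ^+ M * (`|{c}oo| * `|{e * q / b}oo|)
    / (1 - sigma).
  set P := `|{c}oo| * _.
  have P0 : 0 <= P by rewrite mulr_ge0.
  have s0 : 0 <= sigma by case/andP: sigma01.
  apply: norm_sum_sigma => [|k]; first by rewrite !mulr_ge0 ?exprn_ge0 // ltW.
  rewrite Psi_Phi // -/e Psi_H // normrM.
  have e1 := h1 k; have e2 := h2 M k c hc; have e3 := h3 M k e he.
  apply: (@le_trans _ _ (K1 * r ^+ (2 * k) * (`|{c}oo| * (K2 * r ^+ (M - k))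
      * (`|{e * q / b}oo| * `|H e k|)))).
    apply: ler_pM => //; rewrite normrM normrM ler_pM ?mulr_ge0 ?ler_wpM2l //.
    by rewrite normrM.
  apply: (@le_trans _ _ (K1 * K2 * P * (`|H e k| * r ^+ k) * (r ^+ k * r ^+ (M - k)))).
    rewrite le_eqVlt; apply/orP; left; apply/eqP; rewrite mul2n -addnn exprD /P; ring.
  apply: (@le_trans _ _ (K1 * K2 * P * K3 * (sigma ^+ M * sigma ^+ k))).
    apply: ler_pM; rewrite ?sigma_exp ?ler_wpM2l ?mulr_ge0 ?exprn_ge0 // ?ltW //.
  by rewrite le_eqVlt; apply/orP; left; apply/eqP; ring.
have phi_le : `|Phi q b (b / e)| <= K4 := h4 M _ hbe.
have -> : {q / e}oo = Phi q b (b / e) * {b / e}oo.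
  by rewrite /Phi divfK //; congr qpoch_inf; field; rewrite e0 b_neq0.
clearbody e; move: ({a * b / d}oo / {a * q / d}oo) @A A0 => W A A0.
have -> : kap * (e / b) * (W * ({a * b / c}oo * (Phi q b (b / e) * {b / e}oo)) * Tsum c d)
    = (kap * W) * Phi q b (b / e) * (e / b * {a * b / c}oo * {b / e}oo) * Tsum c d by ring.
have -> : {c}oo * {a * b / c}oo * (- (e / b) * ({b / e}oo * {e * q / b}oo))
    = - ((e / b * {a * b / c}oo * {b / e}oo) * ({c}oo * {e * q / b}oo)) by ring.
move: (e / b * _ * _) (Phi _ _ _) phi_le => Y phi phi_le.
rewrite normrN 4!(normrM _ Y, normrM _ (Tsum c d), normrM _ phi, normrM Y)
  [`|_ * {e * q / b}oo|]normrM.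
apply: (@le_trans _ _ (A * K4 * `|Y| * (K1 * K2 * K3 * sigma ^+ M * (`|{c}oo| * `|{e * q / b}oo|)
    / (1 - sigma)))).
  apply: ler_pM; rewrite ?mulr_ge0 //; apply: ler_pM; rewrite ?mulr_ge0 //.
  by apply: ler_pM => //; rewrite lerDl.
by rewrite le_eqVlt; apply/orP; left; apply/eqP; ring.
Qed.

(** Here the dual parameters lie on small circles, so the series is merely bounded relative to its
    products. The decay in M comes from the prefactor: (q/e';q)_oo / (e/b;q)_oo is [Phi] at e/b, on
    a large circle. *)
Lemma growth_T_dual : exists2 K, 0 < K & forall M c, up_circle q rho M c ->
  `|kap * Tfun (a * b / c) (a * b / d)| <= K * sigma ^+ M * `|Qfun c d|.
Proof.
have [_ nv1 _ _] := generic_nonvan (generic_dual gd).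
have [K1 K10 h1] := Tcoef_bdd nv1.
have off2' := off_circleV off2; have off4' := off_circleV off4.
have [K2 K20 h2] := Phi_down C_arch C_complete q_gt0 q_lt1 b off2'.
have nb : `|b| != 0 by rewrite normr_eq0.
have off5 : off_circle q ((rho * `|d / a| / `|b|)^-1 * `|b| / `|b|) by rewrite mulfK.
have [K3 K30 h3] := hq_down C_arch C_complete q_gt0 q_lt1 b_neq0 off5.
have [K4 K40 h4] := Phi_up C_arch C_complete q_gt0 q_lt1 b_neq0 off4.
have [rho0 _] := off1; have [rhoe0 _] := off3.
have s0 : 0 <= sigma by case/andP: sigma01.
pose W := {a * b / (a * b / d)}oo / {a * q / (a * b / d)}oo.
pose A := `|kap * W| + 1.
have A0 : 0 < A by rewrite ltr_wpDl.
exists (A * K4 * (K1 * K2 * K3 / (1 - sigma))) => [|M c hc].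
  by rewrite !mulr_gt0 // invr_gt0.
have c0 := up_neq0 rho0 hc; have he := up_e hc.
have e0 := up_neq0 rhoe0 he.
have hab := down_V (a * b) rho0 hc; have nab := nonvan_down off2' hab.
rewrite /Tfun -/W /Qfun /theta dualK //.
set e' := a * b / c * (a * b / d) / a.
have e'E : e' = b ^+ 2 / (c * d / a).
  by rewrite /e'; field; rewrite c0 d0 a_neq0.
set e := c * d / a in he e0 e'E *.
have heb : up_circle q (rho * `|d / a| / `|b|) M (e / b).
  by rewrite /up_circle -he normrM normfV; ring.
have neb := nonvan_oo (nonvan_up off4 heb).
have hbe := down_V b rhoe0 he.
have he' : down_circle q ((rho * `|d / a| / `|b|)^-1 * `|b|) M e'.
  rewrite /down_circle e'E expr2 -mulrA normrM hbe; ring.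
have nqbe : nonvan (q * b / e).
  apply: (@nonvan_down ((rho * `|d / a| / `|b|)^-1 * `|q|) M); first exact: off_circleM.
  by rewrite /down_circle -mulrA normrM hbe; ring.
have e'q : e' * q / b = q * b / e by rewrite e'E; field; rewrite e0 b_neq0.
have sum_le : `|Tsum (a * b / c) (a * b / d)|
    <= K1 * K2 * K3 * (`|{a * b / c}oo| * `|{q * b / e}oo|) / (1 - sigma).
  set P := `|{a * b / c}oo| * _.
  have P0 : 0 <= P by rewrite mulr_ge0.
  apply: norm_sum_sigma => [|k]; first by rewrite !mulr_ge0 ?exprn_ge0 // ltW.
  have ne'q : nonvan (e' * q / b) by rewrite e'q.
  rewrite Psi_Phi // -/e' Psi_H // normrM e'q.
  have e1 := h1 k; have e3 := h3 M k e' he'.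
  have e2 : `|Phi q b (a * b / c * q ^+ k)| <= K2.
    apply: (h2 (M + k)%N); rewrite /down_circle normrM hab normrX exprD; ring.
  apply: (@le_trans _ _ (K1 * r ^+ (2 * k) * (`|{a * b / c}oo| * K2
      * (`|{q * b / e}oo| * K3)))).
    apply: ler_pM => //; rewrite normrM ler_pM //.
      by rewrite normrM ler_wpM2l.
    by rewrite normrM ler_wpM2l.
  apply: (@le_trans _ _ (K1 * K2 * K3 * P * r ^+ (2 * k))).
    by rewrite le_eqVlt; apply/orP; left; apply/eqP; rewrite /P; ring.
  have K123 : 0 <= K1 * K2 * K3 by rewrite !mulr_ge0 // ltW.
  by apply: ler_wpM2l; [exact: mulr_ge0 | by rewrite sigma_le // mulnA leq_pmull].
have phi_le : `|Phi q b (e / b)| <= K4 * sigma ^+ M.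
  apply: le_trans (h4 M _ heb) _; apply: ler_wpM2l; first exact: ltW.
  by rewrite sigma_le // leq_pmull.
have -> : {q / e'}oo = Phi q b (e / b) * {e / b}oo.
  by rewrite /Phi divfK //; congr qpoch_inf; rewrite e'E; field; rewrite e0 b_neq0.
clearbody e; move: W @A A0 => W A A0.
have -> : kap * (W * ({c}oo * (Phi q b (e / b) * {e / b}oo)) * Tsum (a * b / c) (a * b / d))
    = (kap * W) * Phi q b (e / b) * ({c}oo * {e / b}oo) * Tsum (a * b / c) (a * b / d) by ring.
have -> : {c}oo * {a * b / c}oo * ({e / b}oo * {q * b / e}oo)
    = ({c}oo * {e / b}oo) * ({a * b / c}oo * {q * b / e}oo) by ring.
move: ({c}oo * _) (Phi _ _ _) phi_le => Y phi phi_le.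
rewrite 4!(normrM _ Y, normrM _ (Tsum _ _), normrM _ phi, normrM Y) [`|_ * {q * b / e}oo|]normrM.
apply: (@le_trans _ _ (A * (K4 * sigma ^+ M) * `|Y|
    * (K1 * K2 * K3 * (`|{a * b / c}oo| * `|{q * b / e}oo|) / (1 - sigma)))).
  apply: ler_pM; rewrite ?mulr_ge0 //; apply: ler_pM; rewrite ?mulr_ge0 //.
  by apply: ler_pM => //; rewrite lerDl.
by rewrite le_eqVlt; apply/orP; left; apply/eqP; ring.
Qed.

Lemma growth : exists2 K, 0 < K & forall M c, up_circle q rho M c ->
  `|Efun c d| <= K * sigma ^+ M * `|Qfun c d|.
Proof.
have [K1 K10 h1] := growth_S; have [K2 K20 h2] := growth_T.
have [K3 K30 h3] := growth_T_dual.
exists (K1 + K2 + K3) => [|M c hc]; first by rewrite !addr_gt0.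
have -> : (K1 + K2 + K3) * sigma ^+ M * `|Qfun c d| = K1 * sigma ^+ M * `|Qfun c d|
    + K2 * sigma ^+ M * `|Qfun c d| + K3 * sigma ^+ M * `|Qfun c d| by ring.
rewrite /Efun (le_trans (ler_normB _ _)) // lerD ?h3 //.
rewrite (le_trans (ler_normD _ _)) // lerD ?h2 //.
rewrite normrM /Qfun (normrM (_ * _)) mulrA mulrC ler_wpM2r //.
by rewrite normrM; apply: h1.
Qed.

End Circle.

(** * Zeros and vanishing of the difference *)

Lemma Efun_circle d : generic d -> exists rho K, [/\ 0 < rho, 0 < K &
  forall M c, up_circle q rho M c ->
    [/\ c != 0, Qfun c d != 0 & `|Efun c d| <= K * sigma ^+ M * `|Qfun c d|]].
Proof.
move=> gd; have d0 := generic_neq0 gd.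
have nab : 0 < `|a * b| by rewrite normr_gt0 mulf_neq0.
have nda : 0 < `|d / a| by rewrite normr_gt0 mulf_neq0 ?invr_neq0.
have nb : 0 < `|b| by rewrite normr_gt0.
have [|rho rho0 off] := @exists_off C q q_gt0 q_lt1
    [:: 1; `|a * b|^-1; `|d / a|; `|d / a| / `|b|].
  move=> x; rewrite !inE => /or4P[] /eqP -> //; by rewrite ?invr_gt0 ?divr_gt0.
have off1 : off_circle q rho by rewrite -[rho]mulr1; apply: off; rewrite inE eqxx.
have off2 : off_circle q (rho / `|a * b|) by apply: off; rewrite !inE eqxx orbT.
have off3 : off_circle q (rho * `|d / a|) by apply: off; rewrite !inE eqxx !orbT.
have off4 : off_circle q (rho * `|d / a| / `|b|).
  by rewrite -mulrA; apply: off; rewrite !inE eqxx !orbT.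
have [K K0 hK] := growth gd off1 off2 off3 off4.
exists rho, K; split=> // M c hc; have c0 := up_neq0 rho0 hc; split=> //; last exact: hK.
have he := up_e d hc; have rhoe : 0 < rho * `|d / a| by rewrite mulr_gt0.
have e0 := up_neq0 rhoe he.
have n1 := nonvan_oo (nonvan_up off1 hc).
have n2 := nonvan_oo (nonvan_down (off_circleV off2) (down_V (a * b) rho0 hc)).
have n3 := nonvan_oo (nonvan_down (off_circleV off4) (down_V b rhoe he)).
have n4 : {c * d / a * q / b}oo != 0.
  apply/nonvan_oo/(@nonvan_up (rho * `|d / a| / `|b| * `|q|) M); first exact: off_circleM.
  by rewrite /up_circle -he (normrM (c * d / a * q)) normfV (normrM (c * d / a)); ring.
rewrite /Qfun thetaE //; move: n1 n2 n3 n4 e0; move: (c * d / a) => e n1 n2 n3 n4 e0.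
have eb : - (e / b) != 0 by rewrite oppr_eq0 mulf_neq0 ?invr_neq0.
exact: (mulf_neq0 (mulf_neq0 n1 n2) (mulf_neq0 eb (mulf_neq0 n3 n4))).
Qed.

Lemma theta_dual e : e != 0 -> theta (b ^+ 2 / e) = - (b / e) * theta e.
Proof.
move=> e0; rewrite thetaE ?mulf_neq0 ?invr_neq0 ?expf_neq0 // /theta.
have -> : b / (b ^+ 2 / e) = e / b by field; rewrite e0 b_neq0.
have -> : b ^+ 2 / e * q / b = q * b / e by field; rewrite e0 b_neq0.
by congr (- _ * _); field; rewrite e0 b_neq0.
Qed.

Lemma Qfun_dual c d : c != 0 -> d != 0 ->
  Qfun (a * b / c) (a * b / d) = - (b / (c * d / a)) * Qfun c d.
Proof.
move=> c0 d0; rewrite /Qfun dualK //.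
have -> : a * b / c * (a * b / d) / a = b ^+ 2 / (c * d / a).
  by field; rewrite c0 d0 a_neq0.
rewrite theta_dual; first by ring.
exact: (mulf_neq0 (mulf_neq0 c0 d0) (invr_neq0 a_neq0)).
Qed.

(** [Qfun] with each of its four infinite products cut after J factors, in the shapes that
    [simple_zeros_asc] and [simple_zeros_desc] expect. *)
Definition Qfin J c d : C := {1 * c; J} * {a * b / c; J}
  * ({d / a / b * c; J} * {q * b * a / d / c; J}).

Definition Qroots J d : seq C := ([seq 1^-1 / q ^+ j | j <- iota 0 J]
  ++ [seq a * b * q ^+ j | j <- iota 0 J])
  ++ ([seq (d / a / b)^-1 / q ^+ j | j <- iota 0 J]
  ++ [seq q * b * a / d * q ^+ j | j <- iota 0 J]).

Lemma Qfin_simple J d : d != 0 -> simple_zeros (fun c => Qfin J c d) (Qroots J d).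
Proof.
move=> d0; apply: simple_zerosM; apply: simple_zerosM; try exact: simple_zeros_desc.
  by apply: simple_zeros_asc; rewrite // oner_neq0.
by apply: simple_zeros_asc => //; rewrite !mulf_neq0 ?invr_neq0.
Qed.

Lemma Qfun_fin J c d : c != 0 -> d != 0 -> Qfun c d = Qfin J c d
  * ({c * q ^+ J}oo * {a * b / c * q ^+ J}oo
  * ({d / a / b * c * q ^+ J}oo * {q * b * a / d / c * q ^+ J}oo)).
Proof.
move=> c0 d0; rewrite /Qfun /theta /Qfin mul1r.
have -> : c * d / a / b = d / a / b * c by ring.
have -> : q * b / (c * d / a) = q * b * a / d / c by field; rewrite c0 d0 a_neq0.
rewrite (ooD c J) (ooD (a * b / c) J) (ooD (d / a / b * c) J) (ooD (q * b * a / d / c) J).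
ring.
Qed.

(** A coincidence between q^-i and a b q^j is excluded by [b_gen], one between these and the zeros
    of the theta factor by genericity of d, and one within the latter because q is not a root of
    unity. *)
Lemma uniq_Qroots J d : generic d -> uniq (Qroots J d).
Proof.
move=> [d0 dq db].
have qn0 n : q ^+ n != 0 by rewrite expf_neq0.
have d' : d / a / b != 0 by rewrite !mulf_neq0 ?invr_neq0.
have x1 : 1^-1 / q ^+ 0 != 0 :> C by rewrite mulf_neq0 ?invr_neq0 ?oner_neq0.
have ab0 : a * b != 0 by rewrite mulf_neq0.
have qbad : q * b * a / d != 0 by rewrite !mulf_neq0 ?invr_neq0.
have inj := qX_inj q_neq0 q_inf.
rewrite /Qroots !cat_uniq !map_inj_uniq ?iota_uniq; last 4 first.
- by move=> i j /(mulfI qbad) /inj.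
- by move=> i j /(mulfI (invr_neq0 d')) /invr_inj /inj.
- by move=> i j /(mulfI ab0) /inj.
- by move=> i j; rewrite invr1 !mul1r => /invr_inj /inj.
rewrite /= !andbT; apply/and3P; split.
- apply/hasPn => _ /mapP[j _ ->]; apply/mapP => -[i _ h].
  have /eqP := b_gen (s + j + i)%N 0; apply.
  by rewrite !exprD -aE mulrA mulrA [b * a]mulrC h expr0; field.
- apply/hasPn => x; rewrite !mem_cat => hx; apply/negP => hx'; move: hx hx'.
  case/orP=> /mapP[j _ ->] /orP[] /mapP[i _ h].
  + have /eqP := db j (s + i)%N; apply.
    rewrite exprD -aE -[d * _]mul1r; have := congr1 (fun y => y * q ^+ i * (d * q ^+ j)) h.
    rewrite /= invr1 mul1r mulVf // => <-; field; rewrite !qn0 d0 a_neq0 b_neq0 //.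
  + have /eqP := dq (i + j)%N 0%N; apply.
    apply: (mulfI ab0); rewrite expr0 mulr1 exprD.
    transitivity (a * b * q ^+ i * d * q ^+ j); first by ring.
    by rewrite -h; field; rewrite !qn0 d0 a_neq0 b_neq0.
  + have /eqP := db 0%N (s + j.+1 + i)%N; apply.
    rewrite expr0 mulr1 !exprD -aE exprS.
    transitivity (1^-1 / q ^+ i * d * q ^+ i); first by field.
    by rewrite -h; field.
  + have /eqP := dq i j.+1; apply; apply: (mulfI ab0); rewrite exprS.
    transitivity (a * b * q ^+ i * d); first by ring.
    by rewrite -h; field.
- apply/hasPn => _ /mapP[j _ ->]; apply/mapP => -[i _ h].
  have /eqP := q_inf (j + i); apply; rewrite exprS exprD.
  have n1 : a * b / d != 0 by rewrite !mulf_neq0 ?invr_neq0.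
  apply: (mulfI n1); transitivity (q * b * a / d * q ^+ j * q ^+ i); first by ring.
  by rewrite h; field; rewrite !qn0 d0 a_neq0 b_neq0.
Qed.

Lemma Efun_Qroots J d x : generic d -> x \in Qroots J d -> x != 0 /\ Efun x d = 0.
Proof.
move=> gd; have [d0 _ _] := gd; have gd' := generic_dual gd; have [d0' _ _] := gd'.
have qn0 n : q ^+ n != 0 by rewrite expf_neq0.
have [nv0 nv1 nv2 nv3] := generic_nonvan gd.
have [nv0' nv1' nv2' nv3'] := generic_nonvan gd'.
have nveq y N : generic y -> nonvan (q ^- N * y / a * q / b).
  case=> y0 _ yb i; rewrite subr_eq0 eq_sym; apply: contra (yb i.+1 (s + N)%N) => /eqP h.
  apply/eqP; rewrite exprD -aE -[b]mul1r -h exprS; field.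
  by rewrite !qn0 a_neq0 b_neq0.
have dual y : y != 0 -> Efun y (a * b / d) = 0 -> Efun (a * b / y) d = 0.
  by move=> y0 h; have := Efun_dual y0 d0'; rewrite dualK // h mulr0.
rewrite !mem_cat => /orP[/orP[]|/orP[]] /mapP[j _ ->].
- rewrite invr1 mul1r; split; first by rewrite invr_neq0.
  by apply: Efun_qV => //; apply: nveq.
- split; first by rewrite !mulf_neq0.
  have -> : a * b * q ^+ j = a * b / q ^- j by rewrite invrK.
  apply: dual; first by rewrite invr_neq0.
  by apply: Efun_qV => //; apply: nveq.
(* Here cd/a = b q^-j, which [Efun_shift] covers only for j = 0; at the dual point d q^j, with ab/d,
   the product is b q^j. *)
- split; first by rewrite !mulf_neq0 ?invr_neq0 // !mulf_neq0 ?invr_neq0.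
  have -> : (d / a / b)^-1 / q ^+ j = a * b / (d * q ^+ j).
    by field; rewrite !qn0 d0 a_neq0 b_neq0.
  apply: dual; first by rewrite mulf_neq0.
  apply: (@Efun_shift j) => //; first by field; rewrite d0 a_neq0.
  by rewrite mulfK.
- split; first by rewrite !mulf_neq0 ?invr_neq0.
  apply: (@Efun_shift j.+1) => //; first by rewrite exprS; field; rewrite d0 a_neq0.
  have -> // : q * b * a / d * q ^+ j / q ^+ j.+1 * q / b = a * q / d.
  by rewrite exprS; field; rewrite d0 b_neq0 !qn0 q_neq0.
Qed.

(** For each large M the estimate is applied between the radii [r0 M] and [R0 M], with [Qfun]
    replaced by [Qfin J]. The choice of J depends on M, but the resulting bound is O(sigma^M) with a
    constant that does not. *)
Lemma Efun_eq0 c d : generic d -> c != 0 -> Efun c d = 0.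
Proof.
move=> gd w0; have [d0 _ _] := gd; have gd' := generic_dual gd; have [d0' _ _] := gd'.
have [rho [K [rho0 K0 hK]]] := Efun_circle gd.
have [rho' [K' [rho'0 K'0 hK']]] := Efun_circle gd'.
have [s0 _] := andP sigma01.
have ab0 : a * b != 0 by rewrite mulf_neq0.
have nab : 0 < `|a * b| by rewrite normr_gt0.
have nw : 0 < `|c| by rewrite normr_gt0.
(* The small circles are the images under z -> ab/z of the large circles that belong to the dual
   parameter ab/d. *)
pose R0 M := rho / `|q| ^+ M; pose r0 M := `|a * b| * `|q| ^+ M / rho'.
have qM M : 0 < `|q| ^+ M by rewrite exprn_gt0.
have R00 M : 0 < R0 M by rewrite divr_gt0.
have r00 M : 0 < r0 M by rewrite divr_gt0 ?mulr_gt0.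
have KK : 0 < K + K' by rewrite addr_gt0.
have circ M z : `|z| = r0 M \/ `|z| = R0 M -> [/\ z != 0, Qfun z d != 0 &
    `|Efun z d| <= (K + K') * sigma ^+ M * `|Qfun z d|].
  have leK (y : C) : 0 <= y -> K * sigma ^+ M * y <= (K + K') * sigma ^+ M * y.
    by move=> y0; rewrite ler_wpM2r // ler_wpM2r ?exprn_ge0 // lerDl ltW.
  have leK' (y : C) : 0 <= y -> K' * sigma ^+ M * y <= (K + K') * sigma ^+ M * y.
    by move=> y0; rewrite ler_wpM2r // ler_wpM2r ?exprn_ge0 // lerDr ltW.
  case=> hz; last first.
    have h : up_circle q rho M z by rewrite /up_circle hz divfK // gt_eqF.
    have [z0 Qz Ez] := hK M z h; split=> //; exact: le_trans Ez (leK _ _).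
  have z0 : z != 0 by rewrite -normr_gt0 hz.
  have h : up_circle q rho' M (a * b / z).
    rewrite /up_circle (normrM (a * b)) normfV hz /r0; field.
    by rewrite !gt_eqF.
  have [z'0 Qz Ez] := hK' M _ h; split=> //.
    by move: Qz; rewrite Qfun_dual // mulf_eq0 negb_or => /andP[].
  have nz : 0 < `|- (b / (z * d / a))|.
    by rewrite normr_gt0 oppr_eq0 !mulf_neq0 ?invr_neq0 // !mulf_neq0 ?invr_neq0.
  move: Ez; rewrite Efun_dual // Qfun_dual // !(normrM (- _)) mulrCA ler_pM2l // => Ez.
  exact: le_trans Ez (leK' _ _).
(* The bound must be uniform in J, since J is chosen after M. *)
have [Bw Bw0 hBw] : exists2 B, 0 <= B & forall J, `|Qfin J c d| <= B.
  have [B1 B10 h1] := qp_bdd (1 * c); have [B2 B20 h2] := qp_bdd (a * b / c).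
  have [B3 B30 h3] := qp_bdd (d / a / b * c).
  have [B4 B40 h4] := qp_bdd (q * b * a / d / c).
  exists (B1 * B2 * (B3 * B4)) => [|J]; first by rewrite !mulr_ge0 // ltW.
  rewrite /Qfin normrM; apply: ler_pM => //; rewrite normrM; exact: ler_pM.
have w2 : 0 <= 2 * `|c| by rewrite mulr_ge0.
have ab2 : 0 <= 2 * `|a * b| / rho' by rewrite divr_ge0 ?mulr_ge0 // ltW.
have [M1 hM1] := C_arch w2 q01 rho0.
have [M2 hM2] := C_arch ab2 q01 nw.
have main M : (M1 <= M)%N -> (M2 <= M)%N ->
    `|Efun c d| <= 64 * (K + K') * Bw * sigma ^+ M.
  move=> /hM1/ltW leM1 /hM2/ltW leM2.
  pose Y := r0 M + R0 M; pose Z := (r0 M)^-1 + (R0 M)^-1.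
  have Y0 : 0 <= Y by rewrite addr_ge0 // ltW.
  have Z0 : 0 <= Z by rewrite addr_ge0 // invr_ge0 ltW.
  have YZ z : `|z| = r0 M \/ `|z| = R0 M -> `|z| <= Y /\ `|z^-1| <= Z.
    rewrite normfV /Y /Z; case=> ->; rewrite ?lerDl ?lerDr ?invr_ge0 ?ltW //.
  clearbody Y Z; pose X := Y + `|a * b| * Z + `|d / a / b| * Y + `|q * b * a / d| * Z.
  have X1 : 0 <= `|a * b| * Z by rewrite mulr_ge0.
  have X2 : 0 <= `|d / a / b| * Y by rewrite mulr_ge0.
  have X3 : 0 <= `|q * b * a / d| * Z by rewrite mulr_ge0.
  have X0 : 0 <= X := addr_ge0 (addr_ge0 (addr_ge0 Y0 X1) X2) X3.
  have [J hJ] := qpinf_tail C_arch C_complete q_lt1 X0.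
  have tail y : `|y| <= X -> `|{y * q ^+ J}oo| <= 2.
    by move=> hy; have /andP[] := hJ y J (leqnn _) hy.
  have Q16 z : `|z| = r0 M \/ `|z| = R0 M -> `|Qfun z d| <= 16 * `|Qfin J z d|.
    move=> /[dup] hz /circ[z0 _ _]; have [hY hZ] := YZ z hz.
    rewrite (Qfun_fin J) // normrM mulrC ler_wpM2r //.
    (* One factor 2 for each of the four tails; with the 4 of [liouville_estimate] this makes the 64
       above. *)
    have -> : 16 = 2 * 2 * (2 * 2) :> C by ring.
    have t1 : `|z| <= X by rewrite /X -!addrA (le_trans hY) // lerDl !addr_ge0.
    have t2 : `|a * b / z| <= X.
      rewrite (normrM (a * b)); apply: (le_trans (ler_wpM2l (normr_ge0 _) hZ)).
      by rewrite /X -addrA [Y + _]addrC -addrA lerDl !addr_ge0.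
    have t3 : `|d / a / b * z| <= X.
      rewrite (normrM _ z); apply: (le_trans (ler_wpM2l (normr_ge0 _) hY)).
      by rewrite /X [_ + `|d / a / b| * Y]addrC -addrA lerDl !addr_ge0.
    have t4 : `|q * b * a / d / z| <= X.
      rewrite (normrM _ (z^-1)); apply: (le_trans (ler_wpM2l (normr_ge0 _) hZ)).
      by rewrite /X lerDr !addr_ge0.
    rewrite !(normrM (_ * _)) !(normrM {_ * q ^+ J}oo).
    by apply: ler_pM; rewrite ?mulr_ge0 //; apply: ler_pM => //; apply: tail.
  have delta0 : 0 <= 16 * ((K + K') * sigma ^+ M).
    by rewrite !mulr_ge0 ?exprn_ge0 // ltW.
  have est : `|Efun c d| <= 4 * (16 * ((K + K') * sigma ^+ M)) * `|Qfin J c d|.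
    apply: (@liouville_estimate C (fun z => Efun z d) (fun z => Qfin J z d) (Qroots J d)
      (r0 M) (R0 M) c) => //.
    - exact: lap_Efun.
    - exact: uniq_Qroots.
    - exact: Qfin_simple.
    - by move=> x /(Efun_Qroots gd)[].
    - move=> x hx; have [x0 _] := Efun_Qroots gd hx.
      have Qx : Qfun x d = 0.
        rewrite (Qfun_fin J) //; have [al _ [k ->]] := Qfin_simple J d0; last by [].
        have /eqP -> : (\prod_(y <- Qroots J d) ('X - y%:P)).[x] == 0.
          by rewrite -rootE root_prod_XsubC.
        by rewrite mulr0 mul0r.
      split=> //; apply/eqP => h.
        by have [_ /eqP] := circ M x (or_introl h).
      by have [_ /eqP] := circ M x (or_intror h).
    - move: leM2; rewrite /r0; congr (_ <= _); ring.
    - by rewrite /R0 ler_pdivlMr.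
    move=> z /[dup] hz /circ[_ _ hE]; apply: le_trans hE _.
    rewrite [16 * _]mulrC -[leRHS]mulrA ler_wpM2l ?Q16 //.
    by rewrite mulr_ge0 ?exprn_ge0 // ltW.
  apply: le_trans est _.
  have -> : 64 * (K + K') * Bw * sigma ^+ M = 4 * (16 * ((K + K') * sigma ^+ M)) * Bw by ring.
  by rewrite ler_wpM2l // mulr_ge0.
apply/eqP/negPn/negP; rewrite -normr_gt0 => E0.
have A0 : 0 <= 64 * (K + K') * Bw by rewrite !mulr_ge0 // ltW.
have [M3 hM3] := C_arch A0 sigma01 E0.
pose M := maxn M1 (maxn M2 M3).
have := main M; have := hM3 M; rewrite /M !leq_max !leqnn !orbT => h1 h2.
by have := lt_le_trans (h1 isT) (h2 isT isT); rewrite ltxx.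
Qed.

(** * From the vanishing of the difference to the identity *)

Lemma hq_bdd x : nonvan (x * q / b) -> exists2 K, 0 < K & forall n, `|H x n| <= K.
Proof. exact: hq_bounded. Qed.

Lemma cvg_bounded_geo (u v : nat -> C) K B : 0 < K -> 0 < B ->
  (forall n, `|u n| <= K * r ^+ n) -> (forall n, `|v n| <= B) ->
  cvgn (series (fun n => u n * v n)).
Proof.
move=> K0 B0 hu hv; have KB : 0 <= K * B by rewrite mulr_ge0 // ltW.
have r01 : 0 <= r < 1 by rewrite normr_ge0.
have [n|h _] := sum_geo C_complete KB r01 (u := fun n => u n * v n).
  by rewrite normrM [leRHS]mulrAC ler_pM.
exact: cvgP h.
Qed.

Definition lhs_term c d k : C := Cw k * Fw c k * Fw d k.

Definition rhs_term c d n : C :=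
  H b n * H c n * H d n * H (c * d / a) n * (q / b) ^+ (2 * n).

Record admissible c d : Prop := Admissible {
  adm_c0 : c != 0; adm_d0 : d != 0;
  adm_cb : nonvan (c * q / b); adm_ac : nonvan (a * q / c);
  adm_db : nonvan (d * q / b); adm_ad : nonvan (a * q / d);
  adm_be : nonvan (b / (c * d / a)); adm_eb : nonvan (c * d / a / b) }.

Lemma admissibleC c d : admissible c d -> admissible d c.
Proof. by case=> c0 d0 h1 h2 h3 h4 h5 h6; split; rewrite ?[d * c]mulrC. Qed.

Lemma dual_e c d : c != 0 -> d != 0 ->
  a * b / c * (a * b / d) / a = b ^+ 2 / (c * d / a).
Proof. by move=> c0 d0; field; rewrite c0 d0 a_neq0. Qed.

Lemma dual_qb x : x != 0 -> a * b / x * q / b = a * q / x.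
Proof. by move=> x0; field; rewrite x0 b_neq0. Qed.

Lemma dual_aq x : x != 0 -> a * q / (a * b / x) = x * q / b.
Proof. by move=> x0; field; rewrite x0 b_neq0 a_neq0. Qed.

Lemma admissible_dual c d : admissible c d -> admissible (a * b / c) (a * b / d).
Proof.
case=> c0 d0 h1 h2 h3 h4 h5 h6.
have e0 : c * d / a != 0 by rewrite !mulf_neq0 ?invr_neq0.
split; rewrite ?dual_qb ?dual_aq ?dual_e ?mulf_neq0 ?invr_neq0 //.
  by have -> : b / (b ^+ 2 / (c * d / a)) = c * d / a / b; first by field;
    rewrite b_neq0 c0 d0 a_neq0.
by have -> : b ^+ 2 / (c * d / a) / b = b / (c * d / a); first by field;
  rewrite b_neq0 c0 d0 a_neq0.
Qed.

Lemma cvg_lhs c d : admissible c d -> cvgn (series (lhs_term c d)).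
Proof.
case=> c0 d0 h1 h2 h3 h4 h5 h6.
have [K K0 hK] := Scoef_bdd h3 h4 d0; have [B1 B10 hB1] := hq_bdd h1.
have hc : nonvan (a * b / c * q / b) by rewrite dual_qb.
have [B2 B20 hB2] := hq_bdd hc.
have -> : lhs_term c d = (fun k => Cw k * Fw d k * Fw c k).
  by apply/funext => k; rewrite /lhs_term mulrAC.
apply: (cvg_bounded_geo K0 (mulr_gt0 B10 B20) hK) => k.
by rewrite normrM ler_pM.
Qed.

Lemma nonvan_eqb c d : admissible c d -> nonvan (c * d / a * q / b).
Proof.
case=> c0 d0 h1 h2 h3 h4 h5 h6.
have -> : c * d / a * q / b = c * d / a / b * q ^+ 1 by rewrite expr1; ring.
exact: nonvan_shift.
Qed.

Lemma cvg_rhs c d : admissible c d -> cvgn (series (rhs_term c d)).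
Proof.
move=> adm; have heq := nonvan_eqb adm; case: adm => c0 d0 h1 h2 h3 h4 h5 h6.
have [K K0 hK] := Tcoef_bdd1 h3; have [B1 B10 hB1] := hq_bdd h1.
have [B2 B20 hB2] := hq_bdd heq.
have -> : rhs_term c d = (fun n => Tcoef d n * (H c n * H (c * d / a) n)).
  by apply/funext => k; rewrite /rhs_term /Tcoef; ring.
apply: (cvg_bounded_geo K0 (mulr_gt0 B10 B20) hK) => k.
by rewrite normrM ler_pM.
Qed.

Definition rhs_factor c d : C := kap * ({a * b / c}oo * {a * b / d}oo * {q / (c * d / a)}oo
  / ({a * q / c}oo * {a * q / d}oo * {b / (c * d / a)}oo)).

Definition identity_at c d : Prop :=
  limn (series (lhs_term c d)) = rhs_factor c d * limn (series (rhs_term c d))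
  + rhs_factor (a * b / c) (a * b / d)
    * limn (series (rhs_term (a * b / c) (a * b / d))).

Lemma Tsum_rhs c d : admissible c d ->
  Tsum c d = {c * q / b}oo * {c * d / a * q / b}oo * limn (series (rhs_term c d)).
Proof.
move=> adm; have heq := nonvan_eqb adm.
apply: limn_seriesZ; last exact: cvg_rhs.
move=> n; case: adm => c0 d0 h1 h2 h3 h4 h5 h6.
by rewrite !Psi_H // /Tcoef /rhs_term; ring.
Qed.

Lemma identity_of_Efun c d : admissible c d -> Efun c d = 0 -> identity_at c d.
Proof.
move=> adm; have adm' := admissible_dual adm.
have heq := nonvan_eqb adm; have heq' := nonvan_eqb adm'.
rewrite /Efun /Tfun !Tsum_rhs // /identity_at.
case: (adm) => c0 d0 h1 h2 h3 h4 h5 h6.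
have -> : Ssum c d = {c * q / b}oo * {a * q / c}oo * limn (series (lhs_term c d)).
  apply: limn_seriesZ; last exact: cvg_lhs.
  have hc : nonvan (a * b / c * q / b) by rewrite dual_qb.
  by move=> n; rewrite !Psi_H // dual_qb // /lhs_term /Fw; ring.
rewrite /rhs_factor !dualK // !dual_aq // dual_qb // !dual_e // in heq' *.
have e0 : c * d / a != 0 by rewrite !mulf_neq0 ?invr_neq0.
have thE := thetaE e0; rewrite /theta in thE *.
have n1 := nonvan_oo h1; have n2 := nonvan_oo h2; have n3 := nonvan_oo h3.
have n4 := nonvan_oo h4; have n5 := nonvan_oo h5; have n6 := nonvan_oo h6.
have n7 := nonvan_oo heq; have n8 := nonvan_oo heq'.
move: (c * d / a) e0 thE n5 n6 n7 n8 => e e0.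
have -> : b ^+ 2 / e * q / b = q * b / e by field; rewrite e0 b_neq0.
have -> : b / (b ^+ 2 / e) = e / b by field; rewrite e0 b_neq0.
move=> thE n5 n6 n7 n8.
have n0 : {e / b}oo * {q * b / e}oo != 0 by rewrite mulf_neq0.
move: (limn _) (limn _) (limn _) => L X Y /eqP.
rewrite subr_eq0 addrC => /eqP hE.
apply: (mulfI (mulf_neq0 n0 (mulf_neq0 n1 n2))).
have nab := nonvan_oo nonvan_ab.
rewrite -mulrA; move/(canRL (addKr _)): hE => ->; rewrite mulrDr; congr (_ + _).
  by rewrite thE; field; rewrite ?n1 ?n2 ?n4 ?n5 ?nab ?b_neq0 ?e0.
by field; rewrite ?n1 ?n2 ?n3 ?n6 ?nab.
Qed.

(** A non-generic x is an integral power of q, or b times one. The hypotheses exclude the positive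
    powers of q, and b q^k both for k < 0, through xq/b, and for 0 <= k < s, through ab/x. What
    remains are the points at which a series terminates. *)
Lemma generic_or_zero x : x != 0 -> (forall n, 1 - x / q ^+ n.+1 != 0) ->
  (forall n, 1 - a * b / x / q ^+ n.+1 != 0) -> nonvan (x * q / b) ->
  [\/ generic x, exists N, x = q ^- N | exists N, x = a * b * q ^+ N].
Proof.
move=> x0 h1 h2 h3.
have qn0 n : q ^+ n != 0 by rewrite expf_neq0.
have [[m [n hmn]]|nq] := pselect (exists m n, x * q ^+ m = q ^+ n).
  apply: Or32; have [le_nm|lt_mn] := leqP n m.
    exists (m - n)%N; apply: (mulIf (qn0 m)); rewrite hmn.
    by rewrite -{2}(subnK le_nm) exprD mulKf.
  have /eqP[] := h1 (n - m.+1)%N; apply/eqP; rewrite subr_eq0 eq_sym; apply/eqP.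
  apply: (mulIf (qn0 (n - m.+1).+1)); rewrite divfK // mul1r.
  have en : n = ((n - m.+1).+1 + m)%N by rewrite subnSK // subnK // ltnW.
  by apply: (mulIf (qn0 m)); rewrite hmn {1}en exprD.
have [[m [n hmn]]|nb] := pselect (exists m n, x * q ^+ m = b * q ^+ n); last first.
  apply: Or31; split=> // m n; apply/eqP => h; [apply: nq | apply: nb]; by exists m, n.
apply: Or33; have [lt_nm|le_mn] := ltnP n m.
  have /eqP[] := h3 (m - n.+1)%N; apply/eqP; rewrite subr_eq0 eq_sym; apply/eqP.
  have em : m = ((m - n.+1) + 1 + n)%N by rewrite addn1 subnSK // subnK // ltnW.
  move: hmn; rewrite {1}em !exprD expr1 => hmn.
  apply: (mulfI b_neq0); apply: (mulIf (qn0 n)); rewrite mulr1 -hmn; field.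
  exact: b_neq0.
have xE : x = b * q ^+ (n - m).
  by apply: (mulIf (qn0 m)); rewrite hmn -mulrA -exprD subnK.
have [le_s|lt_s] := leqP s (n - m).
  by exists (n - m - s)%N; rewrite aE [_ * b]mulrC -mulrA -exprD subnKC.
have /eqP[] := h2 (s - (n - m).+1)%N; apply/eqP; rewrite subr_eq0 eq_sym; apply/eqP.
apply: (mulIf (qn0 (s - (n - m).+1).+1)); rewrite divfK // mul1r.
rewrite subnSK // xE aE -{1}(subnK (ltnW lt_s)) exprD; field.
by rewrite b_neq0 qn0.
Qed.

Lemma identity_qV N M : admissible (q ^- N) (q ^- M) -> identity_at (q ^- N) (q ^- M).
Proof.
move=> adm; apply: identity_of_Efun => //.
have heq := nonvan_eqb adm; case: adm => c0 d0 h1 h2 h3 h4 h5 h6.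
by apply: Efun_qV => //; rewrite invrK; apply/nonvan_shift/nonvan_ab.
Qed.

Lemma admissible_qV_abq N M : ~ admissible (q ^- N) (a * b * q ^+ M).
Proof.
have qn0 n : q ^+ n != 0 by rewrite expf_neq0.
case=> c0 d0 h1 h2 h3 h4 h5 h6; have [le_NM|/ltnW le_MN] := leqP N M.
  have /eqP[] := h5 (M - N)%N; apply/eqP; rewrite subr_eq0 eq_sym; apply/eqP.
  by rewrite -{1}(subnK le_NM) exprD; field; rewrite a_neq0 b_neq0 !qn0.
have /eqP[] := h6 (N - M)%N; apply/eqP; rewrite subr_eq0 eq_sym; apply/eqP.
by rewrite -{1}(subnK le_MN) exprD; field; rewrite a_neq0 b_neq0 !qn0.
Qed.

Lemma identity_dual c d : admissible c d ->
  Efun (a * b / c) (a * b / d) = 0 -> identity_at c d.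
Proof.
move=> adm h; apply: identity_of_Efun => //; have [c0 d0 _ _ _ _ _ _] := adm.
have ab0 : a * b != 0 by rewrite mulf_neq0.
have := @Efun_dual (a * b / c) (a * b / d); rewrite !dualK // h mulr0; apply.
  by rewrite mulf_neq0 ?invr_neq0.
by rewrite mulf_neq0 ?invr_neq0.
Qed.

Lemma identity_atC c d : identity_at c d -> identity_at d c.
Proof.
rewrite /identity_at => h.
have e1 x y : limn (series (lhs_term x y)) = limn (series (lhs_term y x)).
  by congr (limn (series _)); apply/funext => k; rewrite /lhs_term mulrAC.
have e2 x y : limn (series (rhs_term x y)) = limn (series (rhs_term y x)).
  congr (limn (series _)); apply/funext => k; rewrite /rhs_term [y * x]mulrC; ring.
have e3 x y : rhs_factor x y = rhs_factor y x.
  by rewrite /rhs_factor [y * x]mulrC [{a * b / y}oo * _]mulrC [{a * q / y}oo * _]mulrC.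
by rewrite e1 h e2 (e2 (a * b / d)) e3 (e3 (a * b / d)).
Qed.

(** If c or d is generic, [Efun_eq0] applies with it in the role of d. Otherwise each of them is
    q^-N or a b q^M. The mixed case would make cd/a equal to b times a power of q, against
    admissibility; the other two cases terminate, either directly or after duality. *)
Theorem identity c d : admissible c d ->
  (forall n, 1 - c / q ^+ n.+1 != 0) -> (forall n, 1 - a * b / c / q ^+ n.+1 != 0) ->
  (forall n, 1 - d / q ^+ n.+1 != 0) -> (forall n, 1 - a * b / d / q ^+ n.+1 != 0) ->
  identity_at c d.
Proof.
move=> adm hc1 hc2 hd1 hd2; have [c0 d0 h1 h2 h3 h4 h5 h6] := adm.
have gen x y : generic y -> admissible x y -> identity_at x y.
  move=> gy adm'; apply: identity_of_Efun => //; apply: Efun_eq0 => //.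
  by case: adm'.
have [gd|[M dE]|[M dE]] := generic_or_zero d0 hd1 hd2 h3; first exact: gen.
- have [gc|[N cE]|[N cE]] := generic_or_zero c0 hc1 hc2 h1.
  + by apply: identity_atC; apply: gen => //; apply: admissibleC.
  + by move: adm; rewrite cE dE; apply: identity_qV.
  + by case: (@admissible_qV_abq M N); rewrite -cE -dE; apply: admissibleC.
have [gc|[N cE]|[N cE]] := generic_or_zero c0 hc1 hc2 h1.
- by apply: identity_atC; apply: gen => //; apply: admissibleC.
- by case: (@admissible_qV_abq N M); rewrite -cE -dE.
have e x n : x = a * b * q ^+ n -> a * b / x = q ^- n.
  by move=> ->; field; rewrite a_neq0 b_neq0 expf_neq0.
apply: identity_dual => //; have adm' := admissible_dual adm.
have heq := nonvan_eqb adm'; move: adm' heq; rewrite (e c N cE) (e d M dE).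
case=> c0' d0' h1' h2' h3' h4' h5' h6' heq.
by apply: Efun_qV => //; rewrite invrK; apply/nonvan_shift/nonvan_ab.
Qed.

End Difference.

(** * Bilateral series *)

Section NegativeIndices.
Variables (C : numClosedFieldType) (q : C).
Hypothesis q_neq0 : q != 0.
Local Notation "{ x ; n }" := (qp q x n) (at level 0, x at level 99).

(* The reciprocal of (x;q)_(-m). *)
Definition qn (x : C) m : C := \prod_(1 <= i < m.+1) (1 - x / q ^+ i).

Lemma qnS x m : qn x m.+1 = qn x m * (1 - x / q ^+ m.+1).
Proof. by rewrite /qn big_nat_recr. Qed.

Lemma qn0 x : qn x 0 = 1.
Proof. by rewrite /qn big_geq. Qed.

Lemma qpoch_Posz x n : qpoch q x (Posz n) = {x; n}.
Proof. by []. Qed.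

Lemma qpoch_Negz x n : qpoch q x (Negz n) = (qn x n.+1)^-1.
Proof. by rewrite /qpoch /qn prodfV. Qed.

Lemma qn_rev x m : x != 0 ->
  qn x m = (- x) ^+ m / (\prod_(1 <= i < m.+1) q ^+ i) * {q / x; m}.
Proof.
move=> x0; elim: m => [|m IHm]; first by rewrite qn0 big_geq // qp0 expr0 divr1 mulr1.
rewrite qnS IHm qpSr [(- x) ^+ m.+1]exprS [\prod_(1 <= i < m.+2) _]big_nat_recr //=
  [q ^+ m.+1]exprS.
have P0 : \prod_(1 <= i < m.+1) q ^+ i != 0.
  by rewrite prodf_seq_neq0; apply/allP => i _; rewrite /= expf_neq0.
by field; rewrite P0 x0 q_neq0 expf_neq0.
Qed.

(** The pair s1, -s1 supplies the factors of even index of (x;q)_(2m), the pair s2, -s2 those of odd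
    index. *)
Lemma qp_sqrt s1 s2 x m : s1 ^+ 2 = x -> s2 ^+ 2 = x * q ->
  {s1; m} * {- s1; m} * ({s2; m} * {- s2; m}) = {x; 2 * m}.
Proof.
move=> h1 h2; elim: m => [|m IHm]; first by rewrite !qp0 !mulr1.
have -> : (2 * m.+1 = (2 * m).+2)%N by rewrite mulnS.
rewrite !qpSr -IHm.
have -> : 1 - x * q ^+ (2 * m).+1 = (1 - s2 * q ^+ m) * (1 - - s2 * q ^+ m).
  transitivity (1 - s2 ^+ 2 * (q ^+ m) ^+ 2); last by ring.
  by rewrite h2 mul2n -addnn exprS exprD; ring.
have -> : 1 - x * q ^+ (2 * m) = (1 - s1 * q ^+ m) * (1 - - s1 * q ^+ m).
  transitivity (1 - s1 ^+ 2 * (q ^+ m) ^+ 2); last by ring.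
  by rewrite h1 mul2n -addnn exprD; ring.
ring.
Qed.

Lemma qn_sqrt s1 s2 x m : s1 ^+ 2 = x -> s2 ^+ 2 = x * q ->
  qn s1 m * qn (- s1) m * (qn s2 m * qn (- s2) m) = qn x (2 * m).
Proof.
move=> h1 h2; elim: m => [|m IHm]; first by rewrite !qn0 !mulr1.
have -> : (2 * m.+1 = (2 * m).+2)%N by rewrite mulnS.
have qm := expf_neq0 m q_neq0.
rewrite !qnS -IHm.
have -> : 1 - x / q ^+ (2 * m).+1 = (1 - s2 / q ^+ m.+1) * (1 - - s2 / q ^+ m.+1).
  transitivity (1 - s2 ^+ 2 / (q ^+ m.+1) ^+ 2); last by field; rewrite expf_neq0.
  by rewrite h2 mul2n -addnn !exprS exprD; field; rewrite qm q_neq0.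
have -> : 1 - x / q ^+ (2 * m).+2 = (1 - s1 / q ^+ m.+1) * (1 - - s1 / q ^+ m.+1).
  transitivity (1 - s1 ^+ 2 / (q ^+ m.+1) ^+ 2); last by field; rewrite expf_neq0.
  by rewrite h1 mul2n -addnn !exprS exprD; field; rewrite qm q_neq0.
ring.
Qed.

Lemma qn_ratio x y m : x != 0 -> y != 0 ->
  qn x m / qn y m = (x / y) ^+ m * ({q / x; m} / {q / y; m}).
Proof.
move=> x0 y0; rewrite !qn_rev // !invfM invrK.
have P0 : \prod_(1 <= i < m.+1) q ^+ i != 0.
  by rewrite prodf_seq_neq0; apply/allP => i _; rewrite /= expf_neq0.
have -> : (x / y) ^+ m = (- x) ^+ m / (- y) ^+ m.
  by rewrite -expr_div_n invrN mulrNN.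
have y0' : (- y) ^+ m != 0 by rewrite expf_neq0 ?oppr_eq0.
(* If [{q / y; m}] is 0, both sides are 0 since 0^-1 = 0; treating the inverse as a variable
   includes this case. *)
move: ({q / y; m}^-1) => w.
by field; rewrite P0 y0'.
Qed.

End NegativeIndices.

Section BilateralTerms.
Variables (C : numClosedFieldType) (q b a c d s1 s2 s3 s4 : C).
Hypothesis q_neq0 : q != 0.
Hypothesis b_neq0 : b != 0.
Hypothesis a_neq0 : a != 0.
Hypothesis c_neq0 : c != 0.
Hypothesis d_neq0 : d != 0.
Hypothesis s1E : s1 ^+ 2 = a * q / b.
Hypothesis s2E : s2 ^+ 2 = a * q / b * q.
Hypothesis s3E : s3 ^+ 2 = a * b * q.
Hypothesis s4E : s4 ^+ 2 = a * b.
Local Notation "{ x ; n }" := (qp q x n) (at level 0, x at level 99).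

(** With [bi_lo], the parameters of (i) at a = 1 and of (ii) at a = q. *)
Definition bi_up := [:: s1; - s1; s2; - s2; b; c; d; a * b / c; a * b / d].
Definition bi_lo := [:: s3; - s3; s4; - s4;
  a * q / b; a * q / c; a * q / d; c * q / b; d * q / b].

Definition bi_term k : C := Dw q b a k * Fw q b a c k * Fw q b a d k.

Lemma psi_term_Posz k : psi_term bi_up bi_lo q (q / b) (Posz k) = bi_term k.
Proof.
rewrite /psi_term /qpochs /bi_up /bi_lo !big_cons !big_nil !qpoch_Posz.
rewrite /bi_term /Dw /Fw /hq.
have -> : a * b / c * q / b = a * q / c by field; rewrite c_neq0 b_neq0.
have -> : a * b / d * q / b = a * q / d by field; rewrite d_neq0 b_neq0.
rewrite -(qp_sqrt k s1E s2E) -(qp_sqrt k s4E s3E) -exprnP !invfM !invr1; ring.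
Qed.

(** Reflection of every symbol, upper and lower parameters being paired so that at a = 1 each ratio
    is one that occurs in [bi_term], and at a = q becomes one once the first factors of its products
    are split off. *)
Lemma psi_term_Negz n : let m := n.+1 in
  psi_term bi_up bi_lo q (q / b) (Negz n) = (a * q ^+ 2 / b) ^+ m
    * ({q / (a * b); 2 * m} / {b / a; 2 * m}) * ({b / a; m} / {q / b; m})
    * ({c / a; m} / {q / c; m}) * ({b / c; m} / {c * q / (a * b); m})
    * ({d / a; m} / {q / d; m}) * ({b / d; m} / {d * q / (a * b); m}).
Proof.
move=> m; transitivity (qn q (a * b) (2 * m) / qn q (a * q / b) (2 * m)
  * (qn q (a * q / b) m / qn q b m) * (qn q (a * q / c) m / qn q c m)
  * (qn q (c * q / b) m / qn q (a * b / c) m) * (qn q (a * q / d) m / qn q d m)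
  * (qn q (d * q / b) m / qn q (a * b / d) m) * (q / b) ^- m).
  rewrite /psi_term /qpochs /bi_up /bi_lo !big_cons !big_nil !qpoch_Negz -/m.
  have -> : (q / b) ^ Negz n = (q / b) ^- m by [].
  rewrite !invfM !invrK !mulr1 !invr1.
  rewrite -(qn_sqrt q_neq0 m s1E s2E) -(qn_sqrt q_neq0 m s4E s3E) !invfM; ring.
have ab0 : a * b != 0 by rewrite mulf_neq0.
have x0 x : x != 0 -> a * q / x != 0 by move=> ?; rewrite !mulf_neq0 ?invr_neq0.
have y0 x : x != 0 -> a * b / x != 0 by move=> ?; rewrite mulf_neq0 ?invr_neq0.
have z0 x : x != 0 -> x * q / b != 0 by move=> ?; rewrite !mulf_neq0 ?invr_neq0.
rewrite !qn_ratio ?x0 ?y0 ?z0 //.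
have e1 x : x != 0 -> q / (a * q / x) = x / a.
  by move=> h; field; rewrite h q_neq0 a_neq0.
have e2 x : x != 0 -> q / (x * q / b) = b / x.
  by move=> h; field; rewrite h q_neq0 b_neq0.
have e3 x : x != 0 -> q / (a * b / x) = x * q / (a * b).
  by move=> h; field; rewrite h b_neq0 a_neq0.
rewrite !e1 ?e2 ?e3 //.
have <- : (a * b / (a * q / b)) ^+ (2 * m) * (a * q / b / b) ^+ m * (a * q / c / c) ^+ m
  * (c * q / b / (a * b / c)) ^+ m * (a * q / d / d) ^+ m * (d * q / b / (a * b / d)) ^+ m
  * (q / b) ^- m = (a * q ^+ 2 / b) ^+ m.
  rewrite exprM -exprVn -!exprMn; congr (_ ^+ _).
  by field; rewrite a_neq0 b_neq0 c_neq0 d_neq0 q_neq0.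
ring.
Qed.

End BilateralTerms.

(** * Consequences of nonvanishing denominators *)

Section Nonvanishing.
Variables (C : numClosedFieldType) (q : C).
Hypothesis q_neq0 : q != 0.

Lemma nonvan_sqrt s1 s2 x : s1 ^+ 2 = x -> s2 ^+ 2 = x * q ->
  nonvan q s1 -> nonvan q (- s1) -> nonvan q s2 -> nonvan q (- s2) -> nonvan q x.
Proof.
move=> h1 h2 n1 n2 n3 n4 i; rewrite -(odd_double_half i) -mul2n mulnC exprD exprM.
case: (odd i); [rewrite expr1 mulrA -h2 | rewrite expr0 mul1r -h1];
  rewrite -exprMn -[1](expr1n _ 2) subr_sqr mulf_neq0 //.
  by have := n4 i./2; rewrite mulNr opprK.
by have := n2 i./2; rewrite mulNr opprK.
Qed.

Lemma qpow_separated b : nonvan q b -> (forall n, 1 - b / q ^+ n.+1 != 0) ->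
  forall m n, b * q ^+ m != q ^+ n.
Proof.
move=> h1 h2 m n; apply/eqP => h.
have [le_nm|lt_mn] := leqP n m.
  have /eqP[] := h1 (m - n)%N; apply/eqP; rewrite subr_eq0 eq_sym; apply/eqP.
  apply: (mulIf (expf_neq0 n q_neq0)).
  by rewrite -mulrA -exprD subnK // h mul1r.
have /eqP[] := h2 (n - m.+1)%N; apply/eqP; rewrite subr_eq0 eq_sym; apply/eqP.
have bE : b = q ^+ (n - m).
  by apply: (mulIf (expf_neq0 m q_neq0)); rewrite h -exprD subnK // ltnW.
by rewrite subnSK // bE divff // expf_neq0.
Qed.

End Nonvanishing.

(** * Folding the bilateral series *)

Section BilateralSum.
Variable C : numClosedFieldType.
Hypothesis C_arch : geo_archimedean C.
Hypothesis C_complete : geo_complete C.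
Variables (q b a c d s1 s2 s3 s4 : C) (s : nat).
Hypothesis q_gt0 : 0 < `|q|.
Hypothesis q_lt1 : `|q| < 1.
Hypothesis b_neq0 : b != 0.
Hypothesis qb_lt1 : `|q / b| < 1.
Hypothesis aE : a = q ^+ s.
Hypothesis b_gen : forall m n, b * q ^+ m != q ^+ n.
Hypothesis c_neq0 : c != 0.
Hypothesis d_neq0 : d != 0.
Hypothesis s1E : s1 ^+ 2 = a * q / b.
Hypothesis s2E : s2 ^+ 2 = a * q / b * q.
Hypothesis s3E : s3 ^+ 2 = a * b * q.
Hypothesis s4E : s4 ^+ 2 = a * b.
Hypothesis adm : admissible q b a c d.
Local Notation "{ x ; n }" := (qp q x n) (at level 0, x at level 99).
Local Notation psi_t := (psi_term (bi_up b a c d s1 s2) (bi_lo q b a c d s3 s4) q (q / b)).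
Local Notation bi_t := (bi_term q b a c d).

Let q_neq0 : q != 0. Proof. by rewrite -normr_gt0. Qed.
Let a_neq0 : a != 0. Proof. by rewrite aE expf_neq0. Qed.

Let psi_Posz := @psi_term_Posz C q b a c d s1 s2 s3 s4 b_neq0 c_neq0 d_neq0 s1E s2E s3E s4E.

Let psi_Negz := @psi_term_Negz C q b a c d s1 s2 s3 s4 q_neq0 b_neq0 a_neq0 c_neq0 d_neq0
  s1E s2E s3E s4E.

Lemma cvg_bi_term w j : (forall k, `|w k| <= 1) ->
  cvgn (series (fun k => w k * bi_t (j + k)%N)).
Proof.
move=> hw; case: adm => _ _ h1 h2 h3 h4 _ _.
have [K K0 hK] := Dw_bdd C_arch C_complete q_gt0 q_lt1 b_neq0 aE b_gen h3 h4 d_neq0.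
have hc : nonvan q (a * b / c * q / b).
  by have -> : a * b / c * q / b = a * q / c by field; rewrite c_neq0 b_neq0.
have [B1 B10 hB1] := hq_bounded C_arch C_complete q_lt1 h1.
have [B2 B20 hB2] := hq_bounded C_arch C_complete q_lt1 hc.
have -> : (fun k => w k * bi_t (j + k)%N) = (fun k => Dw q b a (j + k)%N * Fw q b a d (j + k)%N
    * (w k * Fw q b a c (j + k)%N)) by apply/funext => k; rewrite /bi_term; ring.
apply: (cvg_bounded_geo C_complete qb_lt1 K0 (mulr_gt0 B10 B20)) => k.
  rewrite (le_trans (hK _)) // ler_wpM2l ?(ltW K0) //.
  by rewrite ler_wiXn2l ?(ltW qb_lt1) // leq_addl.
rewrite normrM -[leRHS]mul1r; apply: ler_pM; rewrite ?hw // /Fw.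
by rewrite (normrM (hq q b c _)) ler_pM.
Qed.

Lemma cvg_psi_Posz : cvgn (series (fun n => psi_t (Posz n))).
Proof.
have -> : (fun n => psi_t (Posz n)) = (fun k => 1 * bi_t (0 + k)%N).
  by apply/funext => k; rewrite psi_Posz mul1r.
by apply: cvg_bi_term => k; rewrite normr1.
Qed.

Lemma psi_term_Negz1 n : a = 1 -> psi_t (Negz n) = q ^+ n.+1 * bi_t n.+1.
Proof.
move=> a1; rewrite psi_Negz /bi_term /Dw /Fw /hq a1 !divr1 !mul1r.
have e x : x != 0 -> b / x * q / b = q / x by move=> x0; field; rewrite x0 b_neq0.
rewrite !e //; have -> : (q ^+ 2 / b) ^+ n.+1 = q ^+ n.+1 * (q / b) ^+ n.+1.
  by rewrite -exprMn; congr (_ ^+ _); ring.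
ring.
Qed.

(** The symbols at -n-1 have one factor more than those of [bi_term] at n (two more for index 2n).
    The surplus factors have mutually inverse arguments above and below, and (1 - x) / (1 - 1/x) =
    -x; the conditions on c and d ensure x != 1. *)
Lemma psi_term_Negzq n : a = q -> c != q -> c != b -> d != q -> d != b ->
  psi_t (Negz n) = - q ^+ (2 * n).+1 * bi_t n.
Proof.
move=> aq cq cb dq db; rewrite psi_Negz /bi_term /Dw /Fw /hq aq.
have flip (x : C) : x != 0 -> x != 1 -> (1 - x) / (1 - x^-1) = - x.
  by move=> x0 x1; field; rewrite x0 subr_eq0 x1.
have step (x y : C) : x != 0 -> x != 1 -> y = x^-1 ->
    {x; n.+1} / {y; n.+1} = - x * ({x * q; n} / {y * q; n}).
  by move=> x0 x1 ->; rewrite !qpS invfM mulrACA flip.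
have b1 : b != 1 by have := b_gen 0 0; rewrite mulr1.
have bq : b != q by have := b_gen 0 1; rewrite mulr1.
have div1 (x y : C) : y != 0 -> x != y -> x / y != 1.
  by move=> y0; apply: contraNneq => h; rewrite -[x](divfK y0) h mul1r.
have s0 : {q / (q * b); 2 * n.+1} / {b / q; 2 * n.+1}
    = q / b ^+ 2 * ({q * q / b; 2 * n} / {q * b; 2 * n}).
  rewrite mulnS !qpS ![((1 - _) * _)^-1]invfM.
  have -> : q / (q * b) * q * q = q * q / b by field; rewrite b_neq0 q_neq0.
  have -> : b / q * q * q = q * b by field; rewrite q_neq0.
  have -> : q / (q * b) = b^-1 by field; rewrite b_neq0 q_neq0.
  have -> : b^-1 * q = (b / q)^-1 by field; rewrite b_neq0 q_neq0.
  have -> : b / q * q = b^-1^-1 by rewrite invrK divfK.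
  transitivity ((1 - b^-1) / (1 - b^-1^-1) * ((1 - (b / q)^-1) / (1 - (b / q)^-1^-1))
    * ({q * q / b; 2 * n} / {q * b; 2 * n})).
    by rewrite [(b / q)^-1^-1]invrK; ring.
  rewrite !flip ?invr_neq0 ?mulf_neq0 ?invr_neq0 ?invr_eq1 ?div1 //.
  by congr (_ * _); field; rewrite q_neq0 b_neq0.
rewrite s0 !step ?mulf_neq0 ?invr_neq0 ?div1 //;
  rewrite ?[b == _]eq_sym //;
  try by field; rewrite ?b_neq0 ?c_neq0 ?d_neq0 ?q_neq0.
have e1 (x : C) : x != 0 -> x / q * q = x by move=> x0; rewrite divfK.
rewrite !e1 //.
have e2 (x : C) : x != 0 -> q / x * q = q * q / x by move=> x0; ring.
have e3 (x : C) : x != 0 -> b / x * q = q * b / x by move=> x0; ring.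
have e4 (x : C) : x != 0 -> x * q / (q * b) * q = x * q / b.
  by move=> x0; field; rewrite q_neq0 b_neq0.
have e5 (x : C) : x != 0 -> q * b / x * q / b = q * q / x by move=> x0; field; rewrite x0 b_neq0.
rewrite !e2 // !e3 // !e4 // !e5 //.
have -> : (q * q ^+ 2 / b) ^+ n.+1 = q ^+ (2 * n) * (q / b) ^+ n * (q ^+ 3 / b).
  rewrite exprSr exprM -exprMn; congr (_ ^+ _ * _); ring.
rewrite [q ^+ (2 * n).+1]exprS.
move: ({q * b; 2 * n}^-1) ({q * q / b; n}^-1) ({c * q / b; n}^-1) ({q * q / c; n}^-1).
move: ({d * q / b; n}^-1) ({q * q / d; n}^-1) (q ^+ (2 * n)) ((q / b) ^+ n).
move=> w1 w2 w3 w4 w5 w6 w7 w8; field.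
by rewrite b_neq0 c_neq0 d_neq0 q_neq0.
Qed.

Let qpow_le1 n : `|q ^+ n| <= 1.
Proof. by rewrite normrX exprn_ile1 // ltW. Qed.

Let q_n n : 1 - q ^+ n.+1 != 0.
Proof. by have := nonvan_q q_lt1 n; rewrite -exprS. Qed.

Lemma psi_sum1 : a = 1 ->
  bilateral_cvg psi_t /\ bilateral_sum psi_t = limn (series (lhs_term q b a c d)).
Proof.
move=> a1; have cP := cvg_psi_Posz.
(* The index 0 is its own mirror image and must not be counted twice, hence the weight 0 there. *)
pose w k := if k is k'.+1 then q ^+ k else 0.
have w1 k : `|w k| <= 1 by case: k => [|k] /=; rewrite ?normr0 ?ler01 ?qpow_le1.
have NE : (fun n => psi_t (Negz n)) = (fun n => w (1 + n)%N * bi_t (1 + n)%N).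
  by apply/funext => n; rewrite psi_term_Negz1.
have cN : cvgn (series (fun n => psi_t (Negz n))).
  by rewrite NE; apply: (@cvg_bi_term (fun n => w (1 + n)%N) 1).
split=> //; rewrite /bilateral_sum NE -(@limn_series_shift _ 1 (fun n => w n * bi_t n)).
- rewrite -limn_seriesD //; last exact: (@cvg_bi_term w 0).
  congr (limn (series _)); apply/funext => k; rewrite psi_Posz /lhs_term /Cw.
  rewrite -mulrA -(mulrA (vwp _ _ _)) [Dw q b a k * _]mulrA -/(bi_term q b a c d k).
  rewrite -{1}[bi_term _ _ _ _ _ k]mul1r -mulrDl; congr (_ * _).
  case: k => [|k]; rewrite /w /vwp ?addr0 // a1 !mul1r qpSr -exprS.
  (* The folded weight 1 + q^k, for k > 0, is the very-well-poised factor (1 - q^(2k)) / (1 - q^k)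
     at a = 1. *)
  have -> : 1 - q ^+ (2 * k.+1) = (1 - q ^+ k.+1) * (1 + q ^+ k.+1).
    by rewrite mulnC exprM -{1}[1](expr1n _ 2) subr_sqr.
  by field; rewrite nonvan_qp ?q_n //; apply: nonvan_q.
- by case=> // _; rewrite mul0r.
- exact: (@cvg_bi_term (fun n => w (1 + n)%N) 1).
Qed.

(** Folding gives the weights 1 - q^(2k+1), which are 1 - q times [vwp] at a = q. *)
Lemma psi_sumq : a = q -> c != q -> c != b -> d != q -> d != b ->
  bilateral_cvg psi_t /\
  bilateral_sum psi_t = (1 - q) * limn (series (lhs_term q b a c d)).
Proof.
move=> aq cq cb dq db; have cP := cvg_psi_Posz.
have NE : (fun n => psi_t (Negz n)) = (fun n => - q ^+ (2 * n).+1 * bi_t (0 + n)%N).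
  by apply/funext => n; rewrite psi_term_Negzq.
have cN : cvgn (series (fun n => psi_t (Negz n))).
  by rewrite NE; apply: cvg_bi_term => k; rewrite normrN qpow_le1.
split=> //; rewrite /bilateral_sum -limn_seriesD //.
apply: limn_seriesZ; last exact: (cvg_lhs C_arch C_complete q_gt0 q_lt1 b_neq0 qb_lt1 aE b_gen adm).
move=> k /=; rewrite psi_Posz psi_term_Negzq // /lhs_term /Cw.
have -> : vwp q a k * Dw q b a k * Fw q b a c k * Fw q b a d k = vwp q a k * bi_t k.
  by rewrite /bi_term !mulrA.
rewrite -{1}[bi_t k]mul1r.
rewrite [RHS]mulrA -mulrDl; congr (_ * _); case: k => [|k]; rewrite /vwp ?aq.
  by rewrite mulr1.
rewrite qpS -exprS; have n1 := nonvan_qp k (nonvan_shift 1 (nonvan_q q_lt1)).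
by field; rewrite n1; have := q_n 0.
Qed.

End BilateralSum.

(** * The two bilateral identities *)

Section Identities.
Variable C : numClosedFieldType.
Hypothesis C_arch : geo_archimedean C.
Hypothesis C_complete : geo_complete C.
Variables (q b c d : C).
Hypothesis q_gt0 : 0 < `|q|.
Hypothesis q_lt1 : `|q| < 1.
Hypothesis b_neq0 : b != 0.
Hypothesis c_neq0 : c != 0.
Hypothesis d_neq0 : d != 0.
Hypothesis qb_lt1 : `|q / b| < 1.
Local Notation "{ x ; n }" := (qp q x n) (at level 0, x at level 99).
Local Notation "{ x }oo" := (qpoch_inf q x) (at level 0, x at level 99).

Let q_neq0 : q != 0. Proof. by rewrite -normr_gt0. Qed.

Lemma phi_term_hq x y z n :
  phi_term [:: b; x; y; z] [:: x * q / b; y * q / b; z * q / b] q (q ^+ 2 / b ^+ 2) n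
  = hq q b b n * hq q b x n * hq q b y n * hq q b z n * (q / b) ^+ (2 * n).
Proof.
rewrite /phi_term /qpochs !big_cons !big_nil !qpoch_Posz /hq.
have -> : b * q / b = q by field.
by rewrite -expr_div_n exprM !invfM !invr1; ring.
Qed.

(** Common form of (i) and (ii). The number k is the ratio of the bilateral sum to the folded
    series, 1 for a = 1 and 1 - q for a = q; in both cases k (aq;q)_oo = (q;q)_oo, the first factor
    of the numerators in the theorem. *)
Lemma bilateral_identity a s s1 s2 s3 s4 k : a = q ^+ s ->
  (forall m n, b * q ^+ m != q ^+ n) ->
  let up := bi_up b a c d s1 s2 in let lo := bi_lo q b a c d s3 s4 in
  let e := c * d / a in let e' := b ^+ 2 / e in
  let up1 := [:: b; c; d; e] in
  let lo1 := [:: c * q / b; d * q / b; e * q / b] in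
  let up2 := [:: b; a * b / c; a * b / d; e'] in
  let lo2 := [:: a * b / c * q / b; a * b / d * q / b; e' * q / b] in
  let den1 := [:: a * b; a * q / c; a * q / d; b / e] in
  let den2 := [:: a * b; c * q / b; d * q / b; e / b] in
  psi_defined up lo q ->
  qpochs_inf q den1 != 0 -> qpochs_inf q den2 != 0 ->
  (admissible q b a c d -> bilateral_cvg (psi_term up lo q (q / b)) /\
     psi up lo q (q / b) = k * limn (series (lhs_term q b a c d))) ->
  [/\ bilateral_cvg (psi_term up lo q (q / b)),
      cvgn (series (phi_term up1 lo1 q (q ^+ 2 / b ^+ 2))),
      cvgn (series (phi_term up2 lo2 q (q ^+ 2 / b ^+ 2))) &
      psi up lo q (q / b) =
        k * {a * q}oo * qpochs_inf q [:: a * b / c; a * b / d; q / e]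
          / qpochs_inf q den1 * phi up1 lo1 q (q ^+ 2 / b ^+ 2)
        + k * {a * q}oo * qpochs_inf q [:: c; d; q / e']
          / qpochs_inf q den2 * phi up2 lo2 q (q ^+ 2 / b ^+ 2)].
Proof.
move=> aE b_gen up lo e e' up1 lo1 up2 lo2 den1 den2 [hlo hup] hd1 hd2 hpsi.
have a0 : a != 0 by rewrite aE expf_neq0.
have den_nonvan x l : qpochs_inf q l != 0 -> x \in l -> nonvan q x.
  rewrite /qpochs_inf prodf_seq_neq0 => /allP h /h /=.
  exact: qpinf_neq0E.
have adm : admissible q b a c d.
  split=> //.
  - by move=> i; apply: hlo; rewrite !inE eqxx ?orbT.
  - by move=> i; apply: hlo; rewrite !inE eqxx ?orbT.
  - by move=> i; apply: hlo; rewrite !inE eqxx ?orbT.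
  - by move=> i; apply: hlo; rewrite !inE eqxx ?orbT.
  - by apply: den_nonvan hd1 _; rewrite !inE eqxx ?orbT.
  - by apply: den_nonvan hd2 _; rewrite !inE eqxx ?orbT.
have [psi_cvg psiE] := hpsi adm.
have adm' := admissible_dual q_gt0 b_neq0 aE adm.
have e'E : a * b / c * (a * b / d) / a = e' := dual_e b q_gt0 aE c_neq0 d_neq0.
have phi1 : phi_term up1 lo1 q (q ^+ 2 / b ^+ 2) = rhs_term q b a c d.
  by apply/funext => n; rewrite phi_term_hq.
have phi2 : phi_term up2 lo2 q (q ^+ 2 / b ^+ 2) = rhs_term q b a (a * b / c) (a * b / d).
  by apply/funext => n; rewrite phi_term_hq /rhs_term e'E.
have id := identity C_arch C_complete q_gt0 q_lt1 b_neq0 qb_lt1 aE b_gen adm.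
split=> //.
- by rewrite phi1; apply: (cvg_rhs C_arch C_complete q_lt1 b_neq0 qb_lt1 adm).
- by rewrite phi2; apply: (cvg_rhs C_arch C_complete q_lt1 b_neq0 qb_lt1 adm').
rewrite psiE /phi phi1 phi2 id //;
  try by move=> n; apply: hup; rewrite !inE eqxx ?orbT.
rewrite mulrDr; congr (_ + _); rewrite mulrA; congr (_ * _).
  rewrite /rhs_factor /kap /qpochs_inf !big_cons !big_nil !invfM !invr1; ring.
rewrite /rhs_factor e'E !(dualK q_gt0 b_neq0 aE) // !(dual_aq q_gt0 b_neq0 aE) //.
have -> : b / e' = e / b by rewrite /e' /e; field; rewrite a0 b_neq0 c_neq0 d_neq0.
rewrite /kap /qpochs_inf !big_cons !big_nil !invfM !invr1; ring.
Qed.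

End Identities.

Theorem theorem10 (R : realType) (q b c d : R[i])
    (q_gt0 : 0 < `|q|) (q_lt1 : `|q| < 1)
    (b_neq0 : b != 0) (c_neq0 : c != 0) (d_neq0 : d != 0)
    (qb_lt1 : `|q / b| < 1) :
  (forall s1 s2 s3 s4 : R[i],
     s1 ^+ 2 = q / b -> s2 ^+ 2 = q ^+ 2 / b ->
     s3 ^+ 2 = q * b -> s4 ^+ 2 = b ->
   let up := [:: s1; - s1; s2; - s2; b; c; d; b / c; b / d] in
   let lo := [:: s3; - s3; s4; - s4;
                 q / b; q / c; q / d; c * q / b; d * q / b] in
   let up1 := [:: b; c; d; c * d] in
   let lo1 := [:: c * q / b; d * q / b; c * d * q / b] in
   let up2 := [:: b; b / c; b / d; b ^+ 2 / (c * d)] in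
   let lo2 := [:: q / c; q / d; b * q / (c * d)] in
   let num1 := [:: q; b / c; b / d; q / (c * d)] in
   let den1 := [:: b; q / c; q / d; b / (c * d)] in
   let num2 := [:: q; c; d; c * d * q / b ^+ 2] in
   let den2 := [:: b; c * q / b; d * q / b; c * d / b] in
   psi_defined up lo q -> phi_defined lo1 q -> phi_defined lo2 q ->
   qpochs_inf q den1 != 0 -> qpochs_inf q den2 != 0 ->
   [/\ bilateral_cvg (psi_term up lo q (q / b)),
       cvgn (series (phi_term up1 lo1 q (q ^+ 2 / b ^+ 2))),
       cvgn (series (phi_term up2 lo2 q (q ^+ 2 / b ^+ 2))) &
       psi up lo q (q / b) =
         qpochs_inf q num1 / qpochs_inf q den1
           * phi up1 lo1 q (q ^+ 2 / b ^+ 2)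
         + qpochs_inf q num2 / qpochs_inf q den2
           * phi up2 lo2 q (q ^+ 2 / b ^+ 2)])
  /\
  (forall s1 s2 s3 s4 : R[i],
     s1 ^+ 2 = q ^+ 2 / b -> s2 ^+ 2 = q ^+ 3 / b ->
     s3 ^+ 2 = q ^+ 2 * b -> s4 ^+ 2 = q * b ->
   let up := [:: s1; - s1; s2; - s2; b; c; d; b * q / c; b * q / d] in
   let lo := [:: s3; - s3; s4; - s4;
                 q ^+ 2 / b; q ^+ 2 / c; q ^+ 2 / d; c * q / b; d * q / b] in
   let up1 := [:: b; c; d; c * d / q] in
   let lo1 := [:: c * q / b; d * q / b; c * d / b] in
   let up2 := [:: b; b * q / c; b * q / d; b ^+ 2 * q / (c * d)] in
   let lo2 := [:: q ^+ 2 / c; q ^+ 2 / d; b * q ^+ 2 / (c * d)] in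
   let num1 := [:: q; b * q / c; b * q / d; q ^+ 2 / (c * d)] in
   let den1 := [:: b * q; q ^+ 2 / c; q ^+ 2 / d; b * q / (c * d)] in
   let num2 := [:: q; c; d; c * d / b ^+ 2] in
   let den2 := [:: b * q; c * q / b; d * q / b; c * d / (b * q)] in
   psi_defined up lo q -> phi_defined lo1 q -> phi_defined lo2 q ->
   qpochs_inf q den1 != 0 -> qpochs_inf q den2 != 0 ->
   [/\ bilateral_cvg (psi_term up lo q (q / b)),
       cvgn (series (phi_term up1 lo1 q (q ^+ 2 / b ^+ 2))),
       cvgn (series (phi_term up2 lo2 q (q ^+ 2 / b ^+ 2))) &
       psi up lo q (q / b) =
         qpochs_inf q num1 / qpochs_inf q den1
           * phi up1 lo1 q (q ^+ 2 / b ^+ 2)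
         + qpochs_inf q num2 / qpochs_inf q den2
           * phi up2 lo2 q (q ^+ 2 / b ^+ 2)]).
Proof.
have q0 : q != 0 by rewrite -normr_gt0.
have arch := @geo_archimedean_complex R.
have compl := @geo_complete_complex R.
have div1 (x y : R[i]) : y != 0 -> 1 - x / y != 0 -> x != y.
  by move=> y0; apply: contraNneq => ->; rewrite divff // subrr.
split=> s1 s2 s3 s4 h1 h2 h3 h4 up lo up1 lo1 up2 lo2 num1 den1 num2 den2 def _ _ hd1 hd2.
  have upE : up = bi_up b 1 c d s1 s2 by rewrite /bi_up !mul1r.
  have loE : lo = bi_lo q b 1 c d s3 s4 by rewrite /bi_lo !mul1r.
  have [hlo hup] := def.
  (* The lower parameters, with s4^2 = b and s3^2 = bq, keep b away from the powers q^-n, n >= 0;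
     the upper parameter b keeps it away from the positive powers of q. *)
  have b_gen : forall m n, b * q ^+ m != q ^+ n.
    apply: qpow_separated => // [|n]; last by apply: hup; rewrite !inE eqxx ?orbT.
    apply: (@nonvan_sqrt _ q s4 s3) => //; first (by rewrite h3 mulrC);
      by move=> i; apply: hlo; rewrite !inE eqxx ?orbT.
  have := @bilateral_identity _ arch compl q b c d q_gt0 q_lt1 b_neq0 c_neq0 d_neq0 qb_lt1
    1 0 s1 s2 s3 s4 1 (esym (expr0 q)) b_gen; cbv zeta.
  rewrite -upE -loE !mul1r !divr1.
  have -> : b / c * q / b = q / c by field; rewrite b_neq0 c_neq0.
  have -> : b / d * q / b = q / d by field; rewrite b_neq0 d_neq0.
  have -> : b ^+ 2 / (c * d) * q / b = b * q / (c * d).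
    by field; rewrite b_neq0 c_neq0 d_neq0.
  have -> : q / (b ^+ 2 / (c * d)) = c * d * q / b ^+ 2.
    by field; rewrite b_neq0 c_neq0 d_neq0.
  rewrite /qpochs_inf !(big_cons _ _ q); apply => //.
  move=> adm; rewrite upE loE.
  apply: (psi_sum1 arch compl q_gt0 q_lt1 b_neq0 qb_lt1 (esym (expr0 q)) b_gen c_neq0 d_neq0
    _ _ _ _ adm) => //; rewrite !mul1r //; [by rewrite h2; ring | by rewrite h3 mulrC].
have upE : up = bi_up b q c d s1 s2 by rewrite /bi_up ![q * b]mulrC.
have loE : lo = bi_lo q b q c d s3 s4 by rewrite /bi_lo -!expr2.
have [hlo hup] := def.
(* The lower parameters in (ii) only control the factors of (bq;q)_n, so b = 1 is excluded
   separately: it would give s1 = q or -s1 = q, where an upper symbol has a pole at index -1. *)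
have b1 : b != 1.
  apply/eqP => b1; move: (h1); rewrite b1 divr1 => /eqP; rewrite eqf_sqr => hs.
  have h x : x \in up -> x != q.
    by move=> /(hup _ 0); apply: contraNneq => ->; rewrite expr1 divff ?subrr.
  case/orP: hs => /eqP hs.
    by have := h s1; rewrite inE eqxx => /(_ isT) /eqP.
  by have := h (- s1); rewrite !inE eqxx orbT => /(_ isT); rewrite hs opprK eqxx.
have nvb : nonvan q b.
  have nvbq : nonvan q (q * b).
    apply: (@nonvan_sqrt _ q s4 s3) => //; first (by rewrite h3; ring);
      by move=> i; apply: hlo; rewrite !inE eqxx ?orbT.
  case=> [|i]; first by rewrite expr0 mulr1 subr_eq0 eq_sym.
  by rewrite exprS mulrA [b * q]mulrC.
have b_gen : forall m n, b * q ^+ m != q ^+ n.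
  by apply: qpow_separated => // n; apply: hup; rewrite !inE eqxx ?orbT.
have := @bilateral_identity _ arch compl q b c d q_gt0 q_lt1 b_neq0 c_neq0 d_neq0 qb_lt1
  q 1 s1 s2 s3 s4 (1 - q) (esym (expr1 q)) b_gen; cbv zeta.
rewrite -upE -loE -(qpinfS arch compl q_lt1 q) ![q * b]mulrC.
have -> : b * q / c * q / b = q ^+ 2 / c by field; rewrite b_neq0 c_neq0.
have -> : b * q / d * q / b = q ^+ 2 / d by field; rewrite b_neq0 d_neq0.
have -> : c * d / q / b = c * d / (b * q) by field; rewrite b_neq0 q0.
have -> : c * d / q * q / b = c * d / b by field; rewrite b_neq0 q0.
have -> : b ^+ 2 / (c * d / q) * q / b = b * q ^+ 2 / (c * d).
  by field; rewrite b_neq0 c_neq0 d_neq0 q0.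
have -> : q / (b ^+ 2 / (c * d / q)) = c * d / b ^+ 2.
  by field; rewrite b_neq0 c_neq0 d_neq0 q0.
have -> : b ^+ 2 / (c * d / q) = b ^+ 2 * q / (c * d).
  by field; rewrite c_neq0 d_neq0 q0.
have -> : b / (c * d / q) = b * q / (c * d) by field; rewrite c_neq0 d_neq0 q0.
have -> : q / (c * d / q) = q ^+ 2 / (c * d) by field; rewrite c_neq0 d_neq0 q0.
rewrite -!expr2 /qpochs_inf !(big_cons _ _ q); apply => //.
move=> adm; rewrite upE loE.
have uq x : x \in up -> x != q.
  by move=> /(hup _ 0%N); rewrite expr1; apply: div1.
have ub x : x != 0 -> b * q / x \in up -> x != b.
  move=> x0 /(hup _ 0%N); rewrite expr1 (_ : b * q / x / q = b / x); last by field; rewrite x0 q0.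
  by move=> /(div1 _ _ x0); rewrite eq_sym.
apply: (psi_sumq arch compl q_gt0 q_lt1 b_neq0 qb_lt1 (esym (expr1 q)) b_gen c_neq0 d_neq0
  _ _ _ _ adm) => //; try (by [rewrite h1 | rewrite h2; ring | rewrite h3; ring]).
- by apply: uq; rewrite !inE eqxx ?orbT.
- by apply: ub => //; rewrite !inE eqxx ?orbT.
- by apply: uq; rewrite !inE eqxx ?orbT.
- by apply: ub => //; rewrite !inE eqxx ?orbT.
Qed.
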